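(* The minimal resolution $(\mathcal{L}ie^2)_\infty$ of the operad $\mathcal{L}ie^2$ of pairs of linearly compatible Lie algebras is the quasi-free operad on the $\mathbb S$-module $E=\{E(n)\}_{n\ge2}$ with $$E(n)=\underbrace{\mathrm{sgn}_n\oplus\dots\oplus\mathrm{sgn}_n}_{n\text{ copies}}[n-2]\quad(n\ge2),$$ and $0$ otherwise. Denoting the natural basis of $E(n)$ by $c_n(i)$, $0\le i\le n-1$ (inputs $1,\dots,n$ in natural order), the differential is given by $$\partial\,c_n(i)=\sum(-1)^{\mathrm{sgn}(\tau)+(k-1)(n-k+1)}\ G(i_1,i_2;\tau,k),$$ where the sum is over $2\le k\le n-1$, $i_1+i_2=i$ (with $0\le i_1\le k-1$, $0\le i_2\le n-k$), and $(k,n-k)$-shuffles $\tau$. Here $G(i_1,i_2;\tau,k)$ is the two-vertex tree whose upper vertex is decorated by $c_k(i_1)$ with inputs $\tau(1),\dots,\tau(k)$, and whose lower (root) vertex is decorated by $c_{n-k+1}(i_2)$ with inputs $e,\tau(k+1),\dots,\tau(n)$, $e$ being the output of the upper vertex.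
   Context: $\mathbb K$ is a field of characteristic zero; $V[i]_j=V_{i+j}$; differentials have degree $+1$; $\mathrm{sgn}_n$ is the sign representation of $\mathbb S_n$; in signs, $\mathrm{sgn}(\tau)$ denotes the parity of $\tau$. Vertices of decorated trees carry Koszul signs when reordered, and a displayed two-vertex tree carries the ordered decoration upper $\otimes$ lower. $\mathcal{L}ie^2$ is the quadratic operad whose algebras are vector spaces with two Lie brackets $[\cdot,\cdot]_1,[\cdot,\cdot]_2$ (degree $0$) that are compatible, i.e. $[\cdot,\cdot]_1+[\cdot,\cdot]_2$ is again a Lie bracket. A quasi-free operad is a dg operad that is free as an operad. A minimal resolution of an operad $\mathcal Q$ is a quasi-free operad $(\mathcal F(E),\partial)$ with a quasi-isomorphism to $\mathcal Q$ (with zero differential on $\mathcal Q$) such that $\partial(E)$ lies in the part of $\mathcal F(E)$ spanned by trees with at least two vertices. *)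

(* Defs.v *)
(* MathComp world: algebraic operads in graded vector spaces over a field. *)
From HB Require Import structures.
From mathcomp Require Import all_boot all_order all_algebra all_fingroup.

Set Implicit Arguments.
Unset Strict Implicit.
Unset Printing Implicit Defensive.

Import Order.TTheory GRing.Theory Num.Theory.
Local Open Scope ring_scope.

(** ** Graded vector spaces and S-modules *)

(* A Z-graded vector space is the total space of a direct sum; [homog d] is
   its component of degree d. *)
Record graded_space (K : fieldType) := GradedSpace {
  gs_sort :> lmodType K;
  homog : int -> gs_sort -> Prop;
  homog0 : forall d, homog d 0;
  homog_linear : forall d (a : K) x y,
    homog d x -> homog d y -> homog d (a *: x + y);
  homog_span : forall x, exists (s : seq int) (f : int -> gs_sort),
    (forall d, homog d (f d)) /\ x = \sum_(d <- s) f d;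
  homog_indep : forall (s : seq int) (f : int -> gs_sort), uniq s ->
    (forall d, homog d (f d)) -> \sum_(d <- s) f d = 0 ->
    forall d, d \in s -> f d = 0 }.

(* [relabel x s] relabels inputs: what was input j of x becomes input [s j].  Since
   MathComp's [s * t] is "first s, then t", this is a right action. *)
Record smodule (K : fieldType) := SModule {
  sm_sort :> nat -> graded_space K;
  relabel : forall n, sm_sort n -> 'S_n -> sm_sort n;
  act_linear : forall n (s : 'S_n), linear (fun x : sm_sort n => relabel x s);
  act_homog : forall n (s : 'S_n) d (x : sm_sort n),
    homog d x -> homog d (relabel x s);
  act1 : forall n (x : sm_sort n), relabel x 1%g = x;
  actM : forall n (x : sm_sort n) (s t : 'S_n),
    relabel (relabel x s) t = relabel x (s * t)%g }.

Definition is_smodule_morphism (K : fieldType) (P Q : smodule K)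
    (f : forall n, {linear P n -> Q n}) : Prop :=
  (forall n d (x : P n), homog d x -> homog d (f n x)) /\
  (forall n (x : P n) (s : 'S_n), f n (relabel x s) = relabel (f n x) s).

(** ** Operads *)

(* Position, in a tree whose input i has been replaced by an n-ary tree, of the
   old input j <> i.  Input j of the grafted tree sits at position i + j. *)
Definition outer_pos (n i j : nat) : nat :=
  if (j < i)%N then j else (j + n).-1.

(* [pcomp h i a b] is the partial composition a o_i b, of arity p = m + n - 1.
   The arity p is an independent index, tied to m and n by h, so that the
   associativity axioms need no transport between equal arities.  A composite
   a o_i b carries the ordering a (x) b of its factors, whence the Koszul sign
   in [comp_par].  In [comp_act], r is the permutation of the inputs of
   a o_i b induced by s and t. *)
Record operad (K : fieldType) := Operad {
  op_smodule :> smodule K;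
  unit_op : op_smodule 1%N;
  pcomp : forall m n p, (m + n = p.+1)%N -> 'I_m ->
    op_smodule m -> op_smodule n -> op_smodule p;
  unit_homog : homog 0 unit_op;
  comp_linearl : forall m n p (h : (m + n = p.+1)%N) i (b : op_smodule n),
    linear (fun a : op_smodule m => pcomp h i a b);
  comp_linearr : forall m n p (h : (m + n = p.+1)%N) i (a : op_smodule m),
    linear (pcomp h i a);
  comp_homog : forall m n p (h : (m + n = p.+1)%N) i d e
      (a : op_smodule m) (b : op_smodule n),
    homog d a -> homog e b -> homog (d + e) (pcomp h i a b);
  comp1l : forall n (h : (1 + n = n.+1)%N) (i : 'I_1) (a : op_smodule n),
    pcomp h i unit_op a = a;
  comp1r : forall n (h : (n + 1 = n.+1)%N) (i : 'I_n) (a : op_smodule n),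
    pcomp h i a unit_op = a;
  comp_seq : forall m n l q r p
      (hab : (m + n = q.+1)%N) (hab_c : (q + l = p.+1)%N)
      (hbc : (n + l = r.+1)%N) (ha_bc : (m + r = p.+1)%N)
      (i : 'I_m) (j : 'I_n) (x : 'I_q)
      (a : op_smodule m) (b : op_smodule n) (c : op_smodule l),
    x = (i + j)%N :> nat ->
    pcomp hab_c x (pcomp hab i a b) c = pcomp ha_bc i a (pcomp hbc j b c);
  comp_par : forall m n l q r p
      (hab : (m + n = q.+1)%N) (hab_c : (q + l = p.+1)%N)
      (hac : (m + l = r.+1)%N) (hac_b : (r + n = p.+1)%N)
      (i k : 'I_m) (x : 'I_q) (y : 'I_r) (d e : int)
      (a : op_smodule m) (b : op_smodule n) (c : op_smodule l),
    (i < k)%N -> x = outer_pos n i k :> nat -> y = outer_pos l k i :> nat ->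
    homog d b -> homog e c ->
    pcomp hab_c x (pcomp hab i a b) c
      = (-1) ^ (d * e) *: pcomp hac_b y (pcomp hac k a c) b;
  comp_act : forall m n p (h : (m + n = p.+1)%N) (i : 'I_m)
      (s : 'S_m) (t : 'S_n) (r : 'S_p) (a : op_smodule m) (b : op_smodule n),
    (forall (j : 'I_m) (u : 'I_p), j != i ->
       u = outer_pos n i j :> nat -> r u = outer_pos n (s i) (s j) :> nat) ->
    (forall (j : 'I_n) (u : 'I_p),
       u = (i + j)%N :> nat -> r u = (s i + t j)%N :> nat) ->
    pcomp h (s i) (relabel a s) (relabel b t) = relabel (pcomp h i a b) r }.

Arguments unit_op {K} o.

Definition is_operad_morphism (K : fieldType) (P Q : operad K)
    (f : forall n, {linear P n -> Q n}) : Prop :=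
  [/\ is_smodule_morphism f,
      f 1%N (unit_op P) = unit_op Q &
      forall m n p (h : (m + n = p.+1)%N) (i : 'I_m) (a : P m) (b : P n),
        f p (pcomp h i a b) = pcomp h i (f m a) (f n b)].

(** ** Differential graded operads *)

Record dg_operad (K : fieldType) := DGOperad {
  dg_op :> operad K;
  diff : forall n, {linear dg_op n -> dg_op n};
  diff_homog : forall n d (x : dg_op n), homog d x -> homog (d + 1) (diff n x);
  diff_sq : forall n (x : dg_op n), diff n (diff n x) = 0;
  diff_act : forall n (x : dg_op n) (s : 'S_n),
    diff n (relabel x s) = relabel (diff n x) s;
  diff_comp : forall m n p (h : (m + n = p.+1)%N) (i : 'I_m) (d : int)
      (a : dg_op m) (b : dg_op n), homog d a ->
    diff p (pcomp h i a b)
      = pcomp h i (diff m a) b + (-1) ^ d *: pcomp h i a (diff n b) }.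

Arguments diff {K} _ {n}.

Lemma act0 (K : fieldType) (P : smodule K) n (s : 'S_n) :
  relabel (0 : P n) s = 0.
Proof.
have := act_linear s (-1) (0 : P n) 0.
by rewrite scaler0 addr0 scaleN1r addNr.
Qed.

Lemma comp0l (K : fieldType) (P : operad K) m n p (h : (m + n = p.+1)%N)
  (i : 'I_m) (b : P n) : pcomp h i (0 : P m) b = 0.
Proof.
have := comp_linearl h i b (-1) 0 0.
by rewrite scaler0 addr0 scaleN1r addNr.
Qed.

Lemma comp0r (K : fieldType) (P : operad K) m n p (h : (m + n = p.+1)%N)
  (i : 'I_m) (a : P m) : pcomp h i a (0 : P n) = 0.
Proof.
have := comp_linearr h i a (-1) 0 0.
by rewrite scaler0 addr0 scaleN1r addNr.
Qed.

Section ZeroDifferential.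
Variables (K : fieldType) (P : operad K).

Definition zero_diff n : {linear P n -> P n} := \0.

Fact zero_diff_homog n d (x : P n) : homog d x -> homog (d + 1) (zero_diff n x).
Proof. by move=> _; exact: homog0. Qed.

Fact zero_diff_sq n (x : P n) : zero_diff n (zero_diff n x) = 0.
Proof. by []. Qed.

Fact zero_diff_act n (x : P n) (s : 'S_n) :
  zero_diff n (relabel x s) = relabel (zero_diff n x) s.
Proof. by rewrite /= act0. Qed.

Fact zero_diff_comp m n p (h : (m + n = p.+1)%N) (i : 'I_m) (d : int)
    (a : P m) (b : P n) : homog d a ->
  zero_diff p (pcomp h i a b)
    = pcomp h i (zero_diff m a) b + (-1) ^ d *: pcomp h i a (zero_diff n b).
Proof. by move=> _; rewrite /= comp0l comp0r scaler0 addr0. Qed.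

Definition zero_dg : dg_operad K :=
  DGOperad zero_diff_homog zero_diff_sq zero_diff_act zero_diff_comp.
End ZeroDifferential.

(* The last two clauses say that the map induced by f on ker diff / im diff is
   injective, resp. surjective, in every arity. *)
Definition is_quasi_isomorphism (K : fieldType) (P Q : dg_operad K)
    (f : forall n, {linear P n -> Q n}) : Prop :=
  [/\ is_operad_morphism f,
      forall n (x : P n), f n (diff P x) = diff Q (f n x),
      forall n (x : P n), diff P x = 0 ->
        (exists y : Q n, f n x = diff Q y) -> exists z : P n, x = diff P z &
      forall n (y : Q n), diff Q y = 0 ->
        exists x : P n, diff P x = 0 /\ exists z : Q n, f n x - y = diff Q z].

(** ** Free operads and minimal resolutions *)

Definition is_free_operad (K : fieldType) (E : smodule K) (F : operad K)
    (iota : forall n, {linear E n -> F n}) : Prop :=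
  is_smodule_morphism iota /\
  forall (P : operad K) (g : forall n, {linear E n -> P n}),
    is_smodule_morphism g ->
    exists f : forall n, {linear F n -> P n},
      [/\ is_operad_morphism f,
          forall n (e : E n), f n (iota n e) = g n e &
          forall f' : forall n, {linear F n -> P n},
            is_operad_morphism f' ->
            (forall n (e : E n), f' n (iota n e) = g n e) ->
            forall n (x : F n), f' n x = f n x].

(* [tree_monomial iota w x]: x is a tree with w vertices decorated by E; the
   unit is the tree without vertices. *)
Inductive tree_monomial (K : fieldType) (E : smodule K) (F : operad K)
    (iota : forall n, {linear E n -> F n}) : nat -> forall n, F n -> Prop :=
| Tree_unit : tree_monomial iota 0 (unit_op F)
| Tree_corolla n (e : E n) : tree_monomial iota 1 (iota n e)
| Tree_graft v w m n p (h : (m + n = p.+1)%N) (i : 'I_m) (a : F m) (b : F n) :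
    tree_monomial iota v a -> tree_monomial iota w b ->
    tree_monomial iota (v + w) (pcomp h i a b)
| Tree_relabel w n (a : F n) (s : 'S_n) :
    tree_monomial iota w a -> tree_monomial iota w (relabel a s).

Definition spanned_by_trees_ge2 (K : fieldType) (E : smodule K) (F : operad K)
    (iota : forall n, {linear E n -> F n}) n (x : F n) : Prop :=
  exists (r : nat) (a : 'I_r -> K) (t : 'I_r -> F n),
    (forall j, exists2 w, (2 <= w)%N & tree_monomial iota w (t j)) /\
    x = \sum_(j < r) a j *: t j.

Definition is_minimal_resolution (K : fieldType) (Q : operad K)
    (E : smodule K) (F : dg_operad K) (iota : forall n, {linear E n -> F n})
    (phi : forall n, {linear F n -> zero_dg Q n}) : Prop :=
  [/\ is_free_operad iota,
      is_quasi_isomorphism phi &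
      forall n (e : E n), spanned_by_trees_ge2 iota (diff F (iota n e))].

(** ** The operad of pairs of compatible Lie brackets *)

(* The Jacobi identity is the vanishing of the sum of the relabellings of
   [[1,2],3] by the powers of the 3-cycle [ordS]. *)
Definition is_lie_bracket (K : fieldType) (P : operad K) (b : P 2%N) : Prop :=
  [/\ homog 0 b,
      relabel b (tperm ord0 ord_max) = - b &
      \sum_(k < 3)
        relabel (pcomp (erefl : (2 + 2 = 4)%N) ord0 b b)
            (perm (@ordS_inj 3) ^+ k)%g = 0].

Definition is_compatible_pair (K : fieldType) (P : operad K)
    (b1 b2 : P 2%N) : Prop :=
  [/\ is_lie_bracket b1, is_lie_bracket b2 & is_lie_bracket (b1 + b2)].

(* L is presented by the generators b1, b2 and the relations of
   [is_compatible_pair].  For P an endomorphism operad, this says that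
   L-algebras are vector spaces with two compatible Lie brackets. *)
Definition is_Lie2 (K : fieldType) (L : operad K) (b1 b2 : L 2%N) : Prop :=
  is_compatible_pair b1 b2 /\
  forall (P : operad K) (c1 c2 : P 2%N), is_compatible_pair c1 c2 ->
    exists f : forall n, {linear L n -> P n},
      [/\ is_operad_morphism f, f 2%N b1 = c1, f 2%N b2 = c2 &
          forall f' : forall n, {linear L n -> P n},
            is_operad_morphism f' -> f' 2%N b1 = c1 -> f' 2%N b2 = c2 ->
            forall n (x : L n), f' n x = f n x].

(** ** The generators c_n(i) *)

Definition gen_mult (n : nat) : nat := if (2 <= n)%N then n else 0%N.

Section Generators.
Variable K : fieldType.

(* With V[i]_j = V_{i+j} and sgn_n in degree 0, the component of degree d is
   nonzero only if (n - 2) + d = 0, i.e. d = 2 - n. *)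
Definition gen_homog n (d : int) (v : 'rV[K]_(gen_mult n)) : Prop :=
  n%:Z - 2 + d = 0 \/ v = 0.

Fact gen_homog0 n d : @gen_homog n d 0.
Proof. by right. Qed.

Fact gen_homog_linear n d (a : K) (x y : 'rV[K]_(gen_mult n)) :
  gen_homog d x -> gen_homog d y -> gen_homog d (a *: x + y).
Proof.
case=> [e|->]; first by left.
by case=> [e|->]; [left | right; rewrite scaler0 addr0].
Qed.

Fact gen_homog_span n (x : 'rV[K]_(gen_mult n)) :
  exists (s : seq int) (f : int -> 'rV[K]_(gen_mult n)),
    (forall d, gen_homog d (f d)) /\ x = \sum_(d <- s) f d.
Proof.
exists [:: - (n%:Z - 2)], (fun d => if n%:Z - 2 + d == 0 then x else 0).
split=> [d|]; first by case: eqP => [e|_]; [left | right].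
by rewrite big_seq1 subrr eqxx.
Qed.

Fact gen_homog_indep n (s : seq int) (f : int -> 'rV[K]_(gen_mult n)) :
  uniq s -> (forall d, gen_homog d (f d)) -> \sum_(d <- s) f d = 0 ->
  forall d, d \in s -> f d = 0.
Proof.
move=> us hf sum0 d ds; case: (hf d) => // hd.
move: sum0; rewrite (bigD1_seq d) //= big1 ?addr0 // => e ne.
case: (hf e) => // he; case/eqP: ne.
by apply: (addrI (n%:Z - 2)); rewrite he hd.
Qed.

Definition gen_space n : graded_space K :=
  GradedSpace (@gen_homog0 n) (@gen_homog_linear n) (@gen_homog_span n)
    (@gen_homog_indep n).

Definition gen_act n (v : gen_space n) (s : 'S_n) : gen_space n :=
  (-1) ^+ s *: v.

Fact gen_act_linear n (s : 'S_n) :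
  linear (fun x : gen_space n => gen_act x s).
Proof.
by move=> a x y; rewrite /gen_act scalerDr !scalerA mulrC.
Qed.

Fact gen_act_homog n (s : 'S_n) d (x : gen_space n) :
  homog d x -> homog d (gen_act x s).
Proof.
move=> hx; rewrite /gen_act -[X in homog d X]addr0.
by apply: homog_linear => //; exact: homog0.
Qed.

Fact gen_act1 n (x : gen_space n) : gen_act x 1%g = x.
Proof. by rewrite /gen_act odd_perm1 expr0 scale1r. Qed.

Fact gen_actM n (x : gen_space n) (s t : 'S_n) :
  gen_act (gen_act x s) t = gen_act x (s * t)%g.
Proof. by rewrite /gen_act scalerA odd_permM signr_addb mulrC. Qed.

Definition gens : smodule K :=
  SModule gen_act_linear gen_act_homog gen_act1 gen_actM.

Definition gen_basis (n i : nat) : gens n :=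
  (\row_(j < gen_mult n) (j == i :> nat)%:R : 'rV[K]_(gen_mult n)).
End Generators.

(** ** Two-vertex trees *)

Definition is_shuffle (n k : nat) (t : 'S_n) : bool :=
  [forall i : 'I_n, forall j : 'I_n,
     (i < j)%N && ((j < k)%N || (k <= i)%N) ==> (t i < t j)%N].

Lemma arity_split (n : nat) (k : 'I_n) : ((n - k).+1 + k = n.+1)%N.
Proof. by rewrite addSn subnK // ltnW. Qed.

(* Upper vertex u with inputs t(1), ..., t(k), its output being the first input
   of the root vertex v, whose other inputs are t(k+1), ..., t(n).  The tree
   carries the ordered decoration u (x) v, whereas [pcomp] carries v (x) u: hence
   the Koszul sign, du and dv being the degrees of u and v. *)
Definition two_vertex_tree (K : fieldType) (F : operad K) (n : nat) (k : 'I_n)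
    (t : 'S_n) (du dv : int) (u : F k) (v : F (n - k).+1) : F n :=
  (-1) ^ (du * dv) *: relabel (pcomp (arity_split k) ord0 v u) t.

Definition gen_degree (n : nat) : int := 2 - n%:Z.

(* Main.v *)
(* The free operad is realised on the antisymmetric functions on words of decorated
   clusters: trees are nested families of subsets of the leaves, and the weight (i, j)
   of a vertex stands for c_{i+j+1}(i).  In these coordinates the differential becomes
   the transposed edge contraction adding the weights of the two ends of the edge,
   whose square vanishes because contractions of two edges commute and appear with
   opposite signs.

   Acyclicity outside degree 0 is a discrete Morse argument: every tree which is not
   binary, and some binary ones, are matched with a tree having one vertex more or
   less, and a rank function shows that the matching has no cycles.

   The homology in degree 0 needs no dimension count.  The quotient Q of the complex by
   boundaries and negative degrees is an operad carrying a compatible pair of brackets,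
   because d c_3(i) are the three Jacobi identities.  So the universal property of Lie^2
   gives f : Lie^2 -> Q; the projection equals f o phi by freeness, which makes phi
   injective in homology, and phi factors through Q into a retraction of f, which makes
   phi surjective. *)
Require Import Defs.
From HB Require Import structures.
From mathcomp Require Import all_boot all_order all_algebra all_fingroup.
From mathcomp Require Import boolp functions.
From mathcomp Require Import zify ring.

Set Implicit Arguments.
Unset Strict Implicit.
Unset Printing Implicit Defensive.

Import GRing.Theory.
Local Open Scope ring_scope.

(** * Signs of words *)

(** Three obstacles shape the construction. Signs: degrees 2 - n and sign representations would make
    every formula depend on all arities. An operadic suspension makes all vertices odd and all
    corollas symmetric; arities then reappear only in the exponents of a composition and in the sign
    of a relabelling. Matching: gathering the inputs of a vertex other than its stem into a new
    vertex leaves a choice, since a weight (i, j) splits in several ways. The split leaving (0, 1)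
    at the lower vertex is preferred. What it never produces, weight (1, 0) below a branch with
    nonzero second weight, is critical, and the search continues in the branch and in the stem. As
    the differential is a transpose, a primitive comes from equations that are triangular with
    respect to the rank. Freeness: a tree is an iterated composite in many ways, and no normal form
    is chosen. The relation between constructed trees and their values in [P] is shown to be single
    valued, by cutting two constructions at a common inner edge; associativity in [P] enters only
    when a cut is moved to the outside. *)

Section SignedWords.
Variables (R : comNzRingType) (T : eqType).
Implicit Types (u v w : seq T) (P Q : pred T) (a : seq T -> R).

Definition antisym a := forall u x y v, a (u ++ x :: y :: v) = - a (u ++ y :: x :: v).

Lemma antisym_move a u x v :
  antisym a -> a (u ++ x :: v) = (-1) ^+ size u * a (x :: u ++ v).
Proof.
move=> asa; elim/last_ind: u v => [|u y IH] v; first by rewrite mul1r.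
by rewrite cat_rcons asa IH size_rcons exprS mulN1r mulNr cat_rcons.
Qed.

Lemma antisym_cons a x : antisym a -> antisym (fun w => a (x :: w)).
Proof. by move=> asa u y z v; exact: (asa (x :: u)). Qed.

(** One sign serves all antisymmetric functions. Two such functions can thus be compared on
    reordered words without computing the sign of the reordering. *)
Lemma antisym_perm w w' : perm_eq w w' ->
  exists e : bool, forall a, antisym a -> a w' = (-1) ^+ e * a w.
Proof.
elim: w w' => [|x w IH] w'.
  rewrite perm_sym => /perm_nilP ->; exists false => a _; by rewrite mul1r.
move=> pw; have xw' : x \in w' by rewrite -(perm_mem pw) mem_head.
case/splitPr: xw' pw => u v pw.
have /IH[e He] : perm_eq w (u ++ v).
  by rewrite -(perm_cons x) (perm_trans pw) // -cat1s perm_catCA.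
exists (odd (size u) (+) e) => a asa.
rewrite antisym_move // (He (fun w => a (x :: w))) ?mulrA; last exact: antisym_cons.
by rewrite signr_addb signr_odd.
Qed.

(** Counts the pairs in which a letter of [P] precedes a letter of [Q]. When [Q] is the complement
    of [P], the parity is the Koszul sign of moving all letters of [P] behind the others. *)
Fixpoint cross P Q w :=
  if w is x :: u then ((if P x then count Q u else 0) + cross P Q u)%N else 0%N.

Lemma eq_cross P P' Q Q' w : {in w, P =1 P'} -> {in w, Q =1 Q'} ->
  cross P Q w = cross P' Q' w.
Proof.
elim: w => //= x w IH eP eQ; rewrite eP ?mem_head //.
rewrite (@eq_in_count _ Q Q') ?IH // => y yw; by [apply: eP; rewrite inE yw orbT | apply: eQ; rewrite inE yw orbT].
Qed.

Lemma cross_swap P u x y v :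
  odd (cross P (predC P) (u ++ x :: y :: v)) =
  (P x != P y) (+) odd (cross P (predC P) (u ++ y :: x :: v)).
Proof.
elim: u => [|z u IH] /=; last first.
  rewrite !oddD IH !count_cat /= (addnCA (~~ P x)).
  by case: (P x != P y); rewrite ?addbN.
case: (P x); case: (P y) => //=; rewrite ?add0n ?add1n ?addn0 //= ?negbK //.
Qed.

Lemma cross_filter P Q Q' w :
  cross P Q (filter Q' w) = cross (predI P Q') (predI Q Q') w.
Proof.
elim: w => //= x w IH; case Qx: (Q' x) => /=; rewrite ?andbT ?andbF /= ?IH //.
by rewrite count_filter.
Qed.

Lemma cross0 P Q w : {in w, forall x, ~~ P x} -> cross P Q w = 0%N.
Proof.
elim: w => //= x w IH nP; rewrite (negbTE (nP x _)) ?mem_head // IH // => y yw.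
by rewrite nP // inE yw orbT.
Qed.

Lemma cross0r P Q w : {in w, forall x, ~~ Q x} -> cross P Q w = 0%N.
Proof.
elim: w => //= x w IH nQ; rewrite IH; last by move=> y yw; rewrite nQ // inE yw orbT.
rewrite addn0 (_ : count Q w = 0%N) ?if_same //.
apply/eqP; rewrite -leqn0 leqNgt -has_count; apply/hasPn => y yw.
by rewrite nQ // inE yw orbT.
Qed.

(** Both sides count the exchanges that sort the word into the three groups outside [Q], in [Q] but
    not in [P], in [P]: either [P] is extracted first, or [Q] first and then [P] inside it. This is
    the sign of sequential associativity. *)
Lemma cross_seq P Q w : (forall x, P x -> Q x) ->
  (cross P (predC P) w + cross Q (predC Q) (filter (predC P) w) =
   cross Q (predC Q) w + cross P (predC P) (filter Q w))%N.
Proof.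
move=> PQ; rewrite !cross_filter; elim: w => //= x w IH.
have E : count (predC P) w = (count (predC Q) w + count (predI (predC P) Q) w)%N.
  elim: w {IH} => //= y w ->; case Py: (P y) => /=; first by rewrite PQ //; lia.
  by case: (Q y) => /=; lia.
have E' : count (predI (predC Q) (predC P)) w = count (predC Q) w.
  by apply: eq_count => y /=; case Py: (P y) => /=; [rewrite PQ|rewrite andbT].
case Px: (P x) => /=; first by rewrite PQ //=; lia.
by case: (Q x) => /=; lia.
Qed.

Lemma cross_sym P Q w : (forall x, ~~ (P x && Q x)) ->
  (cross P Q w + cross Q P w = count P w * count Q w)%N.
Proof.
move=> PQ; elim: w => //= x w IH; have := PQ x.
by case: (P x); case: (Q x) => //= _; lia.
Qed.

Lemma cross_addr P Q Q' w : (forall x, ~~ (Q x && Q' x)) ->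
  cross P (predU Q Q') w = (cross P Q w + cross P Q' w)%N.
Proof.
move=> QQ; elim: w => //= x w ->.
rewrite (_ : count (predU Q Q') w = count Q w + count Q' w)%N; first by case: (P x); lia.
rewrite -count_predUI (@eq_count _ (predI Q Q') pred0) ?count_pred0 ?addn0 //.
by move=> y /=; apply/negbTE/QQ.
Qed.

(** The left side sorts into rest, [P], [Q], the right side into rest, [Q], [P]; exchanging the two
    last groups gives the product of their sizes. This is the sign of parallel associativity. *)
Lemma cross_par P Q w : (forall x, ~~ (P x && Q x)) ->
  odd (cross Q (predC Q) w + cross P (predC P) (filter (predC Q) w)) =
  odd (cross P (predC P) w + cross Q (predC Q) (filter (predC P) w))
  (+) odd (count P w * count Q w).
Proof.
move=> PQ; have QP x : ~~ (Q x && P x) by rewrite andbC.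
pose A := predI (predC P) (predC Q).
have nPA x : ~~ (P x && A x) by rewrite /A /=; case: (P x).
have nQA x : ~~ (Q x && A x) by rewrite /A /=; case: (Q x); rewrite ?andbF.
have EQ : cross Q (predC Q) w = (cross Q P w + cross Q A w)%N.
  rewrite -cross_addr //; apply: eq_cross => // x _ /=.
  by have := PQ x; case: (P x); case: (Q x).
have EP : cross P (predC P) w = (cross P Q w + cross P A w)%N.
  rewrite -cross_addr //; apply: eq_cross => // x _ /=.
  by have := PQ x; case: (P x); case: (Q x).
rewrite !cross_filter EQ EP -(cross_sym w PQ).
rewrite (@eq_cross (predI P _) P _ A) //; last first.
  by move=> x _ /=; have := PQ x; case: (P x); case: (Q x).
rewrite (@eq_cross (predI Q _) Q _ A) //; last 2 first.
- by move=> x _ /=; have := PQ x; case: (P x); case: (Q x).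
- by move=> x _ /=; rewrite andbC.
rewrite !oddD; by do 4!case: (odd _).
Qed.
End SignedWords.

(** * Trees as nested sets, and a discrete Morse matching *)

Section Weights.
Variable X : finType.
Local Notation weight := (nat * nat)%type.
Implicit Types (S T Y Z P : {set X}) (t : {set X} -> weight) (v : weight).

Definition wt v := (v.1 + v.2)%N.
Definition padd v v' : weight := ((v.1 + v'.1)%N, (v.2 + v'.2)%N).
Definition psub v v' : weight := ((v.1 - v'.1)%N, (v.2 - v'.2)%N).

Lemma wt_padd v v' : wt (padd v v') = (wt v + wt v')%N.
Proof. by rewrite /wt /=; lia. Qed.

Definition pr t S := (0 < wt (t S))%N.

Lemma prN t S : ~~ pr t S -> t S = (0%N, 0%N).
Proof. by rewrite /pr /wt; case: (t S) => [[|i] [|j]]. Qed.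

Lemma prNE t S : ~~ pr t S -> wt (t S) = 0%N.
Proof. by move/prN->. Qed.

Definition lam S T := [|| S \subset T, T \subset S | [disjoint S & T]].

Lemma lam_sym S T : lam S T = lam T S.
Proof. by rewrite /lam disjoint_sym orbCA. Qed.

Definition tsum t Y := (\sum_(T : {set X} | T \subset Y) wt (t T))%N.

(* A tree with set of leaves X is encoded by the set of leaves above each of its
   vertices (its clusters): [t S = (i, j)] says that the vertex with leaves S is
   decorated by c_n(i) with n = i + j + 1, and [(0, 0)] that S is not a cluster.
   The last condition counts the inputs of the vertices above S. *)
Definition nested t :=
  (forall S T, pr t S -> pr t T -> lam S T) /\
  (forall S, pr t S -> tsum t S = #|S|.-1).

(** The chosen leaf depends on the set alone and not on the tree, hence survives every contraction
    and insertion. *)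
Definition pt S : {set X} := if [pick x in S] is Some x then [set x] else set0.

(* The child of S (cluster or leaf) containing a chosen leaf of S. *)
Definition stem t S : {set X} :=
  pt S :|: \bigcup_(T | [&& pr t T, T \proper S & pt S \subset T]) T.

Definition branch t S := S :\: stem t S.

Lemma pt_sub S : pt S \subset S.
Proof. by rewrite /pt; case: pickP => [x xS|_]; rewrite ?sub1set ?sub0set. Qed.

Lemma card_pt S : S != set0 -> #|pt S| = 1%N.
Proof.
move=> /set0Pn[y yS]; rewrite /pt; case: pickP => [x _|/(_ y)]; first exact: cards1.
by rewrite yS.
Qed.

Lemma stem_eq t S P :
  (P = pt S \/ [&& pr t P, P \proper S & pt S \subset P]) ->
  (forall T, pr t T -> T \proper S -> pt S \subset T -> T \subset P) ->
  stem t S = P.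
Proof.
move=> hP hT; apply/eqP; rewrite eqEsubset; apply/andP; split.
  rewrite /stem subUset; apply/andP; split.
    by case: hP => [->//|/and3P[]].
  by apply/bigcupsP => T /and3P[]; exact: hT.
case: hP => [->|hP]; first exact: subsetUl.
by rewrite (subset_trans _ (subsetUr _ _)) // (bigcup_sup P).
Qed.

Lemma stem_max t S T : pr t T -> T \proper S -> pt S \subset T -> T \subset stem t S.
Proof.
by move=> h1 h2 h3; rewrite (subset_trans _ (subsetUr _ _)) // (bigcup_sup T) ?h1 ?h2.
Qed.

Lemma pt_stem t S : pt S \subset stem t S.
Proof. exact: subsetUl. Qed.

Lemma stem_sub t S : stem t S \subset S.
Proof.
rewrite subUset pt_sub; apply/bigcupsP => T /and3P[_ /proper_sub] //.
Qed.

Lemma branch_sub t S : branch t S \subset S.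
Proof. exact: subsetDl. Qed.

Lemma stem_branch t S : stem t S :&: branch t S = set0.
Proof. by rewrite /branch setIDA setDE setIAC setICr set0I. Qed.

Lemma card_stem_branch t S : (#|stem t S| + #|branch t S|)%N = #|S|.
Proof. by rewrite -[RHS](cardsID (stem t S)) (setIidPr (stem_sub _ _)). Qed.

Section Nested.
Variables (t : {set X} -> weight) (nt : nested t).

Lemma wt_tsum S Y : S \subset Y -> (wt (t S) <= tsum t Y)%N.
Proof. by move=> SY; rewrite /tsum (bigD1 S) //= leq_addr. Qed.

Lemma pr_card S : pr t S -> (1 < #|S|)%N.
Proof.
move=> pS; have := nt.2 _ pS; have := wt_tsum (subxx S); move: pS; rewrite /pr; lia.
Qed.

Lemma pr_neq0 S : pr t S -> S != set0.
Proof. by move/pr_card; rewrite -card_gt0; lia. Qed.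

Lemma lam_pt S T T' : S != set0 -> pt S \subset T -> pt S \subset T' ->
  pr t T -> pr t T' -> (T \subset T') || (T' \subset T).
Proof.
move=> S0 hT hT' pT pT'; have := nt.1 _ _ pT pT'; rewrite /lam orbA => /orP[//|].
move=> dT; have : pt S \subset T :&: T' by rewrite subsetI hT.
rewrite (eqP (_ : T :&: T' == set0)) ?setI_eq0 // subset0 => /eqP E.
by have := card_pt S0; rewrite E cards0.
Qed.

Lemma stemP S : S != set0 -> stem t S = pt S \/
  [&& pr t (stem t S), stem t S \proper S & pt S \subset stem t S].
Proof.
move=> S0; pose q T := [&& pr t T, T \proper S & pt S \subset T].
case: (pickP q) => [T0 qT0|q0]; last first.
  by left; rewrite /stem big_pred0 ?setU0.
right; case: (arg_maxnP (fun T : {set X} => #|T|) qT0) => T qT maxT.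
suff -> : stem t S = T by [].
apply: stem_eq; [by right | move=> T' p1 p2 p3].
have /and3P[p1' p2' p3'] := qT.
have := lam_pt S0 p3 p3' p1 p1' => /orP[//|sub].
suff /eqP-> : T == T' by [].
by rewrite eqEcard sub; apply: maxT; rewrite /q p1 p2 p3.
Qed.

Lemma stem_proper S : (1 < #|S|)%N -> stem t S \proper S.
Proof.
move=> S1; have S0 : S != set0 by rewrite -card_gt0; lia.
case: (stemP S0) => [->|/and3P[]//].
by rewrite properEcard pt_sub card_pt.
Qed.

Lemma card_stem S : S != set0 -> (0 < #|stem t S|)%N.
Proof.
move=> S0; by rewrite -(card_pt S0) subset_leq_card // pt_stem.
Qed.

(** A cluster containing the chosen leaf lies in the stem by maximality. One that misses the leaf
    but meets the stem cannot contain the stem, so laminarity puts it inside. *)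
Lemma split_pr S T : S != set0 -> pr t T -> T \proper S ->
  (T \subset stem t S) || (T \subset branch t S).
Proof.
move=> S0 pT TS; have [ptT|nptT] := boolP (pt S \subset T).
  by rewrite stem_max.
have TS' := proper_sub TS.
have [dT|ndT] := boolP [disjoint T & stem t S].
  by rewrite /branch subsetD TS' dT orbT.
case: (stemP S0) => [E|/and3P[pP _ ptP]].
  have [x Ex] : exists x, pt S = [set x] by apply/cards1P; rewrite card_pt.
  move: ndT nptT; rewrite E Ex sub1set => ndT xT; case/negP: ndT.
  by rewrite disjoint_sym disjoints1.
have := nt.1 _ _ pT pP; rewrite /lam (negbTE ndT) orbF => /orP[->//|sub].
by rewrite (subset_trans ptP sub) in nptT.
Qed.

Lemma branch_neq0 S : (1 < #|S|)%N -> (0 < #|branch t S|)%N.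
Proof.
move=> S1; have := card_stem_branch t S.
have /proper_card := stem_proper S1; lia.
Qed.

Lemma tsum_split S : (1 < #|S|)%N ->
  tsum t S = (wt (t S) + tsum t (stem t S) + tsum t (branch t S))%N.
Proof.
move=> S1; have S0 : S != set0 by rewrite -card_gt0; lia.
rewrite /tsum big_mkcond [X in (_ + X + _)%N]big_mkcond [X in (_ + _ + X)%N]big_mkcond /=.
have -> : wt (t S) = (\sum_T if T == S then wt (t T) else 0)%N.
  by rewrite -big_mkcond big_pred1_eq.
rewrite -!big_split /=; apply: eq_bigr => T _.
have [pT|/prNE ->] := boolP (pr t T); last by rewrite !if_same.
have T0 := pr_neq0 pT.
have ns : (T \subset stem t S) && (T \subset branch t S) = false.
  apply/negP => /andP[h1]; rewrite /branch subsetD => /andP[_].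
  rewrite -setI_eq0 (setIidPl h1) => /eqP T00; by rewrite T00 eqxx in T0.
have [TS|nTS] := boolP (T \subset S); last first.
  rewrite !ifN //; last 1 first.
  - by apply: contra nTS => /eqP ->.
  - by apply: contra nTS => h; rewrite (subset_trans h) ?branch_sub.
  - by apply: contra nTS => h; rewrite (subset_trans h) ?stem_sub.
have [E|neTS] := eqVneq T S.
  rewrite E !ifN ?addn0 //; apply/negP => h; have := subset_leq_card h.
    by have := card_stem S0; have := card_stem_branch t S; lia.
  by have := proper_card (stem_proper S1); lia.
have /(split_pr S0 pT) : T \proper S by rewrite properEneq neTS.
by case: (T \subset stem t S) ns => /= [->|_ ->]; rewrite ?addn0.
Qed.

(** Induction by cutting [S] into stem and branch, each of which carries at least one unit of weight
    less than it has leaves. So a set of several leaves that is not a cluster misses two units. *)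
Lemma tsum_bound S : S != set0 ->
  (tsum t S + (1 + ((1 < #|S|) && ~~ pr t S)) <= #|S|)%N.
Proof.
have [n] := ubnP #|S|; elim: n S => // n IH S ltn S0.
have c0 : (0 < #|S|)%N by rewrite card_gt0.
have [pS|npS] := boolP (pr t S).
  by rewrite (nt.2 _ pS) andbF; lia.
have [S1|] := ltnP 1 #|S|; last first.
  move=> S1; rewrite /tsum big1 => [|T TS]; first by lia.
  apply: prNE; apply/negP => /pr_card; have := subset_leq_card TS; lia.
rewrite tsum_split // (prNE npS).
have c1 := card_stem S0; have c2 := branch_neq0 S1; have c3 := card_stem_branch t S.
have := IH (stem t S); have := IH (branch t S); rewrite -!card_gt0; lia.
Qed.

Lemma tsum_stem S : S != set0 -> tsum t (stem t S) = #|stem t S|.-1.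
Proof.
move=> S0; case: (stemP S0) => [->|/and3P[/nt.2 -> //]].
have := @tsum_bound (pt S); rewrite -card_gt0 card_pt //=; lia.
Qed.

(** The stem is one input of [S]; its other [wt (t S)] inputs share the leaves of the branch, and
    each carries one unit of weight less than it has leaves. *)
Lemma wt_branch S : pr t S -> (wt (t S) + tsum t (branch t S))%N = #|branch t S|.
Proof.
move=> pS; have S1 := pr_card pS; have S0 := pr_neq0 pS.
have := tsum_split S1; rewrite (nt.2 _ pS) tsum_stem //.
have := card_stem S0; have := card_stem_branch t S; lia.
Qed.

(** A vertex is binary exactly when its branch is a single input, that is a cluster or a leaf;
    [wt1_branch1] and [wt2_branch] are the other two cases. *)
Lemma wt1_branch_pr S : pr t S -> pr t (branch t S) -> wt (t S) = 1%N.
Proof.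
by move=> pS pZ; have := wt_branch pS; rewrite (nt.2 _ pZ); have := pr_card pZ; lia.
Qed.

Lemma wt1_branch1 S : pr t S -> #|branch t S| = 1%N -> wt (t S) = 1%N.
Proof.
move=> pS Z1; have := wt_branch pS; have := @tsum_bound (branch t S).
rewrite -card_gt0; lia.
Qed.

Lemma wt2_branch S : pr t S -> (1 < #|branch t S|)%N -> ~~ pr t (branch t S) ->
  (1 < wt (t S))%N.
Proof.
move=> pS Z1 npZ; have := wt_branch pS; have := @tsum_bound (branch t S).
rewrite -card_gt0 Z1 npZ; lia.
Qed.

End Nested.
End Weights.

(** * Edge contraction and its partial inverse, the insertion of a vertex *)

Section Moves.
Variable X : finType.
Implicit Types (S T Y Z P C : {set X}) (t : {set X} -> nat * nat).

(** In a nested family the clusters strictly containing a nonempty [C] form a chain; the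
    intersection is its least member, the vertex just below [C]. *)
Definition par t C := \bigcap_(S | pr t S && (C \proper S)) S.

(** Contracts the edge between [C] and its parent. Arities k and l merge into k + l - 1, so weights,
    which total the arity minus one, simply add. *)
Definition contr t C S :=
  if S == C then (0%N, 0%N) else if S == par t C then padd (t S) (t C) else t S.

Definition inner t C := pr t C /\ exists2 S, pr t S & C \proper S.

(* [ins t T] pulls all inputs of T but the stem up into a new vertex, leaving T
   binary, with weight (0, 1) whenever T has second weight to give. *)
Definition munit (v : nat * nat) := if v.2 == 0%N then (1%N, 0%N) else (0%N, 1%N).

Definition ins t T S :=
  if S == branch t T then psub (t T) (munit (t T)) else
  if S == T then munit (t T) else t S.

(** [T] has at least two inputs besides its stem: this is where [ins] applies. *)
Definition up t T := [&& pr t T, 1 < #|branch t T| & ~~ pr t (branch t T)]%N.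

(** The local shapes produced by [ins]: a binary [T] of weight (0, 1), or of weight (1, 0) because
    there was no second weight to share. The remaining binary shape, (1, 0) under a branch with
    nonzero second weight, is critical at [T]. *)
Definition down t T := [/\ pr t T, pr t (branch t T) &
  ((t T).2 != 0%N) || ((t (branch t T)).2 == 0%N)].

Lemma par_eq t C P : pr t P -> C \proper P ->
  (forall S, pr t S -> C \proper S -> P \subset S) -> par t C = P.
Proof.
move=> pP CP minP; apply/eqP; rewrite eqEsubset; apply/andP; split.
  by rewrite /par (bigD1 P) ?pP //= subsetIl.
by apply/bigcapsP => S /andP[]; exact: minP.
Qed.

Lemma lam_chain t C S T : nested t -> pr t S -> pr t T -> C != set0 ->
  C \subset S -> C \subset T -> (S \subset T) || (T \subset S).
Proof.
move=> nt pS pT C0 CS CT; have := nt.1 _ _ pS pT; rewrite /lam orbA => /orP[//|dT].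
have : C \subset S :&: T by rewrite subsetI CS.
by rewrite (eqP (_ : S :&: T == set0)) ?setI_eq0 // subset0 (negbTE C0).
Qed.

Section Contraction.
Variables (t : {set X} -> nat * nat) (nt : nested t).

Lemma parP C : inner t C ->
  [/\ pr t (par t C), C \proper par t C &
      forall S, pr t S -> C \proper S -> par t C \subset S].
Proof.
move=> [pC [S0 pS0 CS0]].
pose q S := pr t S && (C \proper S); have q0 : q S0 by rewrite /q pS0.
case: (arg_minnP (fun T : {set X} => #|T|) q0) => T /andP[pT CT] minT.
have minT' S : pr t S -> C \proper S -> T \subset S.
  move=> pS CS.
  have := lam_chain nt pT pS (pr_neq0 nt pC) (proper_sub CT) (proper_sub CS).
  move=> /orP[//|sub]; suff /eqP -> : S == T by [].
  by rewrite eqEcard sub; apply: minT; rewrite /q pS.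
by rewrite (par_eq pT CT minT').
Qed.

Lemma par_neq C : inner t C -> par t C != C.
Proof. by case/parP => _ /properP[_ [x xp xC]] _; apply: contra xC => /eqP <-. Qed.

Lemma pr_contr C S : inner t C -> pr (contr t C) S = (S != C) && pr t S.
Proof.
move=> iC; have [pP _ _] := parP iC; rewrite /pr /contr; case: eqP => //= _.
case: eqP => // ->; rewrite wt_padd; move: pP; rewrite /pr; lia.
Qed.

Lemma tsum_contr C Y : inner t C -> (C \subset Y -> par t C \subset Y) ->
  tsum (contr t C) Y = tsum t Y.
Proof.
move=> iC CY; have [pP CP minP] := parP iC; have nPC := par_neq iC.
have [sC|nsC] := boolP (C \subset Y); last first.
  apply: eq_bigr => T TY; rewrite /contr ifN ?ifN //.
    by apply: contra nsC => /eqP E; rewrite (subset_trans (proper_sub CP)) // -E.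
  by apply: contra nsC => /eqP <-.
have sP := CY sC; rewrite /tsum [RHS](bigD1 C) // [LHS](bigD1 C) //=.
rewrite [in RHS](bigD1 (par t C)) /=; last by rewrite sP nPC.
rewrite [in LHS](bigD1 (par t C)) /=; last by rewrite sP nPC.
rewrite {1 2}/contr eqxx (negbTE nPC) eqxx wt_padd (_ : wt (0%N, 0%N) = 0%N) // add0n !addnA.
congr (_ + _)%N; first by rewrite /wt; lia.
by apply: eq_bigr => T /andP[/andP[_ h1] h2]; rewrite /contr !ifN.
Qed.

Lemma nested_contr C : inner t C -> nested (contr t C).
Proof.
move=> iC; have [pP CP minP] := parP iC; split=> [S T|S].
  by rewrite !pr_contr // => /andP[_ pS] /andP[_ pT]; apply: nt.1.
rewrite pr_contr // => /andP[SC pS]; rewrite tsum_contr //; first exact: nt.2.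
by move=> CS; apply: minP => //; rewrite properEneq eq_sym SC.
Qed.

Lemma stem_contr C S : inner t C -> S != set0 -> C != stem t S ->
  stem (contr t C) S = stem t S.
Proof.
move=> iC S0 nC; apply: stem_eq => [|T].
  case: (stemP nt S0) => [|/and3P[h1 h2 h3]]; [by left | right].
  by rewrite pr_contr // eq_sym nC h1 h2.
by rewrite pr_contr // => /andP[_]; exact: stem_max.
Qed.

(** Once its stem is contracted, [S] gets the next child on the way to the chosen leaf as its stem.
    The leading digit of the rank drops for this reason. *)
Lemma card_stem_contr C S : inner t C -> S != set0 -> C = stem t S ->
  stem (contr t C) S \proper stem t S.
Proof.
move=> iC S0 E; have nt' := nested_contr iC.
have sub : stem (contr t C) S \subset stem t S.
  rewrite subUset pt_stem; apply/bigcupsP => T /and3P[]; rewrite pr_contr // => /andP[_].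
  exact: stem_max.
rewrite properEneq sub andbT -E; case: (stemP nt' S0) => [->|/and3P[]].
  apply/eqP => E'; have := pr_card nt iC.1; by rewrite -E' card_pt.
by rewrite pr_contr // => /andP[].
Qed.

End Contraction.

Lemma par_branch t T : nested t -> pr t T -> pr t (branch t T) -> par t (branch t T) = T.
Proof.
move=> nt pT pZ; have T1 := pr_card nt pT.
have T0 := pr_neq0 nt pT.
have ZT : branch t T \proper T.
  rewrite properEcard branch_sub /=; have := card_stem t T0.
  by have := card_stem_branch t T; lia.
apply: par_eq => // S pS ZS.
have := lam_chain nt pT pS (pr_neq0 nt pZ) (proper_sub ZT) (proper_sub ZS).
case/orP=> // ST; have [->//|nST] := eqVneq S T.
have /(split_pr nt T0 pS) : S \proper T by rewrite properEneq nST.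
case/orP => h; last by have := proper_card ZS; have := subset_leq_card h; lia.
have : branch t T \subset stem t T :&: branch t T.
  by rewrite subsetI subxx (subset_trans (proper_sub ZS)).
rewrite stem_branch subset0 => /eqP Z0.
by have := pr_neq0 nt pZ; rewrite Z0 eqxx.
Qed.

Lemma branch_inner t T : nested t -> pr t T -> pr t (branch t T) -> inner t (branch t T).
Proof.
move=> nt pT pZ; split=> //; exists T => //.
rewrite properEcard branch_sub /=.
have := card_stem t (pr_neq0 nt pT).
by have := card_stem_branch t T; lia.
Qed.

Lemma munit1 v : (wt (munit v) = 1)%N. Proof. by rewrite /munit; case: ifP. Qed.

Lemma wt_psub_munit v : (0 < wt v)%N -> (wt (psub v (munit v)) = (wt v).-1)%N.
Proof. by case: v => [i [|j]]; rewrite /munit /psub /wt /=; lia. Qed.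

Section Insertion.
Variables (t : {set X} -> nat * nat) (nt : nested t) (T : {set X}) (uT : up t T).
Let pT : pr t T. Proof. by case/and3P: uT. Qed.
Let T0 : T != set0. Proof. exact: (pr_neq0 nt pT). Qed.

Lemma branch_properT : branch t T \proper T.
Proof.
rewrite properEcard branch_sub /=.
by have := card_stem t T0; have := card_stem_branch t T; lia.
Qed.

Lemma branch_neqT : (T == branch t T) = false.
Proof. by apply/negP => /eqP E; have := proper_card branch_properT; rewrite -E ltnn. Qed.

Lemma pr_ins S : pr (ins t T) S = (S == branch t T) || pr t S.
Proof.
have /and3P[_ Z1 npZ] := uT; have := wt2_branch nt pT Z1 npZ.
rewrite /pr /ins; case: eqP => /= [_ w2|_ _].
  by rewrite wt_psub_munit; lia.
by case: eqP => [->|//]; rewrite munit1; apply/esym/pT.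
Qed.

Lemma lam_branch S : pr t S -> lam S (branch t T).
Proof.
move=> pS; have := nt.1 _ _ pS pT; rewrite /lam => /or3P[ST|TS|dS].
- have [->|nST] := eqVneq S T; first by rewrite branch_sub orbT.
  have /(split_pr nt T0 pS) /orP[h|->//] : S \proper T by rewrite properEneq nST.
  by rewrite (disjointWl h) ?orbT // disjoint_sym disjoints_subset subsetDr.
- by rewrite (subset_trans (branch_sub _ _) TS) orbT.
- by rewrite (disjointWr (branch_sub t T) dS) !orbT.
Qed.

Lemma tsum_ins Y : ~~ (branch t T \subset Y) \/ T \subset Y ->
  tsum (ins t T) Y = tsum t Y.
Proof.
move=> hY; have /and3P[_ Z1 npZ] := uT; have w2 := wt2_branch nt pT Z1 npZ.
have [ZY|nZY] := boolP (branch t T \subset Y); last first.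
  apply: eq_bigr => S SY; rewrite /ins ifN ?ifN //.
    by apply: contra nZY => /eqP E; rewrite (subset_trans (branch_sub _ _)) // -E.
  by apply: contra nZY => /eqP <-.
have sT : T \subset Y by case: hY => //; rewrite ZY.
rewrite /tsum [RHS](bigD1 (branch t T)) // [LHS](bigD1 (branch t T)) //=.
rewrite [in RHS](bigD1 T) /=; last by rewrite sT branch_neqT.
rewrite [in LHS](bigD1 T) /=; last by rewrite sT branch_neqT.
rewrite {1 2}/ins eqxx branch_neqT eqxx munit1 wt_psub_munit; last by lia.
rewrite (prNE npZ) add0n addnA; congr (_ + _)%N; first by lia.
by apply: eq_bigr => S /andP[/andP[_ h1] h2]; rewrite /ins !ifN.
Qed.

Lemma tsum_ins_branch : tsum (ins t T) (branch t T) = #|branch t T|.-1.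
Proof.
have /and3P[_ Z1 npZ] := uT; have w2 := wt2_branch nt pT Z1 npZ.
have := wt_branch nt pT; rewrite /tsum.
rewrite [in X in X -> _](bigD1 (branch t T)) //= (prNE npZ) add0n.
rewrite [in X in _ -> X](bigD1 (branch t T)) //= {1}/ins eqxx wt_psub_munit; last by lia.
rewrite [in X in _ -> X](eq_bigr (fun S => wt (t S))); first by case: (wt (t T)) w2 => // k _ <-.
move=> S /andP[SZ nSZ]; rewrite /ins (negbTE nSZ) ifN //.
by apply/eqP => E; have := proper_card branch_properT; have := subset_leq_card SZ; rewrite E; lia.
Qed.

Lemma nested_ins : nested (ins t T).
Proof.
split=> [S S'|S].
  rewrite !pr_ins => /orP[/eqP->|pS] /orP[/eqP->|pS'].
  - by rewrite /lam subxx.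
  - by rewrite lam_sym lam_branch.
  - exact: lam_branch.
  - exact: nt.1.
rewrite pr_ins => /orP[/eqP->|pS]; first exact: tsum_ins_branch.
rewrite tsum_ins; first exact: nt.2.
have [ZS|] := boolP (branch t T \subset S); [right | by left].
have := lam_chain nt pT pS _ (branch_sub t T) ZS.
have /and3P[_ Z1 npZ] := uT; rewrite -card_gt0 => /(_ (ltnW Z1)) /orP[//|ST].
have [->//|nST] := eqVneq S T.
have /(split_pr nt T0 pS) /orP[h|h] : S \proper T by rewrite properEneq nST.
  have : branch t T \subset stem t T :&: branch t T by rewrite subsetI subxx (subset_trans ZS).
  rewrite stem_branch subset0 => /eqP Z0.
  by move: Z1; rewrite Z0 cards0.
by case/negP: npZ; rewrite (_ : branch t T = S) //; apply/eqP; rewrite eqEsubset ZS.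
Qed.

(** The inserted cluster avoids the chosen leaf of [T], so it is no new stem of [T]; for larger [S]
    it is hidden below [T]. *)
Lemma stem_ins S : S != set0 -> T = S \/ T \proper S -> stem (ins t T) S = stem t S.
Proof.
move=> S0 hS; apply: stem_eq => [|T'].
  case: (stemP nt S0) => [|/and3P[h1 h2 h3]]; [by left | right].
  by rewrite pr_ins h1 h2 orbT.
rewrite pr_ins => /orP[/eqP-> _ ptZ|]; last exact: stem_max.
case: hS ptZ => [<- ptZ|TS ptZ].
  have : pt T \subset stem t T :&: branch t T by rewrite subsetI ptZ pt_stem.
  rewrite stem_branch subset0 => /eqP Z0.
  by have := card_pt T0; rewrite Z0 cards0.
rewrite (subset_trans (branch_sub _ _)) // stem_max //.
by rewrite (subset_trans ptZ) ?branch_sub.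
Qed.

Lemma branch_ins S : S != set0 -> T = S \/ T \proper S -> branch (ins t T) S = branch t S.
Proof. by move=> S0 hS; rewrite /branch stem_ins. Qed.

Lemma contr_ins : contr (ins t T) (branch t T) = t.
Proof.
have /and3P[_ Z1 npZ] := uT; have w2 := wt2_branch nt pT Z1 npZ.
have eZ : branch (ins t T) T = branch t T by rewrite branch_ins //; left.
have pZ : pr (ins t T) (branch t T) by rewrite pr_ins eqxx.
have pT' : pr (ins t T) T by rewrite pr_ins pT orbT.
have := par_branch nested_ins pT'; rewrite eZ => /(_ pZ) eP.
apply/funext => S; rewrite /contr eP; case: eqP => [->|nS]; first by rewrite prN.
rewrite /ins eqxx; move/eqP/negbTE: nS => ->.
case: eqP => [->|//].
by case: (t T) w2 => [i [|j]]; rewrite /munit /padd /psub /wt /= => ?; congr (_, _); lia.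
Qed.

End Insertion.

Section DownMoves.
Variables (t : {set X} -> nat * nat) (nt : nested t) (T : {set X}) (dT : down t T).
Let Z := branch t T.
Let pT : pr t T. Proof. by case: dT. Qed.
Let pZ : pr t Z. Proof. by case: dT. Qed.
Let T0 : T != set0. Proof. exact: (pr_neq0 nt pT). Qed.
Let iZ : inner t Z. Proof. exact: branch_inner. Qed.

Lemma branch_neq_stem : Z != stem t T.
Proof.
apply/eqP => E; have : Z \subset stem t T :&: branch t T by rewrite -E subsetI subxx.
rewrite stem_branch subset0 => /eqP Z0.
by have := pr_neq0 nt pZ; rewrite Z0 eqxx.
Qed.

Lemma branch_contr : branch (contr t Z) T = Z.
Proof. by rewrite /branch stem_contr // branch_neq_stem. Qed.

Lemma up_contr : up (contr t Z) T.
Proof.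
rewrite /up branch_contr !pr_contr // eqxx pT (pr_card nt pZ) !andbT.
by have [_ [S pS /proper_card lt]] := iZ; apply/eqP => E; have := par_neq nt iZ; rewrite par_branch // E eqxx.
Qed.

(** The third clause of [down] is what makes this work: after the two weights have been added,
    [munit] must return the one that [T] had. *)
Lemma ins_contr : ins (contr t Z) T = t.
Proof.
have nTZ : T != Z by have := par_neq nt iZ; rewrite par_branch.
have eT : contr t Z T = padd (t T) (t Z) by rewrite /contr (negbTE nTZ) par_branch // eqxx.
have w1 := wt1_branch_pr nt pT pZ.
have [_ _ c] := dT; move: c; rewrite -/Z => c.
apply/funext => S; rewrite /ins branch_contr eT.
have [->|nZ] := eqVneq S Z.
  case: (t T) w1 c => [[|[|i]] [|[|j]]]; case: (t Z) => [i' [|j']];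
  by rewrite /munit /padd /psub /wt //= => _ _; congr (_, _); lia.
case: eqP => [->|nT]; last by rewrite /contr (negbTE nZ) par_branch // ifN //; apply/eqP.
by case: (t T) w1 c => [[|[|i]] [|[|j]]]; case: (t Z) => [i' [|j']].
Qed.
End DownMoves.
End Moves.

(** * The search for the matched vertex and the rank function *)

Section Matching.
Variable X : finType.
Implicit Types (S T Y Z P C : {set X}) (t : {set X} -> nat * nat).

(** For a cluster whose branch has several leaves, this says that [S] is [up] or [down]; its
    negation is the critical local shape. *)
Definition stops t S :=
  [|| ~~ pr t (branch t S), (t S).2 != 0%N | (t (branch t S)).2 == 0%N].

(* The matching acts at the first vertex T, in a fixed traversal, where it can:
   there [ins] (if [up]) or the contraction of the branch (if [down]) is applied.
   The unmatched trees are binary, i.e. of degree 0.  [f] is fuel. *)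
Fixpoint act f t S : option {set X} :=
  if f is f'.+1 then
    if ~~ pr t S then None else
    if #|branch t S| == 1%N then act f' t (stem t S) else
    if stops t S then Some S else
    if act f' t (branch t S) is Some T then Some T else act f' t (stem t S)
  else None.

(** A digit of [rk] is four times the size of a stem plus a type between 0 and 3, hence less than
    [base]; ranks therefore compare lexicographically. *)
Definition base := (4 * #|X| + 4)%N.

(* Strictly decreases along the gradient paths of the matching. *)
Fixpoint rk f t S : nat :=
  if f is f'.+1 then
    if ~~ pr t S then 0%N else
    let top ty sub := ((4 * #|stem t S| + ty) * base ^ f' + sub)%N in
    if #|branch t S| == 1%N then top 0%N (rk f' t (stem t S)) else
    if ~~ pr t (branch t S) then top (if (t S).2 == 0%N then 3%N else 0%N) 0%N else
    if act f' t (branch t S) is Some _ then top 1%N (rk f' t (branch t S))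
    else top 2%N (rk f' t (stem t S))
  else 0%N.

Lemma base_gt0 f : (0 < base ^ f)%N.
Proof. by rewrite expn_gt0 /base addn4. Qed.

Lemma rk_bound f t S : (rk f t S < base ^ f)%N.
Proof.
elim: f t S => //= f IH t S; case: ifP => // _; first by rewrite base_gt0.
have cS : (#|stem t S| <= #|X|)%N by rewrite max_card.
have K ty sub : (ty <= 3 -> sub < base ^ f ->
   (4 * #|stem t S| + ty) * base ^ f + sub < base ^ f.+1)%N.
  move=> h1 h2; rewrite expnS; apply: (@leq_trans ((4 * #|stem t S| + ty).+1 * base ^ f)%N).
    by rewrite mulSn addnC ltn_add2r.
  by rewrite leq_mul2r; apply/orP; right; rewrite /base; lia.
have B := base_gt0 f.
by case: ifP => _; [|case: ifP => _; [case: ifP => _|case: (act _ _ _) => [?|]]]; apply: K.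
Qed.

Lemma rk_hi f t S : (rk f.+1 t S < (4 * #|stem t S| + 4) * base ^ f)%N.
Proof.
rewrite /=; have B := base_gt0 f; case: ifP => // _; first by rewrite muln_gt0 B addn4.
have K ty sub : (ty <= 3 -> sub < base ^ f ->
   (4 * #|stem t S| + ty) * base ^ f + sub < (4 * #|stem t S| + 4) * base ^ f)%N.
  move=> h1 h2; apply: (@leq_trans ((4 * #|stem t S| + ty).+1 * base ^ f)%N).
    by rewrite mulSn addnC ltn_add2r.
  by rewrite leq_mul2r; apply/orP; right; lia.
by case: ifP => _; [|case: ifP => _; [case: ifP => _|case: (act _ _ _) => [?|]]];
  apply: K; rewrite ?rk_bound.
Qed.

Lemma rk_lo f t S : pr t S -> (4 * #|stem t S| * base ^ f <= rk f.+1 t S)%N.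
Proof.
move=> pS; rewrite /= pS /=.
have K ty sub : (4 * #|stem t S| * base ^ f <= (4 * #|stem t S| + ty) * base ^ f + sub)%N.
  by rewrite mulnDl -addnA leq_addr.
by case: ifP => _; [|case: ifP => _; [case: ifP => _|case: (act _ _ _) => [?|]]]; apply: K.
Qed.

(** Stem, branch and search at [S] depend only on the tree above [S]. Moves made in the stem are
    thus invisible in the branch, and conversely. *)
Definition eqon S t t' := forall T, T \subset S -> t T = t' T.

Lemma eqon_sub S S' t t' : S' \subset S -> eqon S t t' -> eqon S' t t'.
Proof. by move=> sub e T TS; apply: e; exact: subset_trans sub. Qed.

Lemma stem_local S t t' : eqon S t t' -> stem t S = stem t' S.
Proof.
move=> e; congr (_ :|: _); apply: eq_bigl => T.
by case TS: (T \proper S); rewrite ?andbF // /pr (e _ (proper_sub TS)).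
Qed.

Lemma branch_local S t t' : eqon S t t' -> branch t S = branch t' S.
Proof. by move=> e; rewrite /branch (stem_local e). Qed.

Lemma act_local f S t t' : eqon S t t' -> act f t S = act f t' S.
Proof.
elim: f S => //= f IH S e; rewrite /stops -(branch_local e) -(stem_local e).
rewrite /pr -(e S) // -(e _ (branch_sub t S)).
by rewrite -(IH _ (eqon_sub (stem_sub t S) e)) -(IH _ (eqon_sub (branch_sub t S) e)).
Qed.

Lemma ins_eqon Y P t T : T \subset P -> Y :&: P = set0 -> up t T -> T != set0 ->
  eqon Y t (ins t T).
Proof.
move=> TP YP /and3P[_ Z1 _] T0 S SY; rewrite /ins.
have K W : W != set0 -> W \subset P -> (S == W) = false.
  move=> W0 WP; apply/negP => /eqP E; case/negP: W0.
  by rewrite -subset0 -YP subsetI WP andbT -E.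
rewrite !K //; last by rewrite (subset_trans (branch_sub _ _)).
by rewrite -card_gt0; lia.
Qed.

Lemma ins_out t T S : ~~ (S \subset T) -> ins t T S = t S.
Proof.
move=> nS; rewrite /ins !ifN //; apply: contra nS => /eqP -> //.
exact: branch_sub.
Qed.

Section Facts.
Variables (t : {set X} -> nat * nat) (nt : nested t).

Lemma contr_eqon Y P C : inner t C -> par t C \subset P -> Y :&: P = set0 ->
  eqon Y t (contr t C).
Proof.
move=> iC pP YP S SY; have [pp Cp _] := parP nt iC; rewrite /contr.
have K W : pr t W -> W \subset P -> (S == W) = false.
  move=> pW WP; apply/negP => /eqP E; have /negP := pr_neq0 nt pW; apply.
  by rewrite -subset0 -YP subsetI WP andbT -E.
by rewrite !K // ?(subset_trans (proper_sub Cp)) //; case: iC.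
Qed.

Lemma contr_out C S : inner t C -> ~~ (S \subset par t C) -> contr t C S = t S.
Proof.
move=> iC; have [pp /proper_sub Cp _] := parP nt iC; rewrite /contr => nS.
by rewrite !ifN //; apply: contra nS => /eqP ->.
Qed.

Lemma contr_le2 C S : S != C -> ((t S).2 <= (contr t C S).2)%N.
Proof. by rewrite /contr => /negbTE ->; case: ifP => //= _; exact: leq_addr. Qed.

Lemma stem_properS S : pr t S -> stem t S \proper S.
Proof. by move=> pS; exact: (stem_proper nt (pr_card nt pS)). Qed.

Lemma branch_properS S : pr t S -> branch t S \proper S.
Proof.
move=> pS; rewrite properEcard branch_sub /=.
have := card_stem t (pr_neq0 nt pS).
by have := card_stem_branch t S; lia.
Qed.

Lemma act_pr f S T : act f t S = Some T -> pr t S.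
Proof. by case: f => //= f; case: (pr t S). Qed.

Lemma act_spec f S T : act f t S = Some T -> T \subset S /\ (up t T \/ down t T).
Proof.
elim: f S => //= f IH S; case pS: (pr t S) => //=.
case: eqP => [_ /IH[TS ?]|/eqP Z1].
  by split=> //; rewrite (subset_trans TS) ?stem_sub.
have Z0 := branch_neq0 nt (pr_card nt pS).
case: ifP => [st [<-]|_].
  split=> //; case pZ: (pr t (branch t S)).
    by right; split=> //; move: st; rewrite /stops pZ.
  by left; rewrite /up pS pZ /= andbT; lia.
case E: (act f t (branch t S)) => [T'|]; last first.
  by move=> /IH[TS ?]; split=> //; rewrite (subset_trans TS) ?stem_sub.
by move=> [E']; rewrite E' in E; have [TS ?] := IH _ E; split=> //; rewrite (subset_trans TS) ?branch_sub.
Qed.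

Lemma up_down T : up t T -> down t T -> False.
Proof. by move=> /and3P[_ _ /negP npZ] [_]. Qed.

Lemma ins_down T : up t T -> down (ins t T) T.
Proof.
move=> uT; have /and3P[pT Z1 npZ] := uT; have T0 := pr_neq0 nt pT.
have eZ : branch (ins t T) T = branch t T by rewrite branch_ins //; left.
split; rewrite ?eZ ?pr_ins ?eqxx ?pT ?orbT //.
rewrite /ins eqxx branch_neqT // eqxx /munit.
by case: (t T) (wt2_branch nt pT Z1 npZ) => [i [|j]].
Qed.

Lemma stops_down S : down t S -> stops t S.
Proof. by case=> _ pZ h; rewrite /stops pZ. Qed.

End Facts.

(** The vertices passed by the search keep their stem, branch and critical shape, so the search in
    the new tree still arrives at [T], now a [down] vertex. *)
Lemma act_ins f t S T : nested t -> up t T -> act f t S = Some T ->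
  act f (ins t T) S = Some T.
Proof.
move=> nt uT; have /and3P[pT Z1T npZT] := uT; have T0 := pr_neq0 nt pT.
have nt1 := nested_ins nt uT.
elim: f S => // f IH S; rewrite [in X in X -> _]/=; case pS: (pr t S) => //=.
have S0 := pr_neq0 nt pS; have dis := stem_branch t S.
have K : T \subset S -> T != S -> T = S \/ T \proper S.
  by move=> h1 h2; right; rewrite properEneq h2.
rewrite pr_ins // pS orbT /=.
have [Z1 e|Z1] := eqVneq #|branch t S| 1%N.
  have [TP _] := act_spec nt e.
  have TS : T \proper S by rewrite (sub_proper_trans TP) // stem_properS.
  by rewrite branch_ins ?stem_ins ?Z1 ?eqxx //; [exact: IH | right | right].
case: ifP => [st [E]|].
  rewrite E in pS st Z1 *; rewrite branch_ins //; last by left.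
  by rewrite (negbTE Z1) stops_down //; exact: ins_down.
rewrite /stops => /negbT; rewrite !negb_or negbK => /and3P[pZ tS tZ].
case E: (act f t (branch t S)) => [T'|].
  move=> [E']; rewrite {}E' in E; have [TZ _] := act_spec nt E.
  have TS : T \proper S by rewrite (sub_proper_trans TZ) // branch_properS.
  rewrite branch_ins //; last by right.
  rewrite (negbTE Z1) IH // /stops.
  rewrite pr_ins // pZ orbT /= ins_out; last by rewrite proper_subn.
  rewrite (negbTE tS) /=; case: ifP => // h; case/negP: tZ; move: h.
  (* If [T] is the branch itself, its second weight stays nonzero because [munit] prefers (0, 1).
     Otherwise [S] would become [down] and stop the search too early. *)
  have [->|nT] := eqVneq (branch t S) T; last by rewrite ins_out // proper_subn // properEneq eq_sym nT.
  by rewrite /ins branch_neqT // eqxx /munit; case: (t T) => [i [|j]].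
move=> e; have [TP _] := act_spec nt e.
have TS : T \proper S by rewrite (sub_proper_trans TP) // stem_properS.
have eZ : eqon (branch t S) t (ins t T) by apply: (@ins_eqon _ (stem t S)) => //; rewrite setIC.
rewrite branch_ins //; last by right.
rewrite (negbTE Z1) /stops.
rewrite -(act_local _ eZ) E stem_ins //; last by right.
rewrite pr_ins // pZ orbT /= ins_out; last by rewrite proper_subn.
by rewrite (negbTE tS) /= -eZ // (negbTE tZ) IH.
Qed.

(** Counterpart of [act_ins]: with it the two moves are inverse to each other globally, the search
    finding the same vertex in both partners. *)
Lemma act_contr f t S T : nested t -> down t T -> act f t S = Some T ->
  act f (contr t (branch t T)) S = Some T.
Proof.
move=> nt dT; have [pT pC _] := dT; have T0 := pr_neq0 nt pT.
have iC := branch_inner nt pT pC; have eP := par_branch nt pT pC.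
have CT := branch_properS nt pT.
set C := branch t T in iC eP CT pC *.
have nt1 := nested_contr nt iC.
elim: f S => // f IH S; rewrite [in X in X -> _]/=; case pS: (pr t S) => //=.
have S0 := pr_neq0 nt pS; have dis := stem_branch t S.
move=> e; have TS : T \subset S.
  by have := @act_spec t nt f.+1 S T; rewrite /= pS => /(_ e)[].
have CS : C \proper S by exact: proper_sub_trans TS.
have nSC : S != C by apply/eqP => E; move: CS; rewrite E properxx.
rewrite pr_contr // nSC pS /=.
have st_eq : C != stem t S -> (stem (contr t C) S = stem t S) * (branch (contr t C) S = branch t S).
  by move=> h; rewrite /branch stem_contr.
move: e; have [Z1 e|Z1] := eqVneq #|branch t S| 1%N.
  have [TP _] := act_spec nt e.
  have nC : C != stem t S by apply: contraTneq (proper_sub_trans CT TP) => ->; rewrite properxx.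
  by rewrite !st_eq // Z1 eqxx IH.
case: ifP => [st [E]|].
  rewrite E; have := up_contr nt dT; rewrite -/C => /and3P[_ h1 h2].
  by rewrite branch_contr // -/C in h1 h2 *; rewrite /stops branch_contr // -/C h2 ifN //; lia.
rewrite /stops => /negbT; rewrite !negb_or negbK => /and3P[pZ tS tZ].
case E: (act f t (branch t S)) => [T'|].
  move=> [E']; rewrite {}E' in E; have [TZ _] := act_spec nt E.
  have CZ : C \proper branch t S := proper_sub_trans CT TZ.
  have nC : C != stem t S.
    apply/eqP => E'; have := pr_neq0 nt pC; rewrite -subset0 -dis -E' subsetI subxx.
    by rewrite (proper_sub CZ).
  have TS' : T \proper S by rewrite (sub_proper_trans TZ) // branch_properS.
  have nZC : branch t S != C by apply: contraTneq CZ => ->; rewrite properxx.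
  rewrite !st_eq // (negbTE Z1) pr_contr // nZC pZ /= IH //.
  rewrite contr_out // ?eP ?proper_subn // (negbTE tS) /=.
  (* Contraction only adds to the second weight of a surviving vertex, so the branch keeps a nonzero
     one. *)
  by move: tZ; rewrite -lt0n => h; rewrite gtn_eqF // (leq_trans h (contr_le2 t nZC)).
move=> e; have [TP _] := act_spec nt e.
have nC : C != stem t S by apply: contraTneq (proper_sub_trans CT TP) => ->; rewrite properxx.
have TS' : T \proper S by rewrite (sub_proper_trans TP) // stem_properS.
have eZ : eqon (branch t S) t (contr t C).
  by apply: (@contr_eqon _ nt _ (stem t S)) => //; rewrite ?eP // setIC.
rewrite !st_eq // (negbTE Z1) -(act_local _ eZ) E IH //.
have nZC : branch t S != C.
  apply/eqP => E'; have := pr_neq0 nt pC; rewrite -subset0 -dis -E' subsetI subxx andbT E'.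
  by rewrite (subset_trans (proper_sub CT)).
rewrite pr_contr // nZC pZ /= contr_out // ?eP ?proper_subn // (negbTE tS) /=.
by rewrite -eZ // (negbTE tZ).
Qed.

(** A failing search visits every cluster above [S], and at each of them the branch is a leaf or a
    cluster. An unmatched tree is therefore binary. *)
Lemma act_none f t S : nested t -> (#|S| <= f)%N -> pr t S \/ #|S| = 1%N ->
  act f t S = None -> forall T, T \subset S -> pr t T -> wt (t T) = 1%N.
Proof.
move=> nt; elim: f S => [|f IH] S lS hS e T TS pT.
  by have := pr_card nt pT; have := subset_leq_card TS; lia.
case: hS => [pS|S1]; last by have := pr_card nt pT; have := subset_leq_card TS; lia.
have S0 := pr_neq0 nt pS.
have lP : (#|stem t S| <= f)%N by have := proper_card (stem_properS nt pS); lia.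
have lZ : (#|branch t S| <= f)%N by have := proper_card (branch_properS nt pS); lia.
have hP : pr t (stem t S) \/ #|stem t S| = 1%N.
  by case: (stemP nt S0) => [->|/and3P[]]; [right; rewrite card_pt | left].
have Z0 := branch_neq0 nt (pr_card nt pS).
move: e; rewrite /= pS /=.
have split : T != S -> (T \subset stem t S) || (T \subset branch t S).
  by move=> nT; apply: split_pr => //; rewrite properEneq nT.
have [Z1 e|Z1] := eqVneq #|branch t S| 1%N.
  have [->|/split /orP[h|h]] := eqVneq T S; first exact: wt1_branch1.
    exact: (IH (stem t S)).
  by have := pr_card nt pT; have := subset_leq_card h; lia.
case: ifP => // /negbT; rewrite /stops !negb_or negbK => /and3P[pZ _ _].
case E: (act f t (branch t S)) => // e.
have [->|/split /orP[h|h]] := eqVneq T S; first exact: wt1_branch_pr.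
  exact: (IH (stem t S)).
by apply: (IH (branch t S)) => //; left.
Qed.
End Matching.

(** * The rank decreases along gradient paths *)

Section RankDecrease.
Variable X : finType.
Implicit Types (S T Y Z P C : {set X}) (t : {set X} -> nat * nat).

Lemma up_local S T t t' : T \subset S -> eqon S t t' -> up t T = up t' T.
Proof.
move=> TS /(eqon_sub TS) e.
by rewrite /up /pr -(branch_local e) -(e T) // -(e (branch t T)) ?branch_sub.
Qed.

(** The type in the leading digit is 3 when several inputs remain to be gathered and there is no
    second weight, 2 when a branch cluster is passed and the search goes on in the stem, 1 when it
    acts in the branch, 0 otherwise. This order is dictated by the cases of [rk_ins_contr]. *)
Lemma rkE f t S : pr t S -> rk f.+1 t S =
  (if #|branch t S| == 1 then (4 * #|stem t S| + 0) * base X ^ f + rk f t (stem t S) else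
   if ~~ pr t (branch t S) then
     (4 * #|stem t S| + (if (t S).2 == 0 then 3 else 0)) * base X ^ f + 0 else
   if act f t (branch t S) is Some _ then
     (4 * #|stem t S| + 1) * base X ^ f + rk f t (branch t S)
   else (4 * #|stem t S| + 2) * base X ^ f + rk f t (stem t S))%N.
Proof. by move=> pS; rewrite /= pS. Qed.

Lemma actE f t S : pr t S -> act f.+1 t S =
  if #|branch t S| == 1%N then act f t (stem t S) else
  if stops t S then Some S else
  if act f t (branch t S) is Some T then Some T else act f t (stem t S).
Proof. by move=> pS; rewrite /= pS. Qed.

(** One step of a gradient path: insert at the matched vertex, then contract an inner edge other
    than the new one. Only steps ending in an [up] tree continue the path, and those where [T] stays
    matched and [down] are excluded by [u2]. *)
Lemma rk_ins_contr f S t T C T' : nested t -> (#|S| <= f)%N ->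
  act f t S = Some T -> up t T -> pr (ins t T) C -> C \proper S -> C != branch t T ->
  act f (contr (ins t T) C) S = Some T' -> up (contr (ins t T) C) T' ->
  (rk f (contr (ins t T) C) S < rk f t S)%N.
Proof.
move=> nt; elim: f S T' => [//|f IH] S T' leS aS uT pC CS nCZ a2 u2.
have nt1 := nested_ins nt uT; have d1 := ins_down nt uT; have a1 := act_ins nt uT aS.
have /and3P[pT Z1T npZT] := uT; have T0 := pr_neq0 nt pT.
have [t1 Et1] : exists t1, ins t T = t1 by eexists.
rewrite !Et1 in nt1 d1 a1 pC a2 u2 *.
have pS := act_pr aS; have S0 := pr_neq0 nt pS; have S1 := pr_card nt pS.
have [TS _] := act_spec nt aS.
have pS1 : pr t1 S by rewrite -Et1 pr_ins // pS orbT.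
have iC : inner t1 C by split=> //; exists S.
have nt2 := nested_contr nt1 iC; have [pp Cp minp] := parP nt1 iC.
have TS' : T = S \/ T \proper S.
  by have [->|nT] := eqVneq T S; [left | right; rewrite properEneq nT].
have sE : stem t1 S = stem t S by rewrite -Et1 stem_ins.
have bE : branch t1 S = branch t S by rewrite /branch sE.
(* The contraction leaves a vertex of weight at least 2, so the part of the tree containing it
   cannot be free of matches. *)
have wpar : (1 < wt (contr t1 C (par t1 C)))%N.
  rewrite /contr (negbTE (par_neq nt1 iC)) eqxx wt_padd; by move: pp pC; rewrite /pr; clear; lia.
have [t2 Et2] : exists t2, contr t1 C = t2 by eexists.
rewrite !Et2 in nt2 a2 u2 wpar *.
have pr2 D : pr t2 D = (D != C) && pr t1 D by rewrite -Et2 pr_contr.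
have nSC : S != C by apply: contraTneq CS => ->; rewrite properxx.
have pS2 : pr t2 S by rewrite pr2 nSC.
have B := base_gt0 X f; have rb D := rk_bound f D; have dis := stem_branch t S.
(* When [C] is the stem of [S], the stem shrinks and the leading digit drops by at least 4, whatever
   the types. *)
have [eC|nC] := eqVneq C (stem t S).
  have lt : (#|stem t2 S| < #|stem t S|)%N.
    by rewrite -Et2 -sE; apply: proper_card; apply: card_stem_contr; rewrite ?sE.
  apply: (leq_trans (rk_hi f t2 S)); apply: leq_trans (rk_lo f pS).
  by rewrite leq_mul2r; apply/orP; right; clear -lt; lia.
have s2E : stem t2 S = stem t S by rewrite -Et2 stem_contr ?sE.
have b2E : branch t2 S = branch t S by rewrite /branch s2E.
have CPZ : (C \subset stem t S) || (C \subset branch t S).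
  by rewrite -sE -bE; apply: split_pr.
have C1 := pr_card nt1 pC.
have parS D : pr t1 D -> C \proper D -> D \proper S -> t2 S = t1 S.
  move=> pD CD DS; rewrite -Et2 contr_out //.
  by apply/negP => h; have := proper_card DS; have := subset_leq_card (subset_trans h (minp _ pD CD)); clear; lia.
have prP : C \proper stem t S -> pr t1 (stem t S).
  move=> CP; case: (stemP nt1 S0); last by rewrite sE => /and3P[].
  by rewrite sE => E; have := proper_card CP; rewrite E card_pt //; clear -C1; lia.
have PS : stem t S \proper S := stem_properS nt pS.
have ZS : branch t S \proper S := branch_properS nt pS.
have onZ : C \proper stem t S -> eqon (branch t S) t1 t2.
  move=> CP; rewrite -Et2; apply: (@contr_eqon _ _ nt1 _ (stem t S)) => //.
    by apply: minp => //; exact: prP.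
  by rewrite setIC.
have lP : (#|stem t S| <= f)%N by have := proper_card PS; clear -leS; lia.
have lZ : (#|branch t S| <= f)%N by have := proper_card ZS; clear -leS; lia.
move: aS a2; rewrite actE // (actE f pS2) s2E b2E.
rewrite (rkE f pS) (rkE f pS2) s2E b2E.
have [Z1|Z1] := eqVneq #|branch t S| 1%N.
  move=> aP a2; have [TP _] := act_spec nt aP; rewrite ltn_add2l -Et2 -Et1.
  apply: (IH (stem t S) T'); rewrite ?Et1 ?Et2 //.
  case/orP: CPZ => h; first by rewrite properEneq nC.
  by have := subset_leq_card h; clear -C1 Z1; lia.
(* The search stops at [S], which is [T]. A contraction in the stem, or in the branch when [T]
   received (0, 1), leaves [S] matched and [down], against [u2]. Otherwise [T] had no second weight,
   and type 3 falls to at most 2. *)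
case: ifP => [st [ST]|].
  have npZ : ~~ pr t (branch t S) by rewrite ST; case/and3P: uT.
  have pZ1 : pr t1 (branch t S) by case: d1 => _; rewrite -ST bE.
  have pZ2 : pr t2 (branch t S) by rewrite pr2 pZ1 andbT eq_sym ST.
  rewrite npZ pZ2 /=; have t1S : t1 S = munit (t S).
    by rewrite -Et1 /ins ST branch_neqT // eqxx.
  case/orP: CPZ => h.
    have CP : C \proper stem t S by rewrite properEneq nC.
    have t2S := parS _ (prP CP) CP PS.
    rewrite ifT => [[E]|].
      by move: u2; rewrite -E /up b2E pZ2 !andbF.
    rewrite /stops b2E pZ2 t2S -(onZ CP) //; case: d1 => _ _.
    by rewrite -ST bE.
  have CZ : C \proper branch t S by rewrite properEneq ST nCZ -ST.
  have t2S := parS _ pZ1 CZ ZS.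
  have [t0|t0] := eqVneq (t S).2 0%N; last first.
    rewrite ifT => [[E]|]; first by move: u2; rewrite -E /up b2E pZ2 !andbF.
    by rewrite /stops b2E pZ2 t2S t1S /munit (negbTE t0).
  move=> _; rewrite addn0.
  have K ty D : (ty <= 2 -> (4 * #|stem t S| + ty) * base X ^ f + rk f t2 D <
             (4 * #|stem t S| + 3) * base X ^ f)%N.
    move=> h'; apply: (@leq_trans ((4 * #|stem t S| + ty).+1 * base X ^ f)%N).
      by rewrite mulSn addnC ltn_add2r.
    by rewrite leq_mul2r; apply/orP; right; clear -h'; lia.
  by case: (act _ _ _) => [?|]; apply: K.
rewrite /stops => /negbT; rewrite !negb_or negbK => /and3P[pZ tS tZ] aS.
have nTS : T != S.
  apply/eqP => E; by move: npZT; rewrite E pZ.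
have TSp : T \proper S by rewrite properEneq nTS.
have t1S : t1 S = t S by rewrite -Et1 ins_out // proper_subn.
have pZ1 : pr t1 (branch t S) by rewrite -Et1 pr_ins // pZ orbT.
have K ty sub sub' : (sub < base X ^ f -> (4 * #|stem t S| + ty) * base X ^ f + sub <
    (4 * #|stem t S| + ty.+1) * base X ^ f + sub')%N.
  by move=> h; rewrite addnS [(_.+1 * base X ^ f)%N]mulSn (addnC (base X ^ f)%N) -addnA ltn_add2l (leq_trans h) // leq_addr.
have t1Z : (t1 (branch t S)).2 != 0%N.
  case E: (act f t (branch t S)) aS => [T2|] aS.
    case: aS => ET; rewrite ET in E; have [TZ _] := act_spec nt E.
    have [EZ|nT] := eqVneq T (branch t S); last first.
      by rewrite -Et1 ins_out // proper_subn // properEneq nT.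
    rewrite -Et1 /ins -[X in X == branch t T]EZ branch_neqT // -EZ eqxx /munit EZ.
    by case: (t (branch t S)) tZ => [i [|j]].
  have [TP _] := act_spec nt aS.
  suff e : eqon (branch t S) t t1 by rewrite -e.
  by rewrite -Et1; apply: (@ins_eqon _ _ (stem t S)) => //; rewrite setIC.
(* Contracting the whole branch hands its nonzero second weight to [S]: the new type is 0, the old
   one was 1 or 2. *)
have [eCZ|neCZ] := eqVneq C (branch t S).
  have parE : par t1 (branch t S) = S by rewrite -bE par_branch // bE.
  have t2S : ((t2 S).2 == 0%N) = false.
    rewrite -Et2 /contr (negbTE nSC) eCZ parE eqxx /=.
    by rewrite gtn_eqF // addn_gt0 orbC lt0n t1Z.
  rewrite (_ : pr t2 (branch t S) = false); last by rewrite pr2 eCZ eqxx.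
  rewrite t2S pZ /= => _; case: (act f t (branch t S)) => [_|]; first exact: K.
  apply: (@ltn_trans ((4 * #|stem t S| + 1) * base X ^ f + 0)%N); exact: K.
have pZ2 : pr t2 (branch t S) by rewrite pr2 eq_sym neCZ.
have t2S : t2 S = t1 S.
  case/orP: CPZ => h; last by apply: (parS _ pZ1) => //; rewrite properEneq neCZ.
  by have CP : C \proper stem t S; [rewrite properEneq nC | exact: parS (prP CP) CP PS].
have t2Z : (t2 (branch t S)).2 != 0%N.
  have nZC : branch t S != C by rewrite eq_sym.
  by move: t1Z; rewrite -!lt0n -Et2 => h; exact: (leq_trans h (contr_le2 t1 nZC)).
have nst : stops t2 S = false.
  by rewrite /stops b2E pZ2 t2S t1S (negbTE tS) (negbTE t2Z).
rewrite -/(stops t2 S) nst pZ pZ2 /=.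
(* A contraction inside the branch makes it non-binary, so by [act_none] the search succeeds
   there. *)
have nonbin : C \proper branch t S -> act f t2 (branch t S) <> None.
  move=> CZ e; have := @act_none _ f t2 (branch t S) nt2 lZ (or_introl pZ2) e (par t1 C).
  rewrite pr2 pp (par_neq nt1 iC) (minp _ pZ1 CZ) => /(_ isT isT) w1.
  by rewrite w1 in wpar.
(* If the search acted in the branch, a contraction in the stem would leave [T] as a [down] match,
   and a contraction in the branch is left to the induction. *)
case E: (act f t (branch t S)) aS => [T2|] aS.
  case: aS => ET; rewrite ET in E; case/orP: CPZ => h.
    have CP : C \proper stem t S by rewrite properEneq nC.
    have a1Z := act_ins nt uT E; rewrite Et1 (act_local _ (onZ CP)) in a1Z.
    rewrite a1Z => [[E2]]; case: (@up_down _ t1 T) => //.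
    have [TZ _] := act_spec nt E.
    by rewrite (@up_local (branch t S) T t1 t2 TZ (onZ CP)) E2.
  have CZ : C \proper branch t S by rewrite properEneq neCZ.
  have := nonbin CZ; case E2: (act f t2 (branch t S)) => [T3|] // _ [E3].
  rewrite ltn_add2l -Et2 -Et1; apply: (IH (branch t S) T'); rewrite ?Et1 ?Et2 //.
  by rewrite E2 E3.
have [TP _] := act_spec nt aS.
have eZ1 : eqon (branch t S) t t1 by rewrite -Et1; apply: (@ins_eqon _ _ (stem t S)) => //; rewrite setIC.
(* Here the search acted in the stem. A contraction in the branch moves the match there, from type 2
   to type 1; one in the stem is left to the induction. *)
case/orP: CPZ => h; last first.
  have CZ : C \proper branch t S by rewrite properEneq neCZ.
  have := nonbin CZ; case E2: (act f t2 (branch t S)) => [T3|] // _ _.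
  exact: K.
have CP : C \proper stem t S by rewrite properEneq nC.
rewrite -(act_local f (onZ CP)) -(act_local f eZ1) E => a2P.
by rewrite ltn_add2l -Et2 -Et1; apply: (IH (stem t S) T'); rewrite ?Et1 ?Et2.
Qed.
End RankDecrease.

(** * Alternating deletion sums *)

Section Dsum.
Variables (R : comNzRingType) (T : eqType).
Implicit Types (s u v : seq T) (P : pred T).

(** The shape of a simplicial boundary: sum over the positions of [s] of [h x u], [x] being the
    deleted letter and [u] the remaining word, with alternating signs starting at +1. *)
Fixpoint Dsum (h : T -> seq T -> R) s : R :=
  if s is x :: s' then h x s' - Dsum (fun y u => h y (x :: u)) s' else 0.

Lemma eq_Dsum h h' s :
  (forall x u v, s = u ++ x :: v -> h x (u ++ v) = h' x (u ++ v)) ->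
  Dsum h s = Dsum h' s.
Proof.
elim: s h h' => //= x s IH h h' e; rewrite (e x [::] s) //; congr (_ - _).
by apply: IH => y u v E; apply: (e y (x :: u) v); rewrite E.
Qed.

Lemma Dsum0 h s : (forall x u v, s = u ++ x :: v -> h x (u ++ v) = 0) -> Dsum h s = 0.
Proof.
elim: s h => //= x s IH h e; rewrite (e x [::] s) // IH ?subrr // => y u v E.
by apply: (e y (x :: u) v); rewrite E.
Qed.

Lemma DsumD h h' s : Dsum (fun x u => h x u + h' x u) s = Dsum h s + Dsum h' s.
Proof. by elim: s h h' => [|x s IH] h h' /=; rewrite ?addr0 // IH opprD addrACA. Qed.

Lemma DsumZ c h s : Dsum (fun x u => c * h x u) s = c * Dsum h s.
Proof. by elim: s h => [|x s IH] h /=; rewrite ?mulr0 // IH mulrBr. Qed.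

Lemma DsumN h s : Dsum (fun x u => - h x u) s = - Dsum h s.
Proof.
rewrite -mulN1r -DsumZ; apply: eq_Dsum => x u v _; by rewrite mulN1r.
Qed.

Lemma Dsum_antisym h : (forall x, antisym (h x)) -> antisym (Dsum h).
Proof.
move=> ash u x y v; elim: u h ash => [|z u IH] h ash /=.
  have E : Dsum (fun z w => h z (x :: y :: w)) v =
      - Dsum (fun z w => h z (y :: x :: w)) v.
    by rewrite -DsumN; apply: eq_Dsum => z w w' _; exact: (ash z [::]).
  by rewrite E; ring.
rewrite (ash z) IH; first by ring.
by move=> w u' a b v'; exact: (ash w (z :: u')).
Qed.

(** Each pair of letters is deleted in two orders, and the two positions have opposite signs. *)
Lemma Dsum_sq (h : T -> T -> seq T -> R) s : uniq s ->
  (forall x y u, x \in s -> y \in s -> x != y -> h x y u = h y x u) ->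
  Dsum (fun x u => Dsum (h x) u) s = 0.
Proof.
elim: s h => //= x s IH h /andP[xs us] sym.
rewrite DsumD DsumN IH //; last first.
  by move=> y z u ys zs; apply: sym; rewrite inE ?ys ?zs orbT.
rewrite oppr0 addr0; apply/eqP; rewrite subr_eq0; apply/eqP.
apply: eq_Dsum => y u v E; have ys : y \in s by rewrite E mem_cat inE eqxx orbT.
apply: sym; rewrite ?inE ?eqxx ?ys ?orbT //.
by apply: contraNneq xs => ->.
Qed.

(** The combinatorial core of the Leibniz rule. Sorting the word into its part outside [P] followed
    by its part in [P] separates the deletions; those in the second part also pass the whole first
    part. *)
Lemma Dsum_split P (f g : T -> seq T -> seq T -> R) s :
  Dsum (fun x u => (-1) ^+ cross P (predC P) u *
    (if P x then g x (filter (predC P) u) (filter P u)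
     else f x (filter (predC P) u) (filter P u))) s =
  (-1) ^+ cross P (predC P) s *
   (Dsum (fun x u => f x u (filter P s)) (filter (predC P) s) +
    (-1) ^+ size (filter (predC P) s) * Dsum (fun x u => g x (filter (predC P) s) u) (filter P s)).
Proof.
elim: s f g => [|x s IH] f g /=; first by rewrite mulr0 addr0 mulr0.
case Px: (P x) => /=; rewrite ?Px /=.
  set a := size (filter (predC P) s).
  rewrite -[count _ s]size_filter -/a.
  have := IH (fun y a' b' => - (-1) ^+ a * f y a' (x :: b')) (fun y a' b' => (-1) ^+ a * g y a' (x :: b')).
  rewrite !DsumZ -/a => IH'.
  rewrite (eq_Dsum (h' := fun y u => (-1) ^+ cross P (predC P) u *
    (if P y then (-1) ^+ a * g y (filter (predC P) u) (x :: filter P u)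
     else - (-1) ^+ a * f y (filter (predC P) u) (x :: filter P u)))).
    rewrite {}IH' exprD; have : (-1) ^+ a * (-1) ^+ a = 1 :> R by rewrite -exprMn mulrNN mulr1 expr1n.
    move: ((-1) ^+ a) => e E; set G := g x _ _; set c := (-1) ^+ _.
    by rewrite -[c * G]mulr1 -E; ring.
  move=> y u v E; rewrite exprD -[count _ (u ++ v)]size_filter /a E !filter_cat !size_cat /=.
  case Py: (P y) => /=; rewrite !exprD ?exprS; ring.
rewrite add0n.
have := IH (fun y a' b' => f y (x :: a') b') (fun y a' b' => g y (x :: a') b') => IH'.
rewrite (eq_Dsum (h' := fun y u => (-1) ^+ cross P (predC P) u *
    (if P y then g y (x :: filter (predC P) u) (filter P u)
     else f y (x :: filter (predC P) u) (filter P u)))).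
  rewrite {}IH' exprS; ring.
by move=> y u v _; rewrite add0n.
Qed.
End Dsum.

(** * Words encoding trees *)

Section Words.
Variable X : finType.
Local Notation letter := ({set X} * (nat * nat))%type.
Local Notation word := (seq letter).
Implicit Types (w : word) (l : letter) (S T Y C : {set X}) (t : {set X} -> nat * nat) (s : seq {set X}).

Definition cl w := map fst w.

(** Decodes a word into a weighted family. Summing over all occurrences makes it invariant under
    every permutation, even for words with a repeated cluster. *)
Definition val w S : nat * nat :=
  ((\sum_(l <- w | l.1 == S) l.2.1)%N, (\sum_(l <- w | l.1 == S) l.2.2)%N).

Definition csum w Y := (\sum_(l <- w | l.1 \subset Y) wt l.2)%N.

(* A word lists the vertices of a tree in the order of its tensor decoration. *)
Definition good w :=
  [&& uniq (cl w), all (fun l => 0 < wt l.2)%N w,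
      all (fun l => all (fun l' => lam l.1 l'.1) w) w,
      all (fun l => csum w l.1 == #|l.1|.-1) w & (#|X| == 1%N) || (setT \in cl w)].

Definition mkw t s : word := [seq (A, t A) | A <- s].

Lemma wt_val w S : wt (val w S) = (\sum_(l <- w | l.1 == S) wt l.2)%N.
Proof. by rewrite /wt -big_split. Qed.

Lemma tsum_val w Y : tsum (val w) Y = csum w Y.
Proof.
rewrite /tsum (eq_bigr (fun S => \sum_(l <- w | l.1 == S) wt l.2)%N); last first.
  by move=> S _; exact: wt_val.
rewrite (exchange_big_dep xpredT) //= /csum [RHS]big_mkcond; apply: eq_bigr => l _.
case: ifP => lY; last first.
  by rewrite big_pred0 // => S; case: eqP => [<-|_]; rewrite ?lY ?andbF.
by rewrite (big_pred1 l.1) // => S /=; rewrite [l.1 == S]eq_sym; case: eqP => [->|_]; rewrite ?lY ?andbF.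
Qed.

Lemma pr_val w S : all (fun l => 0 < wt l.2)%N w -> pr (val w) S = (S \in cl w).
Proof.
move=> /allP pos; rewrite /pr wt_val lt0n sum_nat_seq_neq0 /cl; apply/hasP/mapP.
  by move=> [l lw /andP[/eqP <- _]]; exists l.
by move=> [l lw ->]; exists l => //; rewrite eqxx -lt0n pos.
Qed.

Lemma val_uniq w l : uniq (cl w) -> l \in w -> val w l.1 = l.2.
Proof.
move=> + lw; case/splitPr: lw => u v; rewrite /cl map_cat cat_uniq /= => /and3P[_].
rewrite !negb_or => /andP[lu _] /andP[lv _].
have K (f : nat * nat -> nat) : (\sum_(l' <- u ++ l :: v | l'.1 == l.1) f l'.2)%N = f l.2.
  rewrite big_cat big_cons eqxx /= [X in (X + _)%N]big1_seq ?[X in (_ + (_ + X))%N]big1_seq //=.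
  - by rewrite addn0.
  - by move=> l' /andP[/eqP E /(map_f fst)]; rewrite E (negbTE lv).
  - by move=> l' /andP[/eqP E /(map_f fst)]; rewrite E (negbTE lu).
by rewrite /val !K -surjective_pairing.
Qed.

Lemma val_notin w S : S \notin cl w -> val w S = (0%N, 0%N).
Proof.
move=> Sw; rewrite /val !big1_seq // => l /andP[/eqP E /(map_f fst)];
by rewrite E (negbTE Sw).
Qed.

Lemma cl_mkw t s : cl (mkw t s) = s.
Proof. by rewrite /cl /mkw -map_comp map_id_in. Qed.

Lemma mkw_val w : uniq (cl w) -> mkw (val w) (cl w) = w.
Proof.
move=> uw; rewrite /mkw /cl -map_comp map_id_in // => l lw /=.
by rewrite val_uniq // -surjective_pairing.
Qed.

Lemma val_mkw t s S : uniq s -> val (mkw t s) S = if S \in s then t S else (0%N, 0%N).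
Proof.
move=> us; case: ifP => Ss; last by rewrite val_notin // cl_mkw Ss.
by rewrite (@val_uniq _ (S, t S)) ?cl_mkw //; apply/mapP; exists S.
Qed.

Lemma val_mkw_pr t s : uniq s -> s =i pr t -> val (mkw t s) = t.
Proof.
move=> us es; apply/funext => S; rewrite val_mkw //; case: ifP => //.
by rewrite es => /negbT /prN ->.
Qed.

Lemma good_uniq w : good w -> uniq (cl w). Proof. by case/and5P. Qed.

Lemma good_pr w : good w -> cl w =i pr (val w).
Proof. by case/and5P=> _ p _ _ _ S; rewrite -pr_val. Qed.

Lemma good_root w : good w -> (#|X| == 1%N) || (setT \in cl w). Proof. by case/and5P. Qed.

Lemma good_nested w : good w -> nested (val w).
Proof.
move=> /and5P[_ p /allP l /allP c _]; split=> [S T|S]; rewrite !pr_val //.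
  by move=> /mapP[a aw ->] /mapP[b bw ->]; have /allP := l a aw; exact.
by move=> /mapP[a aw ->]; rewrite tsum_val; exact/eqP/c.
Qed.

Lemma good_mkw t s : nested t -> uniq s -> s =i pr t ->
  (#|X| == 1%N) || (setT \in s) -> good (mkw t s).
Proof.
move=> nt us es rt; have ev := val_mkw_pr us es.
apply/and5P; split; rewrite ?cl_mkw //.
- by apply/allP => l /mapP[S Ss ->] /=; move: Ss; rewrite es.
- apply/allP => l /mapP[S Ss ->] /=; apply/allP => l' /mapP[S' Ss' ->] /=.
  by apply: nt.1; [move: Ss | move: Ss']; rewrite es.
- apply/allP => l /mapP[S Ss ->] /=; rewrite -tsum_val ev; apply/eqP/nt.2.
  by move: Ss; rewrite es.
Qed.

Lemma perm_val w w' : perm_eq w w' -> val w = val w'.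
Proof. by move=> pw; apply/funext => S; rewrite /val !(perm_big _ pw). Qed.

Lemma perm_good w w' : perm_eq w w' -> good w = good w'.
Proof.
move=> pw; have pc : perm_eq (cl w) (cl w') by exact: perm_map.
rewrite /good (perm_uniq pc) (perm_mem pc) (perm_all _ pw); do 2!congr (_ && _).
congr [&& _, _ & _].
  by rewrite (perm_all _ pw); apply: eq_all => l; exact: perm_all.
by rewrite (perm_all _ pw); apply: eq_all => l; rewrite /csum (perm_big _ pw).
Qed.

Lemma good_gt1 w S : good w -> S \in cl w -> (1 < #|S|)%N.
Proof. by move=> gw; rewrite good_pr // => /(pr_card (good_nested gw)). Qed.

(** Each vertex has weight at least one and the total weight is [#|X|.-1]. Binary trees thus have
    the maximal number of vertices. *)
Lemma good_size w : good w -> (size w < #|X|)%N.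
Proof.
move=> gw; case: w gw => [|l w] gw.
  have := good_root gw; rewrite in_nil orbF => /eqP -> //.
have X1 : (1 < #|X|)%N.
  have := good_gt1 gw (mem_head l.1 (cl w)).
  by have := subset_leq_card (subsetT l.1); rewrite cardsT; lia.
have rt : setT \in cl (l :: w) by have := good_root gw; rewrite gtn_eqF.
have /allP/(_ _) := let: And5 _ _ _ c _ := and5P gw in c.
have /mapP[r rw E] := rt; move/(_ r rw); rewrite -E cardsT /csum => /eqP sE.
have /allP pos := let: And5 _ p _ _ _ := and5P gw in p.
suff : (size (l :: w) <= #|X|.-1)%N by lia.
rewrite -sE -sum1_size big_mkcond [X in (_ <= X)%N]big_mkcond big_seq [X in (_ <= X)%N]big_seq.
by apply: leq_sum => l' lw; rewrite subsetT pos.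
Qed.

Lemma inner_good w C : good w -> C \in cl w -> C != setT -> inner (val w) C.
Proof.
move=> gw Cw CT; split; first by rewrite -[pr _ _](good_pr gw).
have := good_root gw => /orP[/eqP X1|rt].
  by have := good_gt1 gw Cw; have := subset_leq_card (subsetT C); rewrite cardsT X1; lia.
exists setT; first by rewrite -[pr _ _](good_pr gw).
by rewrite properT.
Qed.

Lemma good_contr w C s : good w -> C \in cl w -> C != setT ->
  uniq s -> s =i [predD1 cl w & C] -> good (mkw (contr (val w) C) s).
Proof.
move=> gw Cw CT us es; have iC := inner_good gw Cw CT; have nt := good_nested gw.
apply: good_mkw => //; first exact: nested_contr.
  by move=> S; rewrite es inE [in RHS]/in_mem /= pr_contr // -[pr _ _](good_pr gw).
case/orP: (good_root gw) => [->//|rt]; apply/orP; right.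
by rewrite es inE eq_sym CT.
Qed.

(** The contractions interact only if [C] and [D] share their parent or one is the parent of the
    other; then three weights are added in different orders. *)
Lemma contrC w C D : good w -> C \in cl w -> C != setT -> D \in cl w -> D != setT -> C != D ->
  contr (contr (val w) C) D = contr (contr (val w) D) C.
Proof.
move=> gw Cw CT Dw DT nCD; have nt := good_nested gw.
have iC := inner_good gw Cw CT; have iD := inner_good gw Dw DT.
move: (val w) nt iC iD => t nt {gw Cw Dw} iC iD.
(* After the contraction of [A], a vertex that sat on [A] sits on the parent of [A]; all other
   parents persist. *)
have parE A B : inner t A -> inner t B -> A != B ->
    par (contr t A) B = if par t B == A then par t A else par t B.
  move=> iA iB nAB; have [pA Apr mA] := parP nt iA; have [pB Bpr mB] := parP nt iB.
  case: eqP => E.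
    apply: par_eq => [||S]; first by rewrite pr_contr // par_neq.
      by rewrite E in Bpr; exact: proper_trans Apr.
    rewrite pr_contr // => /andP[SA pS] BS; apply: mA => //.
    by rewrite properEneq eq_sym SA -E mB.
  apply: par_eq => [||S]; rewrite ?pr_contr //; first by rewrite pB andbT; apply/eqP.
  by move=> /andP[_ pS]; exact: mB.
have asym : ~ (par t C = D /\ par t D = C).
  move=> [E1 E2]; have [_ h1 _] := parP nt iC; have [_ h2 _] := parP nt iD.
  rewrite E1 in h1; rewrite E2 in h2; by have := proper_trans h1 h2; rewrite properxx.
have nC := par_neq nt iC; have nD := par_neq nt iD.
have nDC : D != C by rewrite eq_sym.
apply/funext => S; rewrite {1}/contr [in RHS]/contr !parE //.
have [->|nSD] := eqVneq S D.
  by rewrite (negbTE nDC); case: (eqVneq (par t C) D) => [_|n]; rewrite eq_sym ?(negbTE nD) ?(negbTE n).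
have [->|nSC] := eqVneq S C.
  by rewrite /contr eqxx; case: (eqVneq (par t D) C) => [_|n]; rewrite eq_sym ?(negbTE nC) ?(negbTE n).
rewrite /contr ?(negbTE nSC) ?(negbTE nSD) (negbTE nCD) (negbTE nDC).
have pA u v v' : padd (padd u v) v' = padd (padd u v') v.
  by rewrite /padd /=; congr (_, _); lia.
have pA' u v v' : padd (padd u v) v' = padd u (padd v v').
  by rewrite /padd /=; congr (_, _); lia.
have [E1|n1] := eqVneq (par t D) C; have [E2|n2] := eqVneq (par t C) D.
- by case: asym.
- by rewrite E1 (negbTE nSC); case: eqP => // _; rewrite pA'.
- by rewrite E2 (negbTE nSD); case: eqP => // _; rewrite pA'.
- by case: eqP => // _; case: eqP => // _; rewrite pA.
Qed.
End Words.

(** * The complex of decorated trees and its acyclicity *)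

Notation word X := (seq ({set X} * (nat * nat))).

Section Cochains.
Variables (K : fieldType) (X : finType).

(* Vertices of every arity anticommute: an operadic suspension turns their degree
   2 - n into 1, and [gsign] undoes it in composites. *)
Definition is_cochain (a : word X -> K) : Prop :=
  antisym a /\ forall w, ~~ good w -> a w = 0.

Definition cochain_pred : {pred (word X -> K^o)} := fun a => `[< is_cochain a >].

Fact cochain_pred_submod : submod_closed cochain_pred.
Proof.
split=> [|c a b /asboolP[asa sa] /asboolP[asb sb]]; apply/asboolP; split.
- by move=> u x y v; change (0 = - 0 :> K); rewrite oppr0.
- by [].
- move=> u x y v; change (c * a (u ++ x :: y :: v) + b (u ++ x :: y :: v) =
    - (c * a (u ++ y :: x :: v) + b (u ++ y :: x :: v))).
  by rewrite asa asb mulrN opprD.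
- by move=> w gw; change (c * a w + b w = 0); rewrite sa // sb // mulr0 addr0.
Qed.

HB.instance Definition _ := GRing.isSubmodClosed.Build K (word X -> K^o) cochain_pred
  cochain_pred_submod.

Record cochain := Cochain { cfun : word X -> K^o; _ : cfun \in cochain_pred }.
HB.instance Definition _ := [isSub for cfun].
HB.instance Definition _ := [Choice of cochain by <:].
HB.instance Definition _ := [SubChoice_isSubLmodule of cochain by <:].

Definition ev (a : cochain) (w : word X) : K := cfun a w.
Coercion ev : cochain >-> Funclass.

Implicit Types a b : cochain.

Lemma cochain_antisym a : antisym a.
Proof. by case: a => f H; have /asboolP[h _] : cochain_pred f := H. Qed.

Lemma cochain_supp a w : ~~ good w -> a w = 0.
Proof. by case: a => f H; have /asboolP[_ h] : cochain_pred f := H; exact: h. Qed.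

Lemma cochain_eq a b : (forall w, good w -> a w = b w) -> a = b.
Proof.
move=> e; apply: val_inj; apply/funext => w; case: (boolP (good w)) => [/e //|ng].
by rewrite [LHS](cochain_supp a ng) [RHS](cochain_supp b ng).
Qed.

Definition mkcochain (f : word X -> K) (H : is_cochain f) : cochain :=
  @Cochain f (asboolT H).

Arguments ev : simpl never.
Arguments mkcochain : simpl never.

Lemma evD a b w : (a + b) w = a w + b w. Proof. by []. Qed.
Lemma evZ c a w : (c *: a) w = c * a w. Proof. by []. Qed.
Lemma evN a w : (- a) w = - a w. Proof. by []. Qed.
Lemma ev0 w : (0 : cochain) w = 0. Proof. by []. Qed.
Lemma ev_sum I (r : seq I) (P : pred I) (F : I -> cochain) w :
  (\sum_(i <- r | P i) F i) w = \sum_(i <- r | P i) F i w.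
Proof. by apply: (big_morph (fun a : cochain => a w)). Qed.

Lemma good_cat_swap u x y v : good (u ++ x :: y :: v) = good (u ++ y :: x :: v :> word X).
Proof.
by apply: perm_good; rewrite perm_cat2l -!(cat1s _ (_ :: v)) -!(cat1s _ v) perm_catCA.
Qed.

(** The sum of the vertex degrees 2 - n: each is 1 minus the weight, and the weights total
    [#|X|.-1]. *)
Definition wdeg (w : word X) : int := (size w)%:Z + 1 - #|X|%:Z.

Definition chomog (d : int) (a : cochain) : Prop := forall w, a w != 0 -> wdeg w = d.

Fact chomog0 d : chomog d 0.
Proof. by move=> w; rewrite ev0 eqxx. Qed.

Fact chomog_linear d c a b : chomog d a -> chomog d b -> chomog d (c *: a + b).
Proof.
move=> ha hb w; rewrite evD evZ; have [z|/ha //] := eqVneq (a w) 0.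
by rewrite z mulr0 add0r; exact: hb.
Qed.

Fact cut_proof (P : nat -> bool) a : is_cochain (fun w => if P (size w) then a w else 0).
Proof.
split=> [u x y v|w gw]; last by rewrite cochain_supp // if_same.
by rewrite !size_cat /=; case: ifP => _; rewrite ?oppr0 // cochain_antisym.
Qed.

Definition cut P a := mkcochain (cut_proof P a).

Arguments cut : simpl never.
Lemma cutE P a w : cut P a w = if P (size w) then a w else 0. Proof. by []. Qed.

Fact chomog_span a : exists (s : seq int) (f : int -> cochain),
  (forall d, chomog d (f d)) /\ a = \sum_(d <- s) f d.
Proof.
exists [seq i%:Z + 1 - #|X|%:Z | i <- iota 0 #|X|],
       (fun d => cut (fun i => i%:Z + 1 - #|X|%:Z == d) a); split.
  by move=> d w; rewrite cutE; case: ifP => [/eqP //|_]; rewrite eqxx.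
apply: cochain_eq => w gw; rewrite ev_sum big_map.
rewrite (bigD1_seq (size w)) ?iota_uniq ?mem_iota ?good_size // cutE eqxx.
rewrite /= big1 ?addr0 // => i ni; rewrite cutE; case: eqP => // E.
by case/eqP: ni; move: E => /addIr/addIr [].
Qed.

Fact chomog_indep (s : seq int) (f : int -> cochain) : uniq s ->
    (forall d, chomog d (f d)) -> \sum_(d <- s) f d = 0 -> forall d, d \in s -> f d = 0.
Proof.
move=> us hf s0 d ds; apply: cochain_eq => w gw; rewrite ev0; apply/eqP/negPn/negP => nz.
have := congr1 (fun a : cochain => a w) s0; rewrite ev0 ev_sum (bigD1_seq d) //= big1.
  by rewrite addr0 => z; rewrite z eqxx in nz.
move=> e ne; apply/eqP/negPn/negP => nz'; case/eqP: ne.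
by rewrite -(hf _ _ nz) (hf _ _ nz').
Qed.

Definition cspace : graded_space K :=
  GradedSpace chomog0 chomog_linear chomog_span chomog_indep.

(** The root [setT] has no edge below it: its term is 0, but its position still counts in the
    alternating signs. *)
Definition dfun (a : word X -> K) (w : word X) : K :=
  if good w then
    Dsum (fun C s => if C == setT then 0 else a (mkw (contr (val w) C) s)) (cl w)
  else 0.

Lemma mkw_antisym (a : word X -> K) t : antisym a -> antisym (fun s => a (mkw t s)).
Proof. by move=> asa u x y v; rewrite /mkw !map_cat /=; apply: asa. Qed.

Fact dfun_cochain a : is_cochain (dfun a).
Proof.
split=> [u x y v|w /negbTE gw]; last by rewrite /dfun gw.
rewrite /dfun good_cat_swap; case: ifP => _; last by rewrite oppr0.
have -> : val (u ++ [:: x, y & v]) = val (u ++ [:: y, x & v]).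
  by apply: perm_val; rewrite perm_cat2l -!(cat1s _ (_ :: v)) -!(cat1s _ v) perm_catCA.
rewrite /cl !map_cat /=; apply: Dsum_antisym => C; case: eqP => _ u' x' y' v'.
  by rewrite oppr0.
by apply: (mkw_antisym _ (@cochain_antisym a)).
Qed.

Definition cdiff a : cochain := mkcochain (dfun_cochain a).

Arguments cdiff : simpl never.
Lemma cdiffE a w : good w ->
  cdiff a w = Dsum (fun C s => if C == setT then 0 else a (mkw (contr (val w) C) s)) (cl w).
Proof. by move=> gw; rewrite [LHS]/(dfun a w) /dfun gw. Qed.

Fact cdiff_linear : linear cdiff.
Proof.
move=> c a b; apply: cochain_eq => w gw; rewrite evD evZ !cdiffE // -DsumZ -DsumD.
by apply: eq_Dsum => C u v _; case: ifP => _; rewrite ?mulr0 ?addr0.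
Qed.
HB.instance Definition _ := GRing.isLinear.Build K cochain cochain *:%R cdiff cdiff_linear.

Lemma size_mkw t s : size (mkw t s : word X) = size s. Proof. by rewrite size_map. Qed.

Lemma cdiff_homog d a : chomog d a -> chomog (d + 1) (cdiff a).
Proof.
move=> ha w nz; have gw : good w by apply: contraNT nz => /(cochain_supp (cdiff a)) ->.
apply/eqP; apply: contraNT nz => nd; rewrite cdiffE // Dsum0 // => C u v E.
case: eqP => // _; apply/eqP; apply: contraNT nd => /ha <-.
have : size (cl w) = (size (u ++ v)).+1 by rewrite E !size_cat /= addnS.
rewrite /wdeg size_mkw /cl size_map => ->; rewrite -addn1 PoszD; apply/eqP; ring.
Qed.

Lemma good_face (w : word X) (C : {set X}) u v : good w -> cl w = u ++ C :: v -> C != setT ->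
  good (mkw (contr (val w) C) (u ++ v)) /\ val (mkw (contr (val w) C) (u ++ v)) = contr (val w) C.
Proof.
move=> gw E CT; have uw := good_uniq gw; have Cw : C \in cl w by rewrite E mem_cat mem_head orbT.
have [uuv Cuv] : uniq (u ++ v) /\ C \notin u ++ v.
  by move: uw; rewrite E -cat1s uniq_catCA cat1s /= => /andP[].
have es : u ++ v =i [predD1 cl w & C].
  move=> S; rewrite E !inE !mem_cat inE; case: eqP => [->|//] /=.
  by rewrite -mem_cat (negbTE Cuv).
split; first exact: good_contr.
have iC := inner_good gw Cw CT; apply: val_mkw_pr => // S.
by rewrite es inE [in RHS]/in_mem /= (pr_contr (good_nested gw)) // -[pr _ _](good_pr gw).
Qed.

Lemma cdiff_sq a : cdiff (cdiff a) = 0.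
Proof.
apply: cochain_eq => w gw; rewrite ev0 cdiffE //.
pose t := val w.
rewrite (eq_Dsum (h' := fun C s => Dsum (fun D s' =>
    if (C == setT) || (D == setT) then 0 else a (mkw (contr (contr t C) D) s')) s)); last first.
  move=> C u v E; have [_|CT] /= := eqVneq C setT; first by rewrite Dsum0.
  have [gC vC] := good_face gw E CT.
  by rewrite cdiffE // vC cl_mkw.
rewrite Dsum_sq ?good_uniq // => C D s Cw Dw nCD.
have [->|CT] := eqVneq C setT; first by rewrite orbT.
have [//|DT] := eqVneq D setT; by rewrite /= /t contrC.
Qed.

End Cochains.
Arguments ev : simpl never.
Arguments mkcochain : simpl never.
Arguments cut : simpl never.
Arguments cdiff : simpl never.

(** * Acyclicity in negative degrees *)

Section Acyclicity.
Variables (K : fieldType) (X : finType).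
Implicit Types (w : word X) (a b c : cochain K X) (T C S : {set X}).

Let A w := act #|X| (val w) setT.
Let R w := rk #|X| (val w) setT.

Definition upw w := good w && (if A w is Some T then up (val w) T else false).

(** The new vertex is listed first, so that contracting it again carries the sign +1. *)
Definition insw w : word X :=
  if A w is Some T then mkw (ins (val w) T) (branch (val w) T :: cl w) else w.

Lemma upwP w : upw w -> exists T, [/\ good w, A w = Some T & up (val w) T].
Proof. by rewrite /upw; case: (A w) => [T|]; [move/andP=> []; exists T | rewrite andbF]. Qed.

Lemma branch_neq_setT t T : nested t -> up t T -> branch t T != setT.
Proof.
move=> nt uT; apply/eqP => E; have /proper_card := branch_properT nt uT.
by rewrite E cardsT; have := subset_leq_card (subsetT T); rewrite cardsT; lia.
Qed.

Lemma setT_root w S : good w -> S \in cl w -> setT \in cl w.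
Proof.
move=> gw Sw; have := good_root gw => /orP[/eqP X1|//].
by have := good_gt1 gw Sw; have := subset_leq_card (subsetT S); rewrite cardsT X1; lia.
Qed.

Section Insw.
Variables (w : word X) (T : {set X}).
Hypotheses (gw : good w) (AT : A w = Some T) (uT : up (val w) T).
Local Notation t := (val w).
Local Notation Z := (branch (val w) T).
Let nt : nested t. Proof. exact: good_nested. Qed.

Lemma Z_notin : Z \notin cl w.
Proof. by rewrite good_pr //; case/and3P: uT. Qed.

Lemma T_in : T \in cl w.
Proof. by rewrite good_pr //; case/and3P: uT. Qed.

Lemma good_insw : good (insw w).
Proof.
rewrite /insw AT; apply: good_mkw => /=; first exact: nested_ins.
- by rewrite Z_notin good_uniq.
- by move=> S; rewrite inE [in RHS]/in_mem /= pr_ins // -[pr _ _](good_pr gw).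
- by rewrite inE (setT_root gw T_in) !orbT.
Qed.

Lemma val_insw : val (insw w) = ins t T.
Proof.
rewrite /insw AT; apply: val_mkw_pr => /=; first by rewrite Z_notin good_uniq.
by move=> S; rewrite inE [in RHS]/in_mem /= pr_ins // -[pr _ _](good_pr gw).
Qed.

Lemma cl_insw : cl (insw w) = Z :: cl w.
Proof. by rewrite /insw AT cl_mkw. Qed.

Lemma face_insw u C v : cl w = u ++ C :: v -> C != setT ->
  let w' := mkw (contr (ins t T) C) (Z :: u ++ v) in
  [/\ good w', size w' = size w & upw w' -> (R w' < R w)%N].
Proof.
move=> E CT w'; have E' : cl (insw w) = (Z :: u) ++ C :: v by rewrite cl_insw E.
have [g1 v1] := good_face good_insw E' CT; rewrite val_insw in g1 v1.
split=> //.
  by rewrite size_map /= -[size w](size_map fst) -/(cl w) E !size_cat /= addnS.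
move=> /upwP[T' [_ A' u']]; rewrite /A /R v1 in A' u' *.
apply: (rk_ins_contr (T := T) (T' := T')) => //.
- by rewrite cardsT.
- by rewrite pr_ins // -[pr _ _](good_pr gw) E mem_cat mem_head !orbT.
- by rewrite properT.
- by apply: contraNneq Z_notin => <-; rewrite E mem_cat mem_head orbT.
Qed.

(** The tree [w] is the face of [insw w] at its first letter. The other faces are the possible
    continuations of a gradient path, so this is the diagonal entry of a triangular system. *)
Lemma cdiff_insw a :
  (forall u C v, cl w = u ++ C :: v -> C != setT ->
    a (mkw (contr (ins t T) C) (Z :: u ++ v)) = 0) ->
  cdiff a (insw w) = a w.
Proof.
move=> h; rewrite cdiffE ?good_insw // cl_insw val_insw /=.
rewrite (negbTE (branch_neq_setT nt uT)) contr_ins // mkw_val ?good_uniq //.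
rewrite Dsum0 ?subr0 // => C u v E; case: eqP => // /eqP CT; exact: h.
Qed.

End Insw.

Lemma val_swap u x y v : val (u ++ x :: y :: v) = val (u ++ y :: x :: v :> word X).
Proof.
by apply: perm_val; rewrite perm_cat2l -!(cat1s _ (_ :: v)) -!(cat1s _ v) perm_catCA.
Qed.

Lemma upw_swap u x y v : upw (u ++ x :: y :: v) = upw (u ++ y :: x :: v).
Proof. by rewrite /upw /A good_cat_swap val_swap. Qed.

Fact layer_proof (r : nat) a : is_cochain (fun w =>
  if [&& upw w, (size w).+2 < #|X| & R w == r]%N then a (insw w) else 0).
Proof.
split=> [u x y v|w gw]; last by rewrite /upw (negbTE gw).
rewrite upw_swap {1}/R val_swap -/(R _) !size_cat /=; case: ifP => [/and3P[uw _ _]|_]; last by rewrite oppr0.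
have [T [_ AT _]] := upwP uw.
have AT' : A (u ++ x :: y :: v) = Some T by rewrite -AT /A val_swap.
rewrite /insw AT AT' val_swap /mkw /cl /= !map_cat /=.
exact: (cochain_antisym a (_ :: _)).
Qed.

(** Prescribes on the [up] trees of rank [r] the value that a primitive of [a] must have. The bound
    on the size keeps [insw w] strictly below the binary trees, so that the differential of a layer
    does not reach degree 0. *)
Definition layer r a : cochain K X := mkcochain (layer_proof r a).

Lemma layerE r a w : layer r a w =
  if [&& upw w, (size w).+2 < #|X| & R w == r]%N then a (insw w) else 0.
Proof. by []. Qed.

Lemma cdiff_layer r a w : upw w -> (R w <= r)%N -> cdiff (layer r a) (insw w) = layer r a w.
Proof.
move=> /upwP[T [gw AT uT]] le; apply: (cdiff_insw gw AT uT) => u C v E CT.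
have [_ _ lt] := face_insw gw AT uT E CT; rewrite layerE; case: ifP => // /and3P[/lt + _ /eqP].
lia.
Qed.

(** Solves the triangular system by increasing rank. The other faces of [insw w] have smaller rank
    than [w] when they are [up], so a layer of rank [r] does not disturb the equations already
    solved. *)
Lemma cancel_up a r : exists b : cochain K X,
  (forall w, b w != 0 -> upw w && ((size w).+2 < #|X|)%N) /\
  (forall w, upw w -> ((size w).+2 < #|X|)%N -> (R w < r)%N -> (a - cdiff b) (insw w) = 0).
Proof.
elim: r => [|r [b [hb hr]]]; first by exists 0; split=> [w|//]; rewrite ev0 eqxx.
exists (b + layer r (a - cdiff b)); split=> [w|w uw sw].
  rewrite evD; have [->|/hb //] := eqVneq (b w) 0.
  by rewrite add0r layerE; case: ifP => [/and3P[-> ->]|]; rewrite ?eqxx.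
rewrite ltnS => le; rewrite linearD opprD addrA evD evN cdiff_layer // layerE uw sw /=.
case: eqP => [_|/eqP ne]; first by rewrite subrr.
by rewrite subr0 hr // ltn_neqAle ne.
Qed.

Lemma cdiff_short a n w : (forall w, a w != 0 -> ((size w).+1 < n)%N) -> (n <= size w)%N ->
  cdiff a w = 0.
Proof.
move=> ha nw; have [gw|/cochain_supp -> //] := boolP (good w).
rewrite cdiffE // Dsum0 // => C u v E; case: eqP => // _; apply/eqP; apply: contraTT nw => /ha.
have -> : size w = (size (u ++ v)).+1.
  by rewrite -[size w](size_map fst) -/(cl w) E !size_cat /= addnS.
by rewrite size_mkw -ltnNge.
Qed.

(** The primitive is made to agree with [a] on the [down] trees only. That the difference vanishes
    on the [up] trees too is then forced by its being closed. *)
Theorem cdiff_acyclic a : cdiff a = 0 -> (forall w, (size w).+1 = #|X| -> a w = 0) ->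
  exists b, a = cdiff b.
Proof.
move=> da top; have [b [hb hr]] := cancel_up a (base X ^ #|X|).
exists b; apply/eqP; rewrite -subr_eq0; apply/eqP.
set a' := a - cdiff b in hr *.
have da' : cdiff a' = 0 by rewrite linearB /= da sub0r cdiff_sq oppr0.
have top' w : (#|X| <= (size w).+1)%N -> a' w = 0.
  move=> le; have [gw|/cochain_supp -> //] := boolP (good w).
  have sw : (size w).+1 = #|X| by have := good_size gw; lia.
  rewrite evD evN top // sub0r; apply/eqP; rewrite oppr_eq0; apply/eqP.
  by apply: (@cdiff_short _ #|X|.-1) => [w' /hb /andP[_]|]; lia.
(* A tree that is not [up] is, up to order, some [insw w0], where [b] was chosen to cancel [a], or
   it is unmatched. *)
have notup w : good w -> ~~ upw w -> a' w = 0.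
  move=> gw nu; have [le|sw] := leqP #|X| (size w).+1; first exact: top'.
  have nt := good_nested gw.
  case E: (A w) => [T|].
    have [_ [uT|dT]] := act_spec nt E; first by move: nu; rewrite /upw gw E uT.
    have [pT pZ _] := dT; set Z := branch (val w) T in pZ.
    have iZ := branch_inner nt pT pZ.
    have Zw : Z \in cl w by rewrite good_pr.
    have ZT : Z != setT.
      apply/eqP => ZT; have /proper_card := branch_properS nt pT.
      by rewrite -/Z ZT cardsT; have := subset_leq_card (subsetT T); rewrite cardsT; lia.
    have [u [v Ecl]] : exists u v, cl w = u ++ Z :: v by case/splitPr: Zw => u v; exists u, v.
    have [g0 v0] := good_face gw Ecl ZT; set w0 := mkw _ _ in g0 v0.
    have A0 : A w0 = Some T by rewrite /A v0; exact: act_contr.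
    have u0 : up (val w0) T by rewrite v0; exact: up_contr.
    have U0 : upw w0 by rewrite /upw g0 A0.
    have s0 : size w = (size w0).+1.
      by rewrite -[size w](size_map fst) -/(cl w) Ecl size_mkw !size_cat /= addnS.
    have : a' (insw w0) = 0 by apply: hr; rewrite ?rk_bound //; lia.
    have pw : perm_eq w (insw w0).
      rewrite /insw A0 v0 ins_contr // branch_contr // -/Z cl_mkw -[X in perm_eq X _]mkw_val ?good_uniq //.
      by apply: perm_map; rewrite Ecl -cat1s perm_catCA.
    have [e he] := antisym_perm K pw; rewrite (he a' (@cochain_antisym _ _ a')).
    by move/eqP; rewrite mulf_eq0 signr_eq0 => /eqP.
  (* Without a match all weights are 1, so [w] has [#|X|.-1] vertices and lies in degree 0, which
     was treated before. *)
  exfalso; suff : (size w).+1 = #|X| by lia.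
  have rt : setT \in cl w by have := good_root gw; rewrite gtn_eqF //; lia.
  have pT : pr (val w) setT by rewrite -[pr _ _](good_pr gw).
  have w1 S : S \in cl w -> wt (val w S) = 1%N.
    rewrite (good_pr gw) => pS.
    by apply: (act_none nt _ (or_introl pT) E (subsetT S) pS); rewrite cardsT.
  have := nt.2 _ pT; rewrite tsum_val cardsT /csum big_seq_cond.
  rewrite (eq_bigr (fun=> 1%N)) => [|l /andP[lw _]]; last first.
    by rewrite -(val_uniq (good_uniq gw) lw) w1 // map_f.
  rewrite -big_seq_cond (eq_bigl xpredT) => [|l]; last by rewrite subsetT.
  by rewrite sum1_size => ->; rewrite prednK //; apply: leq_ltn_trans sw.
apply: cochain_eq => w gw; rewrite ev0.
(* Evaluated at [insw w], closedness expresses [a' w] by the other faces, which are not [up] or have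
   smaller rank. *)
have [r] := ubnP (R w); elim: r w gw => // r IH w gw lt.
have [uw|] := boolP (upw w); last exact: notup.
have [T [_ AT uT]] := upwP uw.
rewrite -(cdiff_insw gw AT uT) ?da' ?ev0 // => u C v E CT.
have [g' _ lt'] := face_insw gw AT uT E CT.
have [u'|nu] := boolP (upw (mkw (contr (ins (val w) T) C) (branch (val w) T :: u ++ v))).
  by apply: IH => //; have := lt' u'; lia.
exact: notup.
Qed.
End Acyclicity.

(** * Grafting *)

Section Pull.
Variables (X Y : finType) (f : X -> Y).

Definition pull (w : word Y) : word X := map (fun l : {set Y} * (nat * nat) => (f @^-1: l.1, l.2)) w.

Lemma pull_cat u v : pull (u ++ v) = pull u ++ pull v.
Proof. exact: map_cat. Qed.

Lemma cl_pull w : cl (pull w) = map (fun C : {set Y} => f @^-1: C) (cl w).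
Proof. by rewrite /cl /pull -!map_comp. Qed.

Lemma csum_pull w T : csum (pull w) T = (\sum_(l <- w | f @^-1: l.1 \subset T) wt l.2)%N.
Proof. by rewrite /csum big_map. Qed.

End Pull.

Section Glue.
Variables (U V Y : finType) (o : U -> Y) (q : V -> Y) (i : U).
Hypotheses (oI : injective o) (qI : injective q).
Let B := q @: setT.
Hypotheses (oB : forall j, (o j \in B) = (j == i)) (oq : forall y, y \in B \/ exists j, y = o j).
Implicit Types (S T : {set Y}) (w : word Y) (l : {set Y} * (nat * nat)).

(* Gluing a tree with leaves V into the leaf i of a tree with leaves U: [q] embeds
   V into the leaves Y of the result, [o] embeds U \ {i}, and sends i into the image
   of [q].  [upp q w] and [low o q w] are the two factors of the tree [w]. *)
Definition isblk l := l.1 \subset B.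
Definition sat S := [|| S \subset B, B \subset S | [disjoint S & B]].
Definition low w := pull o (filter (predC isblk) w).
Definition upp w := pull q (filter isblk w).

Lemma card_B : #|B| = #|V|. Proof. by rewrite card_imset // cardsT. Qed.

Lemma B_gt0 : (0 < #|B|)%N.
Proof. by rewrite card_gt0; apply/set0Pn; exists (o i); rewrite oB. Qed.

Lemma imset_q S : S \subset B -> q @: (q @^-1: S) = S.
Proof.
move=> /subsetP SB; apply/setP => y; apply/imsetP/idP => [[x + ->]|yS]; first by rewrite inE.
by have /imsetP[x _ E] := SB y yS; exists x => //; rewrite inE -E.
Qed.

Lemma card_q S : S \subset B -> #|q @^-1: S| = #|S|.
Proof. by move=> SB; rewrite -[in RHS](imset_q SB) card_imset. Qed.

Lemma sub_q S T : S \subset B -> (q @^-1: S \subset q @^-1: T) = (S \subset T).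
Proof.
move=> SB; apply/idP/idP => [h|]; last exact: preimsetS.
rewrite -(imset_q SB); apply/subsetP => y /imsetP[x xS ->].
by have := subsetP h x xS; rewrite inE.
Qed.

Lemma disj_q S T : S \subset B -> [disjoint q @^-1: S & q @^-1: T] = [disjoint S & T].
Proof.
move=> SB; rewrite -!setI_eq0 -preimsetI -!cards_eq0 card_q //.
by rewrite (subset_trans (subsetIl _ _)).
Qed.

(** Shape of the clusters of the lower factor inside [Y]: the block is contained or avoided as a
    whole. On such sets the preimage under [o] loses no information. *)
Definition lowt S := (B \subset S) || [disjoint S & B].

Lemma lowtP S : sat S -> ~~ (S \subset B) -> lowt S.
Proof. by rewrite /sat => /or3P[->|h|h] //; rewrite /lowt h ?orbT. Qed.

Lemma lowt_i S : lowt S -> (i \in o @^-1: S) = (B \subset S).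
Proof.
have iB : o i \in B by rewrite oB.
rewrite inE => /orP[BS|dS]; first by rewrite BS (subsetP BS).
rewrite (disjointFl dS) //; apply/esym/negP => BS.
by have := disjointFl dS iB; rewrite (subsetP BS).
Qed.

Lemma sub_o S T : lowt S -> lowt T -> (o @^-1: S \subset o @^-1: T) = (S \subset T).
Proof.
move=> lS lT; apply/idP/idP => [h|]; last exact: preimsetS.
apply/subsetP => y yS; case: (oq y) => [yB|[j E]]; last first.
  by have := subsetP h j; rewrite !inE -E; apply.
have BS : B \subset S by case/orP: lS => // dS; rewrite (disjointFr dS yS) in yB.
have : i \in o @^-1: T by rewrite (subsetP h) // lowt_i.
by rewrite lowt_i // => /subsetP; apply.
Qed.

Lemma o_inj S T : lowt S -> lowt T -> o @^-1: S = o @^-1: T -> S = T.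
Proof.
by move=> lS lT E; apply/eqP; rewrite eqEsubset -!sub_o // E subxx.
Qed.

Lemma disj_o S T : lowt S -> lowt T -> [disjoint o @^-1: S & o @^-1: T] = [disjoint S & T].
Proof.
move=> lS lT; rewrite -!setI_eq0 -preimsetI; apply/eqP/eqP => [E|->]; last exact: preimset0.
apply/setP => y; rewrite [RHS]inE; apply/negP => yST; move: (yST); rewrite inE => /andP[yS yT].
case: (oq y) => [yB|[j Ej]].
  have BS : B \subset S by case/orP: lS => // d; rewrite (disjointFr d yS) in yB.
  have BT : B \subset T by case/orP: lT => // d; rewrite (disjointFr d yT) in yB.
  have : i \in o @^-1: (S :&: T) by rewrite inE (subsetP (_ : B \subset _)) ?oB // subsetI BS.
  by rewrite E inE.
by have : j \in o @^-1: (S :&: T) by [rewrite inE -Ej]; rewrite E inE.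
Qed.

(** The lower factor sees the whole block as the single leaf [i]. *)
Lemma card_o S : lowt S -> #|S| = (#|o @^-1: S| + (if B \subset S then #|V|.-1 else 0))%N.
Proof.
move=> lS; rewrite -(cardsID B S).
have eD : S :\: B = o @: (o @^-1: S :\ i).
  apply/setP => y; rewrite inE; apply/andP/imsetP => [[nB yS]|[j + ->]].
    case: (oq y) => [yB|[j E]]; first by rewrite yB in nB.
    by exists j => //; rewrite !inE -E yS andbT -oB -E.
  by rewrite !inE oB => /andP[].
rewrite eD card_imset // (cardsD1 i (o @^-1: S)) lowt_i //.
case: ifP => BS /=; last first.
  rewrite (_ : S :&: B = set0) ?cards0 ?addn0 //; apply/eqP; rewrite setI_eq0.
  by case/orP: lS; rewrite // BS.
by rewrite (setIidPr BS) card_B addnAC add1n prednK // -card_B B_gt0.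
Qed.

Section Sat.
Variables (w : word Y) (sw : all (fun l => sat l.1) w) (n0 : set0 \notin cl w).

Lemma low_lowt l : l \in w -> ~~ isblk l -> lowt l.1.
Proof. by move=> lw; apply: lowtP; have /allP := sw; apply. Qed.

Lemma uniq_glue : uniq (cl w) = uniq (cl (low w)) && uniq (cl (upp w)).
Proof.
rewrite !cl_pull (@map_inj_in_uniq _ _ (fun C : {set Y} => o @^-1: C)); last first.
  move=> S T /mapP[l + ->] /mapP[l' + ->]; rewrite !mem_filter => /andP[lB lw] /andP[lB' lw'].
  by apply: o_inj; apply: low_lowt.
rewrite (@map_inj_in_uniq _ _ (fun C : {set Y} => q @^-1: C)); last first.
  move=> S T /mapP[l + ->] /mapP[l' + ->]; rewrite !mem_filter => /andP[lB _] /andP[lB' _] E.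
  by rewrite -(imset_q lB) E imset_q.
have pw : perm_eq (cl w) (cl (filter (predC isblk) w) ++ cl (filter isblk w)).
  by rewrite /cl -map_cat; apply: perm_map; rewrite perm_sym perm_catC perm_filterC.
rewrite (perm_uniq pw) cat_uniq; case: (uniq _) => //=; rewrite (_ : has _ _ = false) //.
apply/hasPn => S /mapP[l]; rewrite mem_filter => /andP[lB _] ->.
apply/negP => /mapP[l']; rewrite mem_filter => /andP[+ _] E.
by rewrite /= /isblk -E => /negP.
Qed.

Lemma all_glue (P : pred (nat * nat)) :
  all (fun l => P l.2) w = all (fun k => P k.2) (low w) && all (fun k => P k.2) (upp w).
Proof.
rewrite !all_map !all_filter -all_predI; apply: eq_all => l /=.
by case: (isblk l); rewrite ?andbT.
Qed.

Lemma csum_upp l : l \in w -> isblk l -> csum w l.1 = csum (upp w) (q @^-1: l.1).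
Proof.
move=> lw lB; rewrite csum_pull big_filter_cond /csum; apply: eq_bigl => l'.
apply/idP/andP => [h|[lB' h]].
  have lB' : isblk l' by exact: subset_trans lB.
  by rewrite sub_q.
by rewrite -sub_q.
Qed.

Lemma csum_low l : l \in w -> ~~ isblk l -> csum w l.1 =
  (csum (low w) (o @^-1: l.1) + (if B \subset l.1 then csum (upp w) setT else 0))%N.
Proof.
move=> lw nlB; have lt := low_lowt lw nlB.
rewrite !csum_pull !big_filter_cond /csum (bigID isblk) /= addnC; congr (_ + _)%N.
  rewrite big_seq_cond [RHS]big_seq_cond; apply: eq_bigl => l'.
  case lw': (l' \in w) => //=; case lB': (isblk l') => /=; first by rewrite andbF.
  by rewrite andbT sub_o //; apply: low_lowt => //; rewrite lB'.
case: ifP => BS.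
  apply: eq_bigl => l'; rewrite subsetT andbT; case lB': (isblk l'); last by rewrite andbF.
  by rewrite (subset_trans lB' BS).
rewrite big_seq_cond big1 // => l' /and3P[lw' h lB']; case/negP: n0.
move: lt; rewrite /lowt BS /= => dl; rewrite (_ : set0 = l'.1) ?map_f //.
by apply/esym/eqP; rewrite -subset0 -(eqP (_ : l.1 :&: B == set0)) ?setI_eq0 // subsetI h.
Qed.

Lemma lam_glue : all (fun l => all (fun l' => lam l.1 l'.1) w) w =
  all (fun k => all (fun k' => lam k.1 k'.1) (low w)) (low w) &&
  all (fun k => all (fun k' => lam k.1 k'.1) (upp w)) (upp w).
Proof.
apply/idP/andP => [/allP h|[/allP h1 /allP h2]].
  split; apply/allP => l /mapP[k + ->]; rewrite mem_filter => /andP[kB kw];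
  apply/allP => l' /mapP[k' + ->]; rewrite mem_filter => /andP[kB' kw'] /=;
  have /allP/(_ _ kw') := h k kw; rewrite /lam.
  - by rewrite !sub_o ?disj_o //; apply: low_lowt.
  - by rewrite !sub_q ?disj_q.
apply/allP => l lw; apply/allP => l' lw'.
have [lB|nlB] := boolP (isblk l); have [lB'|nlB'] := boolP (isblk l').
- have := h2 (q @^-1: l.1, l.2); rewrite /upp map_f ?mem_filter ?lB // => /(_ isT) /allP.
  move=> /(_ (q @^-1: l'.1, l'.2)); rewrite map_f ?mem_filter ?lB' // => /(_ isT).
  by rewrite /lam /= !sub_q ?disj_q.
- have := low_lowt lw' nlB'; rewrite /lam => /orP[BS|dS].
    by rewrite (subset_trans lB BS).
  by rewrite [X in _ || X]orbC disjoint_sym (disjointWr lB dS) !orbT.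
- have := low_lowt lw nlB; rewrite /lam => /orP[BS|dS].
    by rewrite (subset_trans lB' BS) orbT.
  by rewrite (disjointWr lB' dS) !orbT.
- have := h1 (o @^-1: l.1, l.2); rewrite /low map_f ?mem_filter /= ?nlB // => /(_ isT) /allP.
  move=> /(_ (o @^-1: l'.1, l'.2)); rewrite map_f ?mem_filter /= ?nlB' // => /(_ isT).
  by rewrite /lam /= !sub_o ?disj_o //; apply: low_lowt.
Qed.

Lemma root_low : (#|U| == 1%N) || (setT \in cl (low w)) =
  (#|U| == 1%N) || (setT \in cl w).
Proof.
case: eqP => //= U1; rewrite cl_pull; apply/mapP/idP => [[S]|rt].
  move=> /mapP[l]; rewrite mem_filter => /andP[nlB lw] -> E.
  rewrite (_ : setT = l.1) ?map_f //; apply: o_inj; rewrite ?E; last by rewrite preimsetT.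
    by rewrite /lowt subsetT.
  exact: low_lowt.
exists setT; rewrite ?preimsetT //; have /mapP[l lw E] := rt; apply/mapP; exists l => //.
rewrite mem_filter lw andbT /= /isblk -E; apply/negP => TB; apply: U1.
apply/eqP; rewrite -cardsT (_ : setT = [set i]) ?cards1 //.
by apply/setP => j; rewrite !inE -oB (subsetP TB).
Qed.

Lemma root_upp : setT \in cl (upp w) = (B \in cl w).
Proof.
rewrite cl_pull; apply/mapP/idP => [[S]|BW].
  move=> /mapP[l]; rewrite mem_filter => /andP[lB lw] -> E.
  by rewrite (_ : B = l.1) ?map_f // /B E imset_q.
exists B; last by apply/setP => x; rewrite !inE imset_f.
have /mapP[l lw E] := BW; apply/mapP; exists l => //.
by rewrite mem_filter lw andbT /isblk -E.
Qed.

End Sat.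

Lemma root_glue w : #|Y| = (#|U| + #|V|).-1 -> B \in cl w \/ #|V| = 1%N ->
  (#|Y| == 1%N) || (setT \in cl w) = (#|U| == 1%N) || (setT \in cl w).
Proof.
have V1 := B_gt0; rewrite card_B in V1.
have U1 : (0 < #|U|)%N by apply/card_gt0P; exists i.
move=> cY hB; have [E|nE] := eqVneq #|U| 1%N => /=.
  case: hB => [BW|EV]; last by rewrite cY E EV.
  rewrite (_ : setT = B) ?BW ?orbT //; apply/esym/eqP.
  by rewrite eqEcard subsetT card_B cardsT cY E; lia.
by rewrite (_ : (#|Y| == 1%N) = false) //; apply/negP; lia.
Qed.

Lemma good_sat w : good w -> B \in cl w \/ #|V| = 1%N -> all (fun l => sat l.1) w.
Proof.
move=> gw; rewrite /sat => -[/mapP[b bw Eb]|V1].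
  apply/allP => l lw; have /and5P[_ _ /allP h _ _] := gw.
  by have /allP/(_ _ bw) := h l lw; rewrite /lam -Eb.
have /cards1P[y Ey] : #|B| == 1%N by rewrite card_B V1.
apply/allP => l lw; rewrite Ey sub1set disjoint_sym disjoints1.
by case: (y \in _); rewrite ?orbT.
Qed.

Lemma set0_good (Z : finType) (w : word Z) : good w -> set0 \notin cl w.
Proof. by move=> gw; apply/negP => /(good_gt1 gw); rewrite cards0. Qed.

Lemma csum_setT (Z : finType) (w : word Z) : good w -> csum w setT = #|Z|.-1.
Proof.
move=> gw; case/orP: (good_root gw) => [/eqP Z1|rt].
  have := good_size gw; rewrite Z1; case: w {gw} => // _; by rewrite /csum big_nil.
by rewrite -tsum_val (good_nested gw).2 ?cardsT // -[pr _ _](good_pr gw).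
Qed.

(** A tree on [Y] is a composite precisely when the block is one of its clusters. For [#|V| = 1] the
    upper factor is the trivial tree and the block a leaf, hence the alternative. *)
Lemma good_glue w : #|Y| = (#|U| + #|V|).-1 ->
  good w && ((B \in cl w) || (#|V| == 1%N)) =
  [&& all (fun l => sat l.1) w, good (low w) & good (upp w)].
Proof.
move=> cY; have V1 := B_gt0; rewrite card_B in V1.
have U1 : (0 < #|U|)%N by apply/card_gt0P; exists i.
(* The weight count is the clause that links the two factors: a lower cluster containing the block
   also contains the total weight [#|V|.-1] of the upper factor. Both directions supply this total,
   each in its own way. *)
suff K : all (fun l => sat l.1) w -> (B \in cl w) || (#|V| == 1%N) -> set0 \notin cl w ->
    csum (upp w) setT = #|V|.-1 -> good w = good (low w) && good (upp w).
  apply/andP/and3P => [[gw h]|[sw gl gu]].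
    have h' : B \in cl w \/ #|V| = 1%N by case/orP: h => [|/eqP]; [left | right].
    have sw := good_sat gw h'; have n0 := set0_good gw.
    have cu : csum (upp w) setT = #|V|.-1.
      case: h' => [/mapP[b bw Eb]|EV].
        have bB : isblk b by rewrite /isblk -Eb.
        have := csum_upp bw bB; rewrite -Eb (_ : q @^-1: B = setT); last first.
          by apply/setP => x; rewrite !inE imset_f.
        by move=> <-; rewrite -tsum_val (good_nested gw).2 ?card_B // Eb -[pr _ _](good_pr gw) map_f.
      rewrite EV csum_pull big_filter_cond /= big_seq_cond big1 // => l /and3P[lw lB _].
      by have := leq_trans (good_gt1 gw (map_f fst lw)) (subset_leq_card lB); rewrite card_B EV.
    by split=> //; have := K sw h n0 cu; rewrite gw; case: (good (low w)).
  have h : (B \in cl w) || (#|V| == 1%N) by have := good_root gu; rewrite root_upp orbC.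
  have n0 : set0 \notin cl w.
    apply/negP => /mapP[l lw E]; have lB : isblk l by rewrite /isblk -E sub0set.
    have := set0_good gu; rewrite cl_pull => /negP; apply; apply/mapP; exists set0.
      by rewrite E map_f // mem_filter lB.
    by rewrite preimset0.
  by rewrite h (K sw h n0) ?csum_setT // gl gu.
move=> sw h n0 cu.
have h' : B \in cl w \/ #|V| = 1%N by case/orP: h => [|/eqP]; [left | right].
rewrite /good uniq_glue // (all_glue w (fun v => 0 < wt v)%N) lam_glue // root_glue //.
rewrite -(root_low sw) root_upp [in X in _ = X](orbC (_ == _) (B \in _)) h.
have -> : all (fun l => csum w l.1 == #|l.1|.-1) w =
  all (fun k => csum (low w) k.1 == #|k.1|.-1) (low w) &&
  all (fun k => csum (upp w) k.1 == #|k.1|.-1) (upp w).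
  apply/idP/andP => [/allP c|[/allP c1 /allP c2]].
    split; apply/allP => l /mapP[k + ->]; rewrite mem_filter => /andP[kB kw] /=; have := c k kw.
      rewrite csum_low // (card_o (low_lowt sw kw kB)) cu; case: ifP => BS; last by rewrite !addn0.
      have := lowt_i (low_lowt sw kw kB); rewrite BS => ik.
      have : (0 < #|o @^-1: k.1|)%N by apply/card_gt0P; exists i.
      lia.
    by rewrite csum_upp // card_q.
  apply/allP => k kw; have [kB|kB] := boolP (isblk k).
    rewrite csum_upp // -card_q //; apply: (c2 (_, k.2)); apply/mapP; exists k => //.
    by rewrite mem_filter kB.
  have := c1 (o @^-1: k.1, k.2); rewrite map_f ?mem_filter /= ?kB // => /(_ isT).
  rewrite csum_low // (card_o (low_lowt sw kw kB)) cu; case: ifP => BS; last by rewrite !addn0.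
  have := lowt_i (low_lowt sw kw kB); rewrite BS => ik.
  have : (0 < #|o @^-1: k.1|)%N by apply/card_gt0P; exists i.
  by case: (#|o @^-1: k.1|) => // c _ /eqP ->; rewrite addSn.
do !case: (uniq _) => //=; do !case: (all _ _) => //=; rewrite ?andbF ?andbT //.
Qed.
End Glue.

Lemma Dsum_map (R : comNzRingType) (T T' : eqType) (g : T -> T') (h : T' -> seq T' -> R) s :
  Dsum h (map g s) = Dsum (fun x u => h (g x) (map g u)) s.
Proof. by elim: s h => //= x s IH h; rewrite IH. Qed.

Lemma signr_parity (R : pzRingType) (a b : nat) : odd a = odd b -> (-1) ^+ a = (-1) ^+ b :> R.
Proof. by move=> E; rewrite -(signr_odd R a) E signr_odd. Qed.

(** * Composition of cochains and the Leibniz rule *)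

Section Compose.
Variables (K : fieldType) (U V Y : finType) (o : U -> Y) (q : V -> Y).
Local Notation B := (q @: setT).
Local Notation blk := (isblk q).
Local Notation lw := (low o q).
Local Notation up := (upp q).
Implicit Types (w : word Y) (a : cochain K U) (b : cochain K V).

(** The [cross] term sorts the vertices into lower factor followed by upper factor. The rest is the
    operadic suspension: [pcmp] takes [e] = i (n - 1) and [f] = m - 1 for a composition of arities m
    and n at input i. *)
Definition gsign (e f : nat) w := (cross blk (predC blk) w + f * size (up w) + e)%N.

Variables e f : nat.

Definition gfun a b w := if good w then (-1) ^+ gsign e f w * (a (lw w) * b (up w)) else 0.

Lemma low_cat u v : lw (u ++ v) = lw u ++ lw v.
Proof. by rewrite /low filter_cat pull_cat. Qed.

Lemma upp_cat u v : up (u ++ v) = up u ++ up v.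
Proof. by rewrite /upp filter_cat pull_cat. Qed.

Fact gfun_cochain a b : is_cochain (gfun a b).
Proof.
split=> [u x y v|w /negbTE gw]; last by rewrite /gfun gw.
rewrite /gfun good_cat_swap; case: ifP => _; last by rewrite oppr0.
have sz : size (up (u ++ x :: y :: v)) = size (up (u ++ y :: x :: v)).
  by rewrite !upp_cat !size_cat !size_map !size_filter /=; congr (_ + _)%N; exact: addnCA.
have cs : (-1) ^+ gsign e f (u ++ x :: y :: v) =
    (-1) ^+ (blk x != blk y) * (-1) ^+ gsign e f (u ++ y :: x :: v) :> K.
  by rewrite /gsign sz -!addnA !(exprD _ (cross _ _ _)) -signr_odd cross_swap signr_addb signr_odd mulrA.
rewrite {}cs !low_cat !upp_cat /low /upp /=.
case xB: (blk x); case yB: (blk y) => /=.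
- by rewrite (cochain_antisym b) mul1r !mulrN.
- by rewrite expr1 !mulN1r mulNr.
- by rewrite expr1 !mulN1r mulNr.
- by rewrite (cochain_antisym a) mul1r mulNr !mulrN.
Qed.

Definition gcomp a b := mkcochain (gfun_cochain a b).

Lemma gcompE a b w : good w -> gcomp a b w = (-1) ^+ gsign e f w * (a (lw w) * b (up w)).
Proof. by move=> gw; rewrite [LHS]/(gfun a b w) /gfun gw. Qed.

Lemma gcomp_linearl b : linear (fun a => gcomp a b).
Proof.
by move=> c a a'; apply: cochain_eq => w gw; rewrite evD evZ !gcompE // evD evZ; ring.
Qed.

Lemma gcomp_linearr a : linear (gcomp a).
Proof.
by move=> c b b'; apply: cochain_eq => w gw; rewrite evD evZ !gcompE // evD evZ; ring.
Qed.

Lemma size_low_upp w : (size (lw w) + size (up w))%N = size w.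
Proof.
by rewrite !size_map !size_filter addnC count_predC.
Qed.

Variable i : U.
Hypotheses (oI : injective o) (qI : injective q).
Hypotheses (oB : forall j, (o j \in B) = (j == i)) (oq : forall y, y \in B \/ exists j, y = o j).
Hypothesis cY : #|Y| = (#|U| + #|V|).-1.

Lemma gcomp_homog d d' a b : chomog d a -> chomog d' b -> chomog (d + d') (gcomp a b).
Proof.
move=> ha hb w nz; have gw : good w by apply: contraNT nz => /(cochain_supp (gcomp a b)) ->.
move: nz; rewrite gcompE // !mulf_eq0 signr_eq0 !negb_or /= => /andP[/ha <- /hb <-].
rewrite /wdeg -(size_low_upp w) PoszD cY.
have U1 : (0 < #|U|)%N by apply/card_gt0P; exists i.
have -> : ((#|U| + #|V|).-1 : int) = #|U|%:Z + #|V|%:Z - 1.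
  by rewrite -subn1 -subzn ?PoszD // addn_gt0 U1.
ring.
Qed.

Lemma upp_good w : good w -> good (up w) -> B \in cl w \/ #|V| = 1%N.
Proof. by move=> gw gu; have := good_root gu; rewrite root_upp // => /orP[/eqP|]; [right | left]. Qed.

Lemma glue_good w : good w -> good (up w) -> all (fun l => sat q l.1) w /\ good (lw w).
Proof.
move=> gw gu; have h := upp_good gw gu.
have := good_glue oI qI oB oq w cY; rewrite gw.
rewrite (_ : (_ \in _) || _ = true); last by case: h => [->//|->]; rewrite eqxx orbT.
by move/esym/and3P => [].
Qed.

Lemma good_upp_B w : good w -> B \in cl w \/ #|V| = 1%N -> good (up w).
Proof.
move=> gw h; have := good_glue oI qI oB oq w cY; rewrite gw.
rewrite (_ : (_ \in _) || _ = true); last by case: h => [->//|->]; rewrite eqxx orbT.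
by move/esym/and3P => [].
Qed.

Section Diff.
Variables (w : word Y) (gw : good w) (gu : good (up w)).
Let sw : all (fun l => sat q l.1) w. Proof. by have [] := glue_good gw gu. Qed.
Let gl : good (lw w). Proof. by have [] := glue_good gw gu. Qed.
Local Notation t := (val w).
Let nt : nested t. Proof. exact: good_nested. Qed.
Let n0 := set0_good gw.

Lemma cl_filter (P : pred {set Y}) : cl (filter (fun l => P l.1) w) = filter P (cl w).
Proof. by rewrite /cl filter_map. Qed.

Lemma cl_low : cl (lw w) = map (fun A : {set Y} => o @^-1: A) (filter (fun A : {set Y} => ~~ (A \subset B)) (cl w)).
Proof. by rewrite cl_pull (cl_filter (fun A => ~~ (A \subset B))). Qed.

Lemma cl_upp : cl (up w) = map (fun A : {set Y} => q @^-1: A) (filter (fun A : {set Y} => A \subset B) (cl w)).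
Proof. by rewrite cl_pull (cl_filter (fun A => A \subset B)). Qed.

Lemma lowt_cl (A : {set Y}) : A \in cl w -> ~~ (A \subset B) -> lowt q A.
Proof. by move=> /mapP[l lw' ->]; exact: (low_lowt sw). Qed.

Lemma val_low (A : {set Y}) : A \in cl w -> ~~ (A \subset B) -> val (lw w) (o @^-1: A) = t A.
Proof.
move=> /mapP[l lw' ->] nB; rewrite val_uniq ?good_uniq //.
apply: (@val_uniq _ _ (o @^-1: l.1, l.2)); first exact: good_uniq.
by apply/mapP; exists l => //; rewrite mem_filter /= nB.
Qed.

Lemma val_upp (A : {set Y}) : A \in cl w -> A \subset B -> val (up w) (q @^-1: A) = t A.
Proof.
move=> /mapP[l lw' ->] AB; rewrite val_uniq ?good_uniq //.
apply: (@val_uniq _ _ (q @^-1: l.1, l.2)); first exact: good_uniq.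
by apply/mapP; exists l => //; rewrite mem_filter /isblk AB.
Qed.

Lemma mem_cl_low (A : {set U}) : A \in cl (lw w) ->
  exists2 S : {set Y}, (S \in cl w) && ~~ (S \subset B) & A = o @^-1: S.
Proof. by rewrite cl_low => /mapP[S]; rewrite mem_filter andbC; exists S. Qed.

Lemma mem_cl_upp (A : {set V}) : A \in cl (up w) ->
  exists2 S : {set Y}, (S \in cl w) && (S \subset B) & A = q @^-1: S.
Proof. by rewrite cl_upp => /mapP[S]; rewrite mem_filter andbC; exists S. Qed.

Lemma par_low (C : {set Y}) : C \in cl w -> C != setT -> ~~ (C \subset B) ->
  ~~ (par t C \subset B) /\ par (val (lw w)) (o @^-1: C) = o @^-1: (par t C).
Proof.
move=> Cw CT CB; have [pP Cp minP] := parP nt (inner_good gw Cw CT).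
have PB : ~~ (par t C \subset B) by apply: contra CB; apply: subset_trans (proper_sub Cp).
have Pw : par t C \in cl w by rewrite good_pr.
split=> //; have sub := sub_o oB oq.
apply: par_eq.
- by rewrite -[pr _ _](good_pr gl) cl_low map_f // mem_filter PB.
- by rewrite properE !sub ?lowt_cl // -properE.
- move=> S; rewrite -[pr _ _](good_pr gl) => /mem_cl_low[A /andP[Aw AB] ->].
  rewrite properE !sub ?lowt_cl // -properE => CA.
  by apply: minP; rewrite // -[pr _ _](good_pr gw).
Qed.

Lemma par_upp (C : {set Y}) : C \in cl w -> C != B -> C \subset B ->
  par t C \subset B /\ par (val (up w)) (q @^-1: C) = q @^-1: (par t C).
Proof.
move=> Cw CnB CB.
have Bw : B \in cl w.
  case: (upp_good gw gu) => // V1; have := good_gt1 gw Cw.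
  by have := subset_leq_card CB; rewrite card_B // V1; lia.
have pB : pr t B by rewrite -[pr _ _](good_pr gw).
have CBp : C \proper B by rewrite properEneq CnB.
have CT : C != setT by apply: contraTneq CBp => ->; rewrite properE subsetT andbF.
have [pP Cp minP] := parP nt (inner_good gw Cw CT).
have PB : par t C \subset B by exact: minP.
have Pw : par t C \in cl w by rewrite good_pr.
split=> //; apply: par_eq.
- by rewrite -[pr _ _](good_pr gu) cl_upp map_f // mem_filter PB.
- by rewrite properE !sub_q // -properE.
- move=> S; rewrite -[pr _ _](good_pr gu) => /mem_cl_upp[A /andP[Aw AB] ->].
  rewrite properE !sub_q // -properE => CA.
  by rewrite minP // -[pr _ _](good_pr gw).
Qed.

Lemma contr_low (C A : {set Y}) : C \in cl w -> C != setT -> ~~ (C \subset B) ->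
  A \in cl w -> ~~ (A \subset B) ->
  contr (val (lw w)) (o @^-1: C) (o @^-1: A) = contr t C A.
Proof.
move=> Cw CT CB Aw AB; have [PB parE] := par_low Cw CT CB.
have [pP _ _] := parP nt (inner_good gw Cw CT).
have Pw : par t C \in cl w by rewrite good_pr.
have eqo (S T : {set Y}) : S \in cl w -> ~~ (S \subset B) -> T \in cl w -> ~~ (T \subset B) ->
    (o @^-1: S == o @^-1: T) = (S == T).
  move=> Sw SB Tw TB; apply/eqP/eqP => [|->//].
  by apply: (o_inj oB oq); apply: lowt_cl.
by rewrite /contr parE !eqo // !val_low.
Qed.

Lemma contr_upp (C A : {set Y}) : C \in cl w -> C != B -> C \subset B ->
  A \in cl w -> A \subset B ->
  contr (val (up w)) (q @^-1: C) (q @^-1: A) = contr t C A.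
Proof.
move=> Cw CnB CB Aw AB; have [PB parE] := par_upp Cw CnB CB.
have eqq (S T : {set Y}) : S \subset B -> T \subset B -> (q @^-1: S == q @^-1: T) = (S == T).
  move=> SB TB; apply/eqP/eqP => [E|->//].
  by rewrite -(imset_q SB) E imset_q.
by rewrite /contr parE !eqq // !val_upp.
Qed.

End Diff.

Local Notation PB := (fun A : {set Y} => A \subset B).

Lemma low_mkw t s : lw (mkw t s) = map (fun A : {set Y} => (o @^-1: A, t A)) (filter (predC PB) s).
Proof. by rewrite /low /pull /mkw filter_map -map_comp. Qed.

Lemma upp_mkw t s : up (mkw t s) = map (fun A : {set Y} => (q @^-1: A, t A)) (filter PB s).
Proof. by rewrite /upp /pull /mkw filter_map -map_comp. Qed.

Lemma cross_mkw t s : cross blk (predC blk) (mkw t s) = cross PB (predC PB) s.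
Proof. by elim: s => //= A s ->; rewrite count_map. Qed.

Lemma cross_cl w : cross blk (predC blk) w = cross PB (predC PB) (cl w).
Proof. by elim: w => //= A s ->; rewrite count_map. Qed.

(** Inner edges of [w] other than the grafting edge belong to one factor, according to whether the
    cluster lies in the block, and [Dsum_split] separates them. The grafting edge contributes
    nothing. *)
Lemma gcomp_diff_word a b w : good w ->
  cdiff (gcomp a b) w = gcomp (cdiff a) b w + (-1) ^+ (size (lw w) + f) * gcomp a (cdiff b) w.
Proof.
move=> gw; rewrite cdiffE // !gcompE //.
(* If the upper part is no tree, all terms vanish: a contraction cannot create the missing cluster
   [B]. *)
have [gu|ngu] := boolP (good (up w)); last first.
  rewrite (cochain_supp b ngu) (cochain_supp (cdiff b) ngu) !mulr0 addr0.
  rewrite Dsum0 // => C u v E; case: eqP => // /eqP CT.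
  have [gF vF] := good_face gw E CT; rewrite gcompE //.
  rewrite (cochain_supp b) ?mulr0 //; apply: contra ngu => guF.
  apply: good_upp_B => //; have := upp_good gF guF; rewrite cl_mkw E => -[Bw|]; last by right.
  by left; move: Bw; rewrite !mem_cat inE => /orP[->|->]; rewrite ?orbT.
have [sw gl] := glue_good gw gu.
have uw := good_uniq gw.
set t := val w; set kap : K := (-1) ^+ (f * size (up w) + e).
pose F (C : {set Y}) u v := kap * ((if o @^-1: C == setT then 0 else
   a (mkw (contr (val (lw w)) (o @^-1: C)) (map (fun A : {set Y} => o @^-1: A) u))) *
   b (mkw (val (up w)) (map (fun A : {set Y} => q @^-1: A) v))).
pose G (C : {set Y}) u v := (-1) ^+ f * kap * (a (mkw (val (lw w)) (map (fun A : {set Y} => o @^-1: A) u)) *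
   (if q @^-1: C == setT then 0 else
   b (mkw (contr (val (up w)) (q @^-1: C)) (map (fun A : {set Y} => q @^-1: A) v)))).
rewrite (eq_Dsum (h' := fun C u => (-1) ^+ cross PB (predC PB) u *
    (if PB C then G C (filter (predC PB) u) (filter PB u)
     else F C (filter (predC PB) u) (filter PB u)))); last first.
  move=> C u v E; have Cw : C \in cl w by rewrite E mem_cat mem_head orbT.
  have sub A : A \in u ++ v -> A \in cl w.
    by rewrite E !mem_cat inE => /orP[->|->]; rewrite ?orbT.
  have nA A : A \in u ++ v -> A != C.
    move: uw; rewrite E -cat1s uniq_catCA cat1s /= => /andP[nC _] Auv.
    by apply: contraNneq nC => <-.
  have szu : size (up w) = (size (filter PB (u ++ v)) + PB C)%N.
    by rewrite -(size_map fst) -/(cl _) cl_upp // size_map E !filter_cat !size_cat /=; case: (PB C) => /=; lia.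
  have [CB|CB] := boolP (C \subset B).
    have CTB : (q @^-1: C == setT) = (C == B).
      apply/eqP/eqP => [E'|->]; first by rewrite -(imset_q CB) E'.
      by apply/setP => x; rewrite !inE imset_f.
    (* Contracting the grafting edge destroys the cluster [B], and the upper part of the result is
       no longer a good word; on the other side [B] is the root of the upper factor, whose term is
       0. *)
    rewrite /G CTB; have [CeB|CnB] := eqVneq C B.
      rewrite !mulr0; case: eqP => // /eqP CT.
      have [gF vF] := good_face gw E CT; rewrite gcompE //.
      rewrite (cochain_supp b) ?mulr0 //; apply/negP => guF.
      have := upp_good gF guF; rewrite cl_mkw -CeB => -[/nA|V1]; first by rewrite eqxx.
      by have := good_gt1 gw Cw; rewrite CeB card_B // V1.
    have CT : C != setT.
      by apply: contraNneq CnB => CT; rewrite eqEsubset CB CT subsetT.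
    have [PBs _] := par_upp gw gu Cw CnB CB.
    rewrite (negbTE CT); have [gF vF] := good_face gw E CT; rewrite gcompE //.
    have eL : lw (mkw (contr t C) (u ++ v)) = mkw (val (lw w)) (map (fun A : {set Y} => o @^-1: A) (filter (predC PB) (u ++ v))).
      rewrite low_mkw /mkw -map_comp; apply/eq_in_map => A; rewrite mem_filter => /andP[AB Auv] /=.
      rewrite val_low ?sub // /contr (negbTE (nA _ Auv)) ifN //.
      by apply: contra AB => /eqP ->.
    have eU : up (mkw (contr t C) (u ++ v)) = mkw (contr (val (up w)) (q @^-1: C)) (map (fun A : {set Y} => q @^-1: A) (filter PB (u ++ v))).
      rewrite upp_mkw /mkw -map_comp; apply/eq_in_map => A; rewrite mem_filter => /andP[AB Auv] /=.
      by rewrite contr_upp //; exact: sub.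
    rewrite /gsign cross_mkw {1}upp_mkw size_map eL eU /kap szu CB addn1 mulnS.
    rewrite -!addnA !exprD; have := sqrr_sign K (odd f); rewrite signr_odd expr2 => f2.
    set X1 := (-1) ^+ cross _ _ _; set X2 := (-1) ^+ (f * _); set X3 := (-1) ^+ e.
    set Z1 := a _; set Z2 := b _.
    rewrite (_ : (-1) ^+ f * ((-1) ^+ f * (X2 * X3)) = ((-1) ^+ f * (-1) ^+ f) * (X2 * X3)); last by rewrite mulrA.
    by rewrite f2 mul1r !mulrA.
  have CTo : (o @^-1: C == setT) = (C == setT).
    apply/eqP/eqP => [E'|->]; last by rewrite preimsetT.
    apply: (o_inj oB oq); rewrite ?E' ?preimsetT //; first exact: (lowt_cl gw gu).
    by rewrite /lowt subsetT.
  rewrite /F CTo; have [_|CT] := eqVneq C setT; first by rewrite mul0r !mulr0.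
  have [PBs _] := par_low gw gu Cw CT CB.
  have [gF vF] := good_face gw E CT; rewrite gcompE //.
  have eL : lw (mkw (contr t C) (u ++ v)) = mkw (contr (val (lw w)) (o @^-1: C)) (map (fun A : {set Y} => o @^-1: A) (filter (predC PB) (u ++ v))).
    rewrite low_mkw /mkw -map_comp; apply/eq_in_map => A; rewrite mem_filter => /andP[AB Auv] /=.
    by rewrite contr_low //; exact: sub.
  have eU : up (mkw (contr t C) (u ++ v)) = mkw (val (up w)) (map (fun A : {set Y} => q @^-1: A) (filter PB (u ++ v))).
    rewrite upp_mkw /mkw -map_comp; apply/eq_in_map => A; rewrite mem_filter => /andP[AB Auv] /=.
    rewrite val_upp ?sub // /contr (negbTE (nA _ Auv)) ifN //.
    by apply: contraNneq PBs => <-.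
  by rewrite /gsign cross_mkw {1}upp_mkw size_map eL eU /kap szu (negbTE CB) addn0 -addnA exprD !mulrA.
rewrite Dsum_split /F /G.
rewrite /gsign cross_cl -addnA !(exprD _ (cross _ _ _)) -/kap.
rewrite (cdiffE a gl) (cdiffE b gu) (cl_low w) (cl_upp w) !Dsum_map.
have eA : mkw (val (lw w)) (map (fun A : {set Y} => o @^-1: A) (filter (predC PB) (cl w))) = lw w.
  by rewrite -[map _ _](cl_low w) mkw_val // good_uniq.
have eB : mkw (val (up w)) (map (fun A : {set Y} => q @^-1: A) (filter PB (cl w))) = up w.
  by rewrite -[map _ _](cl_upp w) mkw_val // good_uniq.
have sL : size (lw w) = size (filter (predC PB) (cl w)).
  by rewrite -(size_map fst) -/(cl _) cl_low size_map.
rewrite eA eB sL.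
pose fa (C : {set Y}) u := if o @^-1: C == setT then 0 else
  a (mkw (contr (val (lw w)) (o @^-1: C)) (map (fun A : {set Y} => o @^-1: A) u)).
pose fb (C : {set Y}) u := if q @^-1: C == setT then 0 else
  b (mkw (contr (val (up w)) (q @^-1: C)) (map (fun A : {set Y} => q @^-1: A) u)).
transitivity ((-1) ^+ cross PB (predC PB) (cl w) *
  (kap * b (up w) * Dsum fa (filter (predC PB) (cl w)) +
   (-1) ^+ size (filter (predC PB) (cl w)) *
   ((-1) ^+ f * kap * a (lw w) * Dsum fb (filter PB (cl w))))).
  by congr (_ * (_ + _ * _)); rewrite -DsumZ; apply: eq_Dsum => C u v _; rewrite /fa /fb; ring.
rewrite -/fa -/fb exprD; change (filter (fun A : {set Y} => ~~ (A \subset B))) with (filter (predC PB)).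
ring.
Qed.

(** This fixes the exponent [f]: the degree [d] is the number of lower vertices minus [#|U|.-1], so
    [(-1) ^ d] is the sign found in [gcomp_diff_word]. *)
Lemma gcomp_diff a b d : f = #|U|.-1 -> chomog d a ->
  cdiff (gcomp a b) = gcomp (cdiff a) b + (-1) ^ d *: gcomp a (cdiff b).
Proof.
move=> ef ha; apply: cochain_eq => w gw; rewrite gcomp_diff_word // evD evZ; congr (_ + _).
rewrite gcompE //; have [->|/ha <-] := eqVneq (a (lw w)) 0; first by rewrite !(mul0r, mulr0).
have U1 : (0 < #|U|)%N by apply/card_gt0P; exists i.
congr (_ * _); rewrite /wdeg ef.
have -> : (size (lw w))%:Z + 1 - #|U|%:Z = (size (lw w) + #|U|.-1)%N%:Z - (#|U|.-1 * 2)%N%:Z.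
  have {1}-> : #|U| = #|U|.-1.+1 by rewrite prednK.
  by rewrite PoszM PoszD -addn1 PoszD; ring.
by rewrite expfzDr ?oppr_eq0 ?oner_eq0 // -exprnN exprM sqrr_sign invr1 mulr1.
Qed.

End Compose.

(** * The sign of a block permutation *)

Section BlockPerm.

Lemma perm_lift n (i : 'I_n.+1) (s : 'S_n.+1) :
  exists s' : 'S_n, s = lift_perm i (s i) s'.
Proof.
have ex k : exists k', s (lift i k) = lift (s i) k'.
  case: (unliftP (s i) (s (lift i k))) => [k' ->|/perm_inj E]; first by exists k'.
  by have := neq_lift i k; rewrite E eqxx.
pose f k := odflt k (unlift (s i) (s (lift i k))).
have fE k : s (lift i k) = lift (s i) (f k).
  by rewrite /f; have [k' ->] := ex k; rewrite liftK.
have fI : injective f.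
  by move=> k k' E; apply: (@lift_inj _ i); apply: (@perm_inj _ s); rewrite !fE E.
exists (perm fI); apply/permP => k; case: (unliftP i k) => [k' ->|->].
  by rewrite lift_perm_lift permE fE.
by rewrite lift_perm_id.
Qed.

Lemma outer_lt n i j : (j < i)%N -> outer_pos n i j = j.
Proof. by rewrite /outer_pos => ->. Qed.

Lemma outer_ge n i j : (i <= j)%N -> outer_pos n i j = (j + n).-1.
Proof. by rewrite /outer_pos ltnNge => ->. Qed.

Lemma outer_bump h k : outer_pos 0 h (bump h k) = k.
Proof.
rewrite /bump; case: leqP => hk; last by rewrite add0n outer_lt.
by rewrite add1n outer_ge ?addn0 // ltnW.
Qed.

Lemma bump_outer n c i j : (c <= n)%N -> j != i ->
  bump (i + c) (outer_pos n i j) = outer_pos n.+1 i j.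
Proof.
move=> cn; case: ltngtP => // ji _; rewrite /bump.
  by rewrite !outer_lt // leqNgt (leq_trans ji) ?leq_addr.
rewrite !(outer_ge _ (ltnW ji)) addnS /= -(ltn_predK ji) addSn /=.
by rewrite (leq_add _ cn) // -ltnS (ltn_predK ji).
Qed.

(** Induction on the block size, removing the last input of the block. Each of the [n] inputs of the
    block contributes [s i + i], and so does the removal of the input [i] itself, whence the factor
    [n.+1]. *)
Lemma block_sign m n p (i : 'I_m) (s : 'S_m) (t : 'S_n) (r : 'S_p) :
  (m + n = p.+1)%N ->
  (forall (j : 'I_m) (u : 'I_p), j != i ->
     u = outer_pos n i j :> nat -> r u = outer_pos n (s i) (s j) :> nat) ->
  (forall (j : 'I_n) (u : 'I_p),
     u = (i + j)%N :> nat -> r u = (s i + t j)%N :> nat) ->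
  odd_perm r = odd_perm s (+) odd_perm t (+) odd ((s i + i) * n.+1).
Proof.
elim: n p t r => [|n IH] p t r h H1 H2.
  rewrite addn0 in h; subst m.
  have [s' Es] := perm_lift i s.
  have -> : r = s'.
    apply/permP => k; apply: ord_inj; rewrite (H1 (lift i k) k).
    - by rewrite [in s (lift i k)]Es lift_perm_lift outer_bump.
    - by rewrite eq_sym neq_lift.
    - by rewrite outer_bump.
  rewrite [in RHS]Es odd_lift_perm muln1 oddD (_ : odd_perm t = false).
    rewrite lift_perm_id.
    by case: (odd i); case: (odd (s i)); case: (odd_perm s').
  by rewrite (_ : t = 1%g) ?odd_perm1 //; apply/permP => -[].
have lm := ltn_ord i.
case: p r h H1 H2 => [|p] r h H1 H2; first by lia.
have h' : (m + n = p.+1)%N by lia.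
have ltm := ltn_ord (s i).
have lt1 : (i + n < p.+1)%N by lia.
have ltt := ltn_ord (t ord_max).
have [t' Et] := perm_lift ord_max t.
have [r' Er] := perm_lift (Ordinal lt1) r.
have rb : r (Ordinal lt1) = (s i + t ord_max)%N :> nat by rewrite (H2 ord_max).
have bi := @bumpK (s i + t ord_max)%N.
have E : odd_perm r' = odd_perm s (+) odd_perm t' (+) odd ((s i + i) * n.+1).
  apply: IH => // j u.
    move=> ne uE; apply: (can_inj bi).
    have := H1 j (lift (Ordinal lt1) u) ne; rewrite {1}Er lift_perm_lift /= rb => ->.
      by rewrite bump_outer // (inj_eq val_inj) (inj_eq perm_inj).
    by rewrite uE bump_outer.
  move=> uE; apply: (can_inj bi).
  have := H2 (lift ord_max j) (lift (Ordinal lt1) u); rewrite {1}Er lift_perm_lift /= rb => ->.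
    rewrite {1}Et lift_perm_lift /= /bump leq_add2l; case: (_ <= _)%N => //=; lia.
  by rewrite uE /bump leq_add2l; case: (_ <= _)%N => //=; lia.
rewrite Er Et !odd_lift_perm E rb /= !oddM !oddD /=.
by do 8?case: (odd _) => //=; do ?case: (odd_perm _).
Qed.

End BlockPerm.

Lemma signz_sub (K : fieldType) (n k : nat) : (-1 : K) ^ (n%:Z - (k * 2)%N%:Z) = (-1) ^+ n.
Proof.
by rewrite expfzDr ?oppr_eq0 ?oner_eq0 // -exprnN exprM sqrr_sign invr1 mulr1.
Qed.

Lemma pull_pull (X Y Z : finType) (f : X -> Y) (g : Y -> Z) w :
  pull f (pull g w) = pull (g \o f) w.
Proof.
by rewrite /pull -map_comp; apply: eq_map => l /=; congr (_, _); apply/setP => x; rewrite !inE.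
Qed.

Lemma eq_pull (X Y : finType) (f g : X -> Y) w : f =1 g -> pull f w = pull g w.
Proof. by move=> e; apply: eq_map => l; congr (_, _); apply/setP => x; rewrite !inE e. Qed.

Lemma pull_id (X : finType) (w : word X) : pull id w = w.
Proof.
by rewrite /pull map_id_in // => -[S v] _ /=; congr (_, _); apply/setP => x; rewrite !inE.
Qed.

Lemma filter_pull (X Y : finType) (f : X -> Y) P w :
  filter P (pull f w) = pull f (filter (fun l : {set Y} * (nat * nat) => P (f @^-1: l.1, l.2)) w).
Proof. by rewrite /pull filter_map. Qed.

Lemma cross_pull (X Y : finType) (f : X -> Y) P Q w :
  cross P Q (pull f w) = cross (fun l : {set Y} * (nat * nat) => P (f @^-1: l.1, l.2)) (fun l : {set Y} * (nat * nat) => Q (f @^-1: l.1, l.2)) w.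
Proof. by elim: w => //= l w ->; rewrite count_map. Qed.

Section PullBij.
Variables (X Y : finType) (f : X -> Y) (g : Y -> X) (fK : cancel f g) (gK : cancel g f).

Lemma sub_bij (S T : {set Y}) : (f @^-1: S \subset f @^-1: T) = (S \subset T).
Proof.
apply/idP/idP => [/subsetP h|]; last exact: preimsetS.
by apply/subsetP => y yS; have := h (g y); rewrite !inE gK; apply.
Qed.

Lemma card_bij (S : {set Y}) : #|f @^-1: S| = #|S|.
Proof.
rewrite -(card_imset _ (can_inj fK)); apply: eq_card => y; apply/imsetP/idP.
  by move=> [x + ->]; rewrite inE.
by move=> yS; exists (g y); rewrite ?inE gK.
Qed.

Lemma good_pull w : good (pull f w) = good w.
Proof.
have inj : injective (fun S : {set Y} => f @^-1: S).
  by move=> S T E; apply/eqP; rewrite eqEsubset -!sub_bij E subxx.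
rewrite /good cl_pull (map_inj_uniq inj); congr [&& _, _, _, _ & _].
- by rewrite all_map.
- rewrite all_map; apply: eq_all => l; rewrite /= all_map; apply: eq_all => l'.
  by rewrite /= /lam !sub_bij -!setI_eq0 -preimsetI -!cards_eq0 card_bij.
- rewrite all_map; apply: eq_all => l /=; rewrite card_bij csum_pull; congr (_ == _).
  by apply: eq_bigl => l'; rewrite sub_bij.
- have -> : #|X| = #|Y| by rewrite -[#|Y|]cardsT -card_bij -cardsT; apply: eq_card => x; rewrite !inE.
  congr (_ || _); rewrite -(mem_map inj) (_ : f @^-1: setT = setT) //.
  by apply/setP => x; rewrite !inE.
Qed.

End PullBij.

Record glue (U V Y : finType) (o : U -> Y) (q : V -> Y) (i : U) : Prop := Glue {
  glue_oI : injective o;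
  glue_qI : injective q;
  glue_oB : forall j, (o j \in q @: setT) = (j == i);
  glue_oq : forall y, y \in q @: setT \/ exists j, y = o j;
  glue_card : #|Y| = (#|U| + #|V|).-1 }.

(** * Associativity of grafting *)

Section Sequential.
Variables (K : fieldType) (M N L Q R Y : finType).
Variables (oC : Q -> Y) (qC : L -> Y) (x : Q) (oB : M -> Q) (qB : N -> Q) (i : M).
Variables (oA : M -> Y) (qA : R -> Y) (oc : N -> R) (qc : L -> R) (j : N).
Hypotheses (gC : glue oC qC x) (gB : glue oB qB i) (gA : glue oA qA i) (gc : glue oc qc j).
Hypotheses (h1 : forall m, oC (oB m) = oA m) (h2 : forall n, oC (qB n) = qA (oc n)).
Hypotheses (h3 : forall l, qC l = qA (qc l)).
Implicit Types (w : word Y) (S : {set Y}).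

Lemma seq_blockC : qC @: setT = qA @: (qc @: setT).
Proof. by rewrite -imset_comp; apply: eq_imset => l; rewrite /= h3. Qed.

Lemma seq_sub : qC @: setT \subset qA @: setT.
Proof. by rewrite seq_blockC imsetS ?subsetT. Qed.

Lemma seq_pred S : ~~ (S \subset qC @: setT) ->
  (oC @^-1: S \subset qB @: setT) = (S \subset qA @: setT).
Proof.
move=> nC; apply/subsetP/subsetP => [h y yS|h z]; last first.
  rewrite inE => /h zA; case: (glue_oq gB z) => // -[m E].
  by move: zA; rewrite E h1 (glue_oB gA) (glue_oB gB).
case: (glue_oq gC y) => [yC|[z E]]; first exact: (subsetP seq_sub).
have : z \in oC @^-1: S by rewrite inE -E.
by move/h => /imsetP[n _ En]; rewrite E En h2 imset_f.
Qed.

Lemma seq_predC S : S \subset qA @: setT ->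
  (qA @^-1: S \subset qc @: setT) = (S \subset qC @: setT).
Proof.
move=> SA; rewrite seq_blockC; apply/subsetP/subsetP => [h y yS|h z].
  by have /imsetP[z _ E] := subsetP SA y yS; rewrite E imset_f // h // inE -E.
by rewrite inE => /h /imsetP[z' zc /(glue_qI gA) ->].
Qed.

Lemma seq_low w : low oB qB (low oC qC w) = low oA qA w.
Proof.
rewrite /low filter_pull pull_pull -filter_predI (@eq_pull _ _ _ oA) //; congr pull.
apply: eq_filter => l /=; rewrite /isblk /=.
case: (boolP (l.1 \subset qC @: setT)) => lC; last by rewrite seq_pred // andbT.
by rewrite andbF (subset_trans lC seq_sub).
Qed.

Lemma seq_mid w : upp qB (low oC qC w) = low oc qc (upp qA w).
Proof.
rewrite /low /upp !filter_pull !pull_pull -!filter_predI (@eq_pull _ _ _ (qA \o oc)) //.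
congr pull; apply: eq_filter => l /=; rewrite /isblk /=.
have [lA|lA] := boolP (l.1 \subset qA @: setT).
  rewrite seq_predC // andbT; case: (boolP (l.1 \subset qC @: setT)) => lC; rewrite ?andbF //.
  by rewrite andbT seq_pred.
rewrite andbF; case: (boolP (l.1 \subset qC @: setT)) => lC; rewrite ?andbF //.
by rewrite andbT seq_pred // (negbTE lA).
Qed.

Lemma seq_upp w : upp qC w = upp qc (upp qA w).
Proof.
rewrite /upp filter_pull pull_pull -filter_predI (@eq_pull _ _ _ (qA \o qc)) //.
congr pull; apply: eq_filter => l /=; rewrite /isblk /=.
have [lA|lA] := boolP (l.1 \subset qA @: setT); first by rewrite seq_predC ?andbT.
by rewrite andbF; apply: contraNF lA => lC; exact: subset_trans seq_sub.
Qed.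

Lemma sat_pull (X' : finType) (f : X' -> Y) (B : {set Y}) (qq : L -> X') S :
  f @^-1: B = qq @: setT -> [|| S \subset B, B \subset S | [disjoint S & B]] -> sat qq (f @^-1: S).
Proof.
move=> e /or3P[h|h|h]; rewrite /sat -e; first by rewrite preimsetS.
  by rewrite (preimsetS f h) orbT.
by rewrite -!setI_eq0 -preimsetI (eqP (_ : S :&: B == set0)) ?setI_eq0 // preimset0 eqxx !orbT.
Qed.

Variables (eC fC eB fB eA ec fc : nat).
Hypotheses (pf : odd fC = odd (fB + fc)) (pe : odd (eC + eB) = odd (eA + ec)).

(** Both sides cut the tree at the same two nested clusters and give the same three factors. The
    sorting signs agree by [cross_seq]; [pf] and [pe] are what remains for the suspension
    exponents. *)
Lemma gcomp_seq (a : cochain K M) (b : cochain K N) (c : cochain K L) :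
  gcomp oC qC eC fC (gcomp oB qB eB fB a b) c =
  gcomp oA qA eA fB a (gcomp oc qc ec fc b c).
Proof.
apply: cochain_eq => w gw; rewrite [LHS]gcompE // [RHS]gcompE //.
have [gcw|ngc] := boolP (good (upp qC w)); last first.
  rewrite (cochain_supp c ngc) !mulr0 [X in _ = _ * (_ * X)](_ : _ = 0) ?mulr0 //.
  have [gu|/cochain_supp -> //] := boolP (good (upp qA w)).
  by rewrite gcompE // -seq_upp (cochain_supp c ngc) !mulr0.
have [sC gl] := glue_good (glue_oI gC) (glue_qI gC) (glue_oB gC) (glue_oq gC) (glue_card gC) gw gcw.
have eBC : qA @^-1: (qC @: setT) = qc @: setT.
  rewrite seq_blockC; apply/setP => z; rewrite inE; apply/imsetP/idP => [[z' h /(glue_qI gA) ->] //|h].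
  by exists z.
rewrite [gcomp oB _ _ _ _ _ _]gcompE //.
have [gbw|ngb] := boolP (good (upp qB (low oC qC w))); last first.
  rewrite (cochain_supp b ngb) mulr0 mulr0 mul0r mulr0 [X in _ = _ * (_ * X)](_ : _ = 0) ?mulr0 //.
  have [gu|/cochain_supp -> //] := boolP (good (upp qA w)).
  by rewrite gcompE // -seq_mid (cochain_supp b ngb) mul0r mulr0.
(* The inner two factors are good trees, so by [good_glue] their composite is one as well. *)
have gu : good (upp qA w).
  have gg := good_glue (glue_oI gc) (glue_qI gc) (glue_oB gc) (glue_oq gc) (upp qA w) (glue_card gc).
  have /andP[] // : good (upp qA w) && ((qc @: setT \in cl (upp qA w)) || (#|L| == 1%N)).
  rewrite gg -seq_mid -seq_upp gbw gcw !andbT.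
  apply/allP => l /mapP[l' +]; rewrite mem_filter => /andP[_ lw] ->.
  by apply: sat_pull eBC _; have /allP := sC; apply.
rewrite gcompE // seq_low seq_mid seq_upp.
set va := a _; set vb := b _; set vc := c _.
have : (-1) ^+ gsign qC eC fC w * (-1) ^+ gsign qB eB fB (low oC qC w) =
  (-1) ^+ gsign qA eA fB w * (-1) ^+ gsign qc ec fc (upp qA w) :> K; last first.
  by move=> E; rewrite !mulrA E; ring.
rewrite -!exprD; apply: signr_parity; rewrite /gsign seq_mid -seq_upp.
have -> : size (upp qA w) = (size (low oc qc (upp qA w)) + size (upp qC w))%N.
  by rewrite seq_upp size_low_upp.
have cr : (cross (isblk qC) (predC (isblk qC)) w + cross (isblk qB) (predC (isblk qB)) (low oC qC w) =
  cross (isblk qA) (predC (isblk qA)) w + cross (isblk qc) (predC (isblk qc)) (upp qA w))%N.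
  rewrite /low /upp !cross_pull.
  rewrite (@eq_cross _ _ (isblk qA) _ (predC (isblk qA)) (filter (predC (isblk qC)) w)); last 2 first.
  - by move=> l; rewrite mem_filter => /andP[lC _]; rewrite /isblk /= seq_pred.
  - by move=> l; rewrite mem_filter => /andP[lC _]; rewrite /isblk /= seq_pred.
  rewrite [X in _ = (_ + X)%N](@eq_cross _ _ (isblk qC) _ (predC (isblk qC)) (filter (isblk qA) w)); last 2 first.
  - by move=> l; rewrite mem_filter => /andP[lC _]; rewrite /isblk /= seq_predC.
  - by move=> l; rewrite mem_filter => /andP[lC _]; rewrite /isblk /= seq_predC.
  by apply: cross_seq => l h; exact: subset_trans seq_sub.
have {cr} := congr1 odd cr; move: pe pf; rewrite !(oddD, oddM) => e1 -> e2.
have -> : odd eC = odd eA (+) odd ec (+) odd eB by rewrite -e1 addbK.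
have -> : odd (cross (isblk qC) (predC (isblk qC)) w) =
    odd (cross (isblk qA) (predC (isblk qA)) w) (+) odd (cross (isblk qc) (predC (isblk qc)) (upp qA w))
    (+) odd (cross (isblk qB) (predC (isblk qB)) (low oC qC w)) by rewrite -e2 addbK.
by do 10!case: (odd _).
Qed.

End Sequential.

(** The two blocks are disjoint: a saturated set whose preimage lies in the first block cannot
    contain the second, as that preimage would contain [x]. *)
Lemma par_pred (N L Q Y : finType) (oC : Q -> Y) (qC : L -> Y) (x : Q) (qB : N -> Q) (qB' : N -> Y) :
  glue oC qC x -> (forall n, oC (qB n) = qB' n) -> x \notin qB @: setT ->
  forall S : {set Y}, sat qC S -> ~~ (S \subset qC @: setT) ->
  (oC @^-1: S \subset qB @: setT) = (S \subset qB' @: setT).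
Proof.
move=> gC h2 hx S sS nC; have lS := lowtP sS nC.
apply/subsetP/subsetP => [h y yS|h z].
  case: (glue_oq gC y) => [yC|[z E]].
    have CS : qC @: setT \subset S by case/orP: lS => // d; rewrite (disjointFr d yS) in yC.
    case/negP: hx; apply: h; rewrite inE (subsetP CS) //.
    by rewrite (glue_oB gC).
  have /imsetP[n _ En] : z \in qB @: setT by apply: h; rewrite inE -E.
  by rewrite E En h2 imset_f.
by rewrite inE => /h /imsetP[n _]; rewrite -h2 => /(glue_oI gC) ->; rewrite imset_f.
Qed.

Section Parallel.
Variables (K : fieldType) (M N L Q R Y : finType).
Variables (oC : Q -> Y) (qC : L -> Y) (x : Q) (oB : M -> Q) (qB : N -> Q) (i : M).
Variables (oB' : R -> Y) (qB' : N -> Y) (y : R) (oC' : M -> R) (qC' : L -> R) (k : M).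
Hypotheses (gC : glue oC qC x) (gB : glue oB qB i) (gB' : glue oB' qB' y) (gC' : glue oC' qC' k).
Hypotheses (h1 : forall m, oC (oB m) = oB' (oC' m)).
Hypotheses (h2 : forall n, oC (qB n) = qB' n) (h3 : forall l, oB' (qC' l) = qC l).
Hypotheses (hx : x \notin qB @: setT) (hy : y \notin qC' @: setT).
Implicit Types (w : word Y) (S : {set Y}).

Lemma par_disj S : S != set0 -> S \subset qC @: setT -> S \subset qB' @: setT -> False.
Proof.
move=> /set0Pn[z zS] /subsetP /(_ z zS) zC /subsetP/(_ z zS)/imsetP[n _ E].
by move: zC; rewrite E -h2 (glue_oB gC) => /eqP E'; case/negP: hx; rewrite -E' imset_f.
Qed.

Section Sat.
Variables (w : word Y) (n0 : set0 \notin cl w).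
Hypotheses (sC : all (fun l => sat qC l.1) w) (sB : all (fun l => sat qB' l.1) w).

Let disj l : l \in w -> isblk qC l -> isblk qB' l -> False.
Proof.
move=> lw; apply: par_disj; apply: contraNneq n0 => <-; exact: map_f.
Qed.

Let predB l : l \in w -> ~~ isblk qC l ->
  isblk qB (oC @^-1: l.1, l.2) = isblk qB' l.
Proof.
by move=> lw lC; rewrite /isblk /= (par_pred gC h2 hx) //; have /allP := sC; apply.
Qed.

Let predC' l : l \in w -> ~~ isblk qB' l ->
  isblk qC' (oB' @^-1: l.1, l.2) = isblk qC l.
Proof.
by move=> lw lC; rewrite /isblk /= (par_pred gB' h3 hy) //; have /allP := sB; apply.
Qed.

Lemma low_par : low oB qB (low oC qC w) = low oC' qC' (low oB' qB' w).
Proof.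
rewrite /low !filter_pull !pull_pull -!filter_predI (@eq_pull _ _ _ (oB' \o oC')) //.
congr pull; apply: eq_in_filter => l lw /=.
have := disj lw; case lC: (isblk qC l); case lB: (isblk qB' l) => //= d.
- by rewrite !andbF.
- by rewrite andbF predC' ?lB // lC.
- by rewrite andbF predB ?lC // lB.
- by rewrite predB ?lC // predC' ?lB // ?lC ?lB.
Qed.

Lemma par_uppB : upp qB (low oC qC w) = upp qB' w.
Proof.
rewrite /low /upp !filter_pull !pull_pull -!filter_predI (@eq_pull _ _ _ qB') //.
congr pull; apply: eq_in_filter => l lw /=.
have := disj lw; case lC: (isblk qC l) => /= d; last by rewrite andbT predB ?lC.
by rewrite andbF; apply/esym/negP => /d; apply.
Qed.

Lemma par_uppC : upp qC' (low oB' qB' w) = upp qC w.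
Proof.
rewrite /low /upp !filter_pull !pull_pull -!filter_predI (@eq_pull _ _ _ qC) //.
congr pull; apply: eq_in_filter => l lw /=.
have := disj lw; case lB: (isblk qB' l) => /= d; last by rewrite andbT predC' ?lB.
by rewrite andbF; apply/esym/negP => /d; apply.
Qed.

Lemma par_cross :
  odd (cross (isblk qC) (predC (isblk qC)) w + cross (isblk qB) (predC (isblk qB)) (low oC qC w)) =
  odd (cross (isblk qB') (predC (isblk qB')) w + cross (isblk qC') (predC (isblk qC')) (low oB' qB' w))
  (+) odd (size (upp qB' w) * size (upp qC w)).
Proof.
pose P l := (l \in w) && isblk qB' l; pose P' l := (l \in w) && isblk qC l.
have PQ l : ~~ (P l && P' l).
  by apply/negP => /andP[/andP[lw lB] /andP[_ lC]]; exact: (disj lw lC lB).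
have eP : {in w, isblk qB' =1 P} by move=> l lw; rewrite /P lw.
have eP' : {in w, isblk qC =1 P'} by move=> l lw; rewrite /P' lw.
have nP : {in w, predC (isblk qB') =1 predC P} by move=> l lw; rewrite /= /P lw.
have nP' : {in w, predC (isblk qC) =1 predC P'} by move=> l lw; rewrite /= /P' lw.
rewrite (eq_cross eP nP) (eq_cross eP' nP') /low !cross_pull.
rewrite (eq_in_filter nP) (eq_in_filter nP') /upp !size_map !size_filter (eq_in_count eP) (eq_in_count eP').
rewrite (@eq_cross _ _ P _ (predC P) (filter (predC P') w)); last 2 first.
- move=> l; rewrite mem_filter => /andP[+ lw]; rewrite -[predC P' l]nP' // -[P l]eP //= => nC.
  by rewrite -predB.
- move=> l; rewrite mem_filter => /andP[+ lw]; rewrite -[predC P' l]nP' // -[predC P l]nP //= => nC.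
  by rewrite -predB.
rewrite (@eq_cross _ _ P' _ (predC P') (filter (predC P) w)); last 2 first.
- move=> l; rewrite mem_filter => /andP[+ lw]; rewrite -[predC P l]nP // -[P' l]eP' //= => nC.
  by rewrite -predC'.
- move=> l; rewrite mem_filter => /andP[+ lw]; rewrite -[predC P l]nP // -[predC P' l]nP' //= => nC.
  by rewrite -predC'.
exact: cross_par.
Qed.

End Sat.

Variables (eC eB eB' eC' f n' l' : nat).
Hypotheses (N1 : #|N| = n'.+1) (L1 : #|L| = l'.+1).
Hypothesis (pe : odd (eC + eB) = odd (eB' + eC' + n' * l')).

(** Modulo 2 the degrees of [b] and [c] are their numbers of vertices plus [n'] and [l']. The
    product of the vertex numbers comes from [par_cross], the mixed products from the terms in [f],
    and n' l' from [pe]. *)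
Lemma gcomp_par d e (a : cochain K M) (b : cochain K N) (c : cochain K L) :
  chomog d b -> chomog e c ->
  gcomp oC qC eC (f + n') (gcomp oB qB eB f a b) c =
  (-1) ^ (d * e) *: gcomp oB' qB' eB' (f + l') (gcomp oC' qC' eC' f a c) b.
Proof.
move=> hb hc; apply: cochain_eq => w gw; rewrite evZ [LHS]gcompE // [in RHS]gcompE //.
have n0 := set0_good gw.
have gCC gcw := glue_good (glue_oI gC) (glue_qI gC) (glue_oB gC) (glue_oq gC) (glue_card gC) gw gcw.
have gBB gbw := glue_good (glue_oI gB') (glue_qI gB') (glue_oB gB') (glue_oq gB') (glue_card gB') gw gbw.
have [gcw|ngc] := boolP (good (upp qC w)); last first.
  rewrite (cochain_supp c ngc) !mulr0.
  have [gbw|/cochain_supp ->] := boolP (good (upp qB' w)); last by rewrite !mulr0.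
  have [sB gl] := gBB gbw; rewrite [X in _ = _ * (_ * (X * _))]gcompE // par_uppC //.
  by rewrite (cochain_supp c ngc) !(mulr0, mul0r).
have [sC gl] := gCC gcw; rewrite [X in _ * (X * _) = _]gcompE // par_uppB //.
have [gbw|ngb] := boolP (good (upp qB' w)); last first.
  by rewrite (cochain_supp b ngb) !(mulr0, mul0r).
have [sB gl'] := gBB gbw; rewrite [X in _ = _ * (_ * (X * _))]gcompE // par_uppC // low_par //.
have [->|/hb dE] := eqVneq (b (upp qB' w)) 0; first by rewrite !(mulr0, mul0r).
have [->|/hc eE] := eqVneq (c (upp qC w)) 0; first by rewrite !(mulr0, mul0r).
have -> : (-1 : K) ^ (d * e) = (-1) ^+ ((size (upp qB' w) + n') * (size (upp qC w) + l')).
  rewrite -dE -eE /wdeg N1 L1 -(addn1 n') -(addn1 l') !PoszD -(signz_sub _ _ (size (upp qB' w) * l' + n' * size (upp qC w))).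
  by congr (_ ^ _); rewrite !PoszM !PoszD !PoszM; ring.
set va := a _; set vb := b _; set vc := c _.
suff E : (-1) ^+ gsign qC eC (f + n') w * (-1) ^+ gsign qB eB f (low oC qC w) =
  (-1) ^+ ((size (upp qB' w) + n') * (size (upp qC w) + l')) *
  ((-1) ^+ gsign qB' eB' (f + l') w * (-1) ^+ gsign qC' eC' f (low oB' qB' w)) :> K.
  by rewrite !mulrA E; ring.
rewrite -!exprD; apply: signr_parity; rewrite /gsign par_uppB // par_uppC //.
have := par_cross n0 sC sB; have := pe; rewrite !(oddD, oddM) => e1 e2.
have -> : odd eC = odd eB' (+) odd eC' (+) odd n' && odd l' (+) odd eB by rewrite -e1 addbK.
have -> : odd (cross (isblk qC) (predC (isblk qC)) w) =
    odd (cross (isblk qB') (predC (isblk qB')) w) (+) odd (cross (isblk qC') (predC (isblk qC')) (low oB' qB' w))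
    (+) (odd (size (upp qB' w)) && odd (size (upp qC w)))
    (+) odd (cross (isblk qB) (predC (isblk qB)) (low oC qC w)) by rewrite -e2 addbK.
move: (odd (cross (isblk qB') _ _)) (odd (cross (isblk qC') _ _)) (odd (cross (isblk qB) _ _)) => c1 c2 c3.
move: (odd (size (upp qB' w))) (odd (size (upp qC w))) (odd f) (odd n') (odd l') => s1 s2 f' nn ll.
move: (odd eB') (odd eC') (odd eB) => x1 x2 x3.
by case: s1; case: s2; case: f'; case: nn; case: ll => /=;
  case: c1; case: c2; case: c3; case: x1; case: x2; case: x3.
Qed.

End Parallel.

(** * Equivariance of grafting *)

Section Equivariance.
Variables (K : fieldType) (U V Y : finType).
Variables (o o' : U -> Y) (q q' : V -> Y) (i i' : U).
Hypotheses (g : glue o q i) (g' : glue o' q' i').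
Variables (s : U -> U) (t : V -> V) (r ri : Y -> Y).
Hypotheses (rK : cancel r ri) (riK : cancel ri r) (si : s i = i').
Hypotheses (ro : forall j, j != i -> r (o j) = o' (s j)) (rq : forall j, r (q j) = q' (t j)).
Hypothesis tK : exists ti, cancel ti t.

Let blockE : r @: (q @: setT) = q' @: setT.
Proof.
have [ti tiK] := tK; apply/setP => y; apply/imsetP/imsetP.
  by move=> [_ /imsetP[v _ ->] ->]; exists (t v); rewrite ?rq.
by move=> [v _ ->]; exists (q (ti v)); rewrite ?imset_f ?rq ?tiK.
Qed.

Let blk_sub (S : {set Y}) : (r @^-1: S \subset q @: setT) = (S \subset q' @: setT).
Proof.
rewrite -blockE -(sub_bij rK (r @^-1: S)).
rewrite (_ : ri @^-1: (r @^-1: S) = S); last by apply/setP => y; rewrite !inE riK.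
rewrite (_ : ri @^-1: (q @: setT) = r @: (q @: setT)) //.
apply/setP => y; rewrite inE; apply/idP/imsetP.
  by move=> h; exists (ri y); rewrite ?riK.
by move=> [z h ->]; rewrite rK.
Qed.

Lemma upp_act w : upp q (pull r w) = pull t (upp q' w).
Proof.
rewrite /upp filter_pull !pull_pull (@eq_pull _ _ _ (q' \o t)); last by move=> j /=; rewrite rq.
by congr pull; apply: eq_filter => l; rewrite /isblk /= blk_sub.
Qed.

Lemma low_act w : all (fun l => sat q' l.1) w -> low o q (pull r w) = pull s (low o' q' w).
Proof.
move=> sw; rewrite /low filter_pull !pull_pull.
rewrite (eq_filter (a2 := predC (isblk q'))) => [|l]; last by rewrite /isblk /= blk_sub.
apply/eq_in_map => l; rewrite mem_filter => /andP[lB lw]; congr (_, _); apply/setP => j.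
rewrite !inE /=; have [->|/ro -> //] := eqVneq j i.
(* At the grafted input, [r] need not send [o i] to [o' i'] but only into the block; a saturated
   cluster contains either both points or neither. *)
have lt : lowt q' l.1 by apply: lowtP => //; have /allP := sw; apply.
rewrite si; have := lowt_i (glue_oB g') lt; rewrite inE => ->.
have rB : r (o i) \in q' @: setT by rewrite -blockE imset_f // (glue_oB g).
apply/idP/idP => [h|/subsetP -> //].
by case/orP: lt => // d; rewrite (disjointFr d h) in rB.
Qed.

Lemma cross_act w : cross (isblk q) (predC (isblk q)) (pull r w) =
  cross (isblk q') (predC (isblk q')) w.
Proof. by rewrite cross_pull; apply: eq_cross => l _; rewrite /isblk /= blk_sub. Qed.

End Equivariance.

(** * The dg operad of decorated trees *)

Section Ordinals.
Variable K : fieldType.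
Local Notation F n := (cochain K 'I_n).

Lemma cochain_ord0 (a : F 0) : a = 0.
Proof. by apply: cochain_eq => w /good_size; rewrite card_ord. Qed.

Fact relabel_cochain n (a : F n) (s : 'S_n) :
  is_cochain (fun w => (-1) ^+ s * a (pull s w)).
Proof.
split=> [u x y v|w gw].
  by rewrite !pull_cat /= (cochain_antisym a) mulrN.
rewrite cochain_supp ?mulr0 //; apply: contra gw.
by rewrite (good_pull (permK s) (permKV s)).
Qed.

(** [pull] alone fixes every corolla; the sign turns the corollas into sign representations and is
    part of the operadic suspension. *)
Definition crelabel n (a : F n) (s : 'S_n) : F n := mkcochain (relabel_cochain a s).
Arguments crelabel : simpl never.

Lemma crelabelE n (a : F n) (s : 'S_n) w : crelabel a s w = (-1) ^+ s * a (pull s w).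
Proof. by []. Qed.

Lemma good_relabel n (s : 'S_n) w : good (pull s w) = good w.
Proof. exact: (good_pull (permK s) (permKV s)). Qed.

Fact crelabel_linear n (s : 'S_n) : linear (fun a : F n => crelabel a s).
Proof.
by move=> c a b; apply: cochain_eq => w _; rewrite [LHS]crelabelE evD evZ [RHS]evD evZ [X in _ = c * X + _]crelabelE [X in _ = _ + X]crelabelE mulrDr mulrCA.
Qed.

Fact crelabel_homog n (s : 'S_n) d (a : F n) : chomog d a -> chomog d (crelabel a s).
Proof.
move=> ha w; rewrite crelabelE mulf_eq0 signr_eq0 /= => /ha <-.
by rewrite /wdeg size_map.
Qed.

Fact crelabel1 n (a : F n) : crelabel a 1%g = a.
Proof.
apply: cochain_eq => w _; rewrite crelabelE odd_perm1 expr0 mul1r.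
by rewrite (@eq_pull _ _ _ id) ?pull_id // => x; rewrite perm1.
Qed.

Fact crelabelM n (a : F n) (s t : 'S_n) :
  crelabel (crelabel a s) t = crelabel a (s * t)%g.
Proof.
apply: cochain_eq => w _; rewrite !crelabelE odd_permM signr_addb mulrA (mulrC ((-1) ^+ t)).
by congr (_ * a _); rewrite pull_pull; apply: eq_pull => x; rewrite /= permM.
Qed.

Definition csmodule : smodule K :=
  @SModule K (fun n => cspace K 'I_n) crelabel crelabel_linear crelabel_homog crelabel1 crelabelM.

(** At [j = i] the value is the last position of a nonempty block, a legitimate value since [glue]
    asks the grafted input to land in the block. *)
Definition omap m p (n i : nat) (j : 'I_m) : 'I_p.+1 := inord (outer_pos n i j).
Definition qmap n p (i : nat) (j : 'I_n) : 'I_p.+1 := inord (i + j).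

(** The exponents are those of the operadic suspension. Arity 0 is separated because [inord] needs
    an inhabited ordinal; there are no nonzero cochains on zero leaves. *)
Definition pcmp m n p (i : nat) : F m -> F n -> F p :=
  match p return F m -> F n -> F p with
  | 0 => fun _ _ => 0
  | p'.+1 => gcomp (omap (m := m) p' n i) (qmap (n := n) p' i) (i * n.-1) m.-1
  end.

Lemma omapE m n p (h : (m + n = p.+2)%N) (i j : 'I_m) : (0 < n)%N ->
  omap p n i j = outer_pos n i j :> nat.
Proof.
move=> n0; rewrite /omap inordK // /outer_pos; have := ltn_ord j; have := ltn_ord i.
case: ifP => _; lia.
Qed.

Lemma qmapE m n p (h : (m + n = p.+2)%N) (i : 'I_m) (j : 'I_n) :
  qmap p i j = (i + j)%N :> nat.
Proof. rewrite /qmap inordK //; have := ltn_ord j; have := ltn_ord i; lia. Qed.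

Lemma mem_block m n p (h : (m + n = p.+2)%N) (i : 'I_m) (u : 'I_p.+1) :
  (u \in qmap (n := n) p i @: setT) = (i <= u < i + n)%N.
Proof.
apply/imsetP/idP => [[j _ ->]|/andP[iu un]].
  by rewrite (qmapE h) leq_addr ltn_add2l ltn_ord.
have lt : (u - i < n)%N by lia.
exists (Ordinal lt) => //; apply: ord_inj; rewrite (qmapE h) /=; lia.
Qed.

Lemma ord_glue m n p (h : (m + n = p.+2)%N) (i : 'I_m) : (0 < n)%N ->
  glue (omap (m := m) p n i) (qmap (n := n) p i) i.
Proof.
move=> n0; split.
- move=> j k /(congr1 (@nat_of_ord _)); rewrite !(omapE h) // /outer_pos => E; apply: ord_inj.
  by move: E; case: ifP => ?; case: ifP => ?; lia.
- by move=> j k /(congr1 (@nat_of_ord _)); rewrite !(qmapE h) => /addnI/ord_inj.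
- move=> j; rewrite (mem_block h) (omapE h) // /outer_pos -(inj_eq (@ord_inj _)) /=.
  by case: ltngtP => ? /=; lia.
- move=> u; have [|out] := boolP (u \in qmap (n := n) p i @: setT); [by left | right].
  rewrite (mem_block h) in out; have := ltn_ord u; have := ltn_ord i => li lu.
  have [lt|ge] := ltnP u i.
    have lm : (u < m)%N by lia.
    by exists (Ordinal lm); apply: ord_inj; rewrite (omapE h) //= /outer_pos lt.
  have lm : ((u - n).+1 < m)%N by lia.
  exists (Ordinal lm); apply: ord_inj; rewrite (omapE h) //= /outer_pos ifF; lia.
- by rewrite !card_ord h.
Qed.

End Ordinals.

Section TreeOperad.
Variable K : fieldType.
Local Notation F n := (cochain K 'I_n).
Implicit Types m n p q r l : nat.

Lemma pcmp0l m n p i (b : F n) : pcmp p i (0 : F m) b = 0.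
Proof.
case: p => [|p] //; apply: cochain_eq => w gw; rewrite [LHS]gcompE //.
by rewrite ev0 mul0r mulr0.
Qed.

Lemma pcmp0r m n p i (a : F m) : pcmp p i a (0 : F n) = 0.
Proof.
case: p => [|p] //; apply: cochain_eq => w gw; rewrite [LHS]gcompE //.
by rewrite [X in _ * X]mulrC ev0 mul0r mulr0.
Qed.

Lemma crelabel0 n (s : 'S_n) : crelabel (0 : F n) s = 0.
Proof. by apply: cochain_eq => w _; rewrite crelabelE ev0 mulr0. Qed.

Fact cunit_proof : is_cochain (fun w : word 'I_1 => (nilp w)%:R : K).
Proof.
split=> [u x y v|w]; first by case: u => [|z u]; rewrite /= oppr0.
by case: w => //; rewrite /good /= card_ord.
Qed.

Definition cunit : F 1 := mkcochain cunit_proof.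
Arguments cunit : simpl never.

Lemma cunitE w : cunit w = (nilp w)%:R. Proof. by []. Qed.

Fact cunit_homog : chomog 0 cunit.
Proof. by case=> [|l w]; rewrite cunitE /wdeg /= ?eqxx // card_ord. Qed.

Definition pcomp_F m n p (_ : (m + n = p.+1)%N) (i : 'I_m) (a : F m) (b : F n) : F p := pcmp p i a b.

Fact pcomp_linearl m n p (h : (m + n = p.+1)%N) (i : 'I_m) (b : F n) :
  linear (fun a : F m => pcomp_F h i a b).
Proof.
rewrite /pcomp_F; case: p h => [|p] h; last exact: gcomp_linearl.
by move=> c a a' /=; rewrite scaler0 addr0.
Qed.

Fact pcomp_linearr m n p (h : (m + n = p.+1)%N) (i : 'I_m) (a : F m) :
  linear (pcomp_F h i a : F n -> F p).
Proof.
rewrite /pcomp_F; case: p h => [|p] h; last exact: gcomp_linearr.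
by move=> c b b' /=; rewrite scaler0 addr0.
Qed.

Fact pcomp_homog m n p (h : (m + n = p.+1)%N) (i : 'I_m) d e (a : F m) (b : F n) :
  chomog d a -> chomog e b -> chomog (d + e) (pcomp_F h i a b).
Proof.
rewrite /pcomp_F; case: n b h => [|n] b h ha hb.
  by rewrite [b]cochain_ord0 pcmp0r; exact: chomog0.
case: p h => [|p] h /=; first exact: chomog0.
have g := ord_glue h i (ltn0Sn n).
exact: (gcomp_homog i (glue_card g)).
Qed.

Fact pcomp_1l n (h : (1 + n = n.+1)%N) (i : 'I_1) (a : F n) : pcomp_F h i cunit a = a.
Proof.
rewrite /pcomp_F; case: n h a => [|n] h a; first by rewrite [RHS]cochain_ord0 [LHS]cochain_ord0.
have g := ord_glue h i (ltn0Sn n); apply: cochain_eq => w gw; rewrite [LHS]gcompE //.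
have all_blk c : isblk (qmap (n := n.+1) n i) c.
  by apply/subsetP => u _; rewrite (mem_block h) (ord1 i) add0n ltn_ord.
have -> : low (omap (m := 1) n n.+1 i) (qmap (n := n.+1) n i) w = [::].
  by rewrite /low (eq_filter (a2 := pred0)) ?filter_pred0 // => l; rewrite /= all_blk.
have -> : upp (qmap (n := n.+1) n i) w = w.
  rewrite /upp (eq_filter (a2 := predT)) ?filter_predT => [|l]; last by rewrite all_blk.
  by rewrite (@eq_pull _ _ _ id) ?pull_id // => u; apply: ord_inj; rewrite (qmapE h) (ord1 i).
rewrite /gsign cross0r => [|l _]; last by rewrite /= all_blk.
by rewrite cunitE (ord1 i) /= !mul0n expr0 !mul1r.
Qed.

Fact pcomp_1r n (h : (n + 1 = n.+1)%N) (i : 'I_n) (a : F n) : pcomp_F h i a cunit = a.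
Proof.
rewrite /pcomp_F; case: n h a i => [|n] h a i; first by case: i.
have g := ord_glue h i (ltn0Sn 0); apply: cochain_eq => w gw; rewrite [LHS]gcompE //.
have no_blk : {in w, forall c, isblk (qmap (n := 1) n i) c = false}.
  move=> l lw; apply/negP => /subset_leq_card; rewrite card_imset; last exact: glue_qI g.
  by move=> /(leq_trans (good_gt1 gw (map_f fst lw))); rewrite cardsT card_ord.
have E : upp (qmap (n := 1) n i) w = [::].
  by rewrite /upp (eq_in_filter (a2 := pred0)) ?filter_pred0 // => l lw; rewrite no_blk.
have -> : low (omap (m := n.+1) n 1 i) (qmap (n := 1) n i) w = w.
  rewrite /low (eq_in_filter (a2 := predT)) ?filter_predT => [|l lw]; last by rewrite /= no_blk.
  rewrite (@eq_pull _ _ _ id) ?pull_id // => u; apply: ord_inj; rewrite (omapE h) //.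
  by rewrite /outer_pos addn1 if_same.
rewrite /gsign cross0 => [|l lw]; last by rewrite no_blk.
by rewrite E cunitE /= !muln0 expr0 mulr1 mul1r.
Qed.

Fact pcomp_seq m n l q r p
      (hab : (m + n = q.+1)%N) (hab_c : (q + l = p.+1)%N)
      (hbc : (n + l = r.+1)%N) (ha_bc : (m + r = p.+1)%N)
      (i : 'I_m) (j : 'I_n) (x : 'I_q) (a : F m) (b : F n) (c : F l) :
    x = (i + j)%N :> nat ->
    pcomp_F hab_c x (pcomp_F hab i a b) c = pcomp_F ha_bc i a (pcomp_F hbc j b c).
Proof.
move=> xE; rewrite /pcomp_F.
case: l c hab_c hbc => [|l] c hab_c hbc; first by rewrite [c]cochain_ord0 !pcmp0r.
have jn := ltn_ord j; have im := ltn_ord i.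
case: n b hab hbc j xE jn => [|n] b hab hbc j xE jn; first by lia.
case: m a hab ha_bc i xE im => [|m] a hab ha_bc i xE im; first by lia.
case: p hab_c ha_bc => [|p] hab_c ha_bc; first by rewrite [LHS]cochain_ord0 [RHS]cochain_ord0.
case: q hab hab_c x xE => [|q] hab hab_c x xE; first by case: x {xE}.
case: r hbc ha_bc => [|r] hbc ha_bc; first by lia.
apply: (gcomp_seq (ord_glue hab_c x (ltn0Sn l)) (ord_glue hab i (ltn0Sn n))
   (ord_glue ha_bc i (ltn0Sn r)) (ord_glue hbc j (ltn0Sn l))).
- move=> k; apply: ord_inj; rewrite !(omapE hab_c, omapE hab, omapE ha_bc) // xE /outer_pos.
  by case: (ltnP k i) => ki; case: ifP => ?; lia.
- move=> k; apply: ord_inj; rewrite (omapE hab_c) // (qmapE hab) (qmapE ha_bc) (omapE hbc) // xE /outer_pos.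
  by rewrite ltn_add2l; case: ifP => ?; lia.
- by move=> k; apply: ord_inj; rewrite (qmapE hab_c) (qmapE ha_bc) (qmapE hbc) xE addnA.
- congr odd; rewrite /=; lia.
- congr odd; rewrite /= xE (_ : r = n + l)%N; last by lia.
  by rewrite mulnDl mulnDr; lia.
Qed.

Fact pcomp_par m n l q r p
      (hab : (m + n = q.+1)%N) (hab_c : (q + l = p.+1)%N)
      (hac : (m + l = r.+1)%N) (hac_b : (r + n = p.+1)%N)
      (i k : 'I_m) (x : 'I_q) (y : 'I_r) (d e : int)
      (a : F m) (b : F n) (c : F l) :
    (i < k)%N -> x = outer_pos n i k :> nat -> y = outer_pos l k i :> nat ->
    chomog d b -> chomog e c ->
    pcomp_F hab_c x (pcomp_F hab i a b) c
      = (-1) ^ (d * e) *: pcomp_F hac_b y (pcomp_F hac k a c) b.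
Proof.
move=> ik xE yE hb hc; rewrite /pcomp_F.
case: l c hc hab_c hac yE => [|l] c hc hab_c hac yE.
  by rewrite [c]cochain_ord0 !pcmp0r pcmp0l scaler0.
case: n b hb hab hac_b xE => [|n] b hb hab hac_b xE.
  by rewrite [b]cochain_ord0 !pcmp0r pcmp0l scaler0.
have im := ltn_ord i; have km := ltn_ord k.
case: m a hab hac i k ik xE yE im km => [|m] a hab hac i k ik xE yE im km; first by lia.
case: p hab_c hac_b => [|p] hab_c hac_b; first by rewrite [LHS]cochain_ord0 [RHS]cochain_ord0.
case: q hab hab_c x xE => [|q] hab hab_c x xE; first by case: x {xE}.
case: r hac hac_b y yE => [|r] hac hac_b y yE; first by case: y {yE}.
rewrite /outer_pos ltnNge (ltnW ik) /= addnS /= in xE; rewrite /outer_pos ik in yE.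
have qE : (m + n = q)%N by lia.
have rE : (m + l = r)%N by lia.
have H1 (z : 'I_m.+1) : omap p l.+1 x (omap q n.+1 i z) = omap p n.+1 y (omap r l.+1 k z).
  apply: ord_inj; rewrite (omapE hab_c) // (omapE hab) // (omapE hac_b) // (omapE hac) // xE yE /outer_pos.
  have := ltn_ord z; case: (ltnP z i) => zi; case: (ltnP z k) => zk lz; do 2?case: ifP => ?; lia.
have H2 (z : 'I_n.+1) : omap p l.+1 x (qmap q i z) = qmap p y z.
  apply: ord_inj; rewrite (omapE hab_c) // (qmapE hab) (qmapE hac_b) xE yE /outer_pos.
  have := ltn_ord z; case: ifP => ?; lia.
have H3 (z : 'I_l.+1) : omap p n.+1 y (qmap r k z) = qmap p x z.
  apply: ord_inj; rewrite (omapE hac_b) // (qmapE hac) (qmapE hab_c) xE yE /outer_pos.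
  have := ltn_ord z; case: ifP => ?; lia.
have hx : x \notin qmap q i @: [set: 'I_n.+1] by rewrite (mem_block hab) xE; apply/negP; lia.
have hy : y \notin qmap r k @: [set: 'I_l.+1] by rewrite (mem_block hac) yE; apply/negP; lia.
have pe : odd (x * l + i * n) = odd (y * n + k * l + n * l) by congr odd; rewrite xE yE mulnDl; lia.
have := gcomp_par (ord_glue hab_c x (ltn0Sn l)) (ord_glue hac_b y (ltn0Sn n))
  H1 H2 H3 hx hy m (card_ord _) (card_ord _) pe a hb hc.
by rewrite qE rE.
Qed.

Fact pcomp_act m n p (h : (m + n = p.+1)%N) (i : 'I_m)
      (s : 'S_m) (t : 'S_n) (r : 'S_p) (a : F m) (b : F n) :
    (forall (j : 'I_m) (u : 'I_p), j != i ->
       u = outer_pos n i j :> nat -> r u = outer_pos n (s i) (s j) :> nat) ->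
    (forall (j : 'I_n) (u : 'I_p),
       u = (i + j)%N :> nat -> r u = (s i + t j)%N :> nat) ->
    pcomp_F h (s i) (crelabel a s) (crelabel b t) = crelabel (pcomp_F h i a b) r.
Proof.
move=> H1 H2; rewrite /pcomp_F; have sgn := block_sign h H1 H2.
case: n b h t H1 H2 sgn => [|n] b h t H1 H2 sgn.
  by rewrite [b]cochain_ord0 crelabel0 !pcmp0r crelabel0.
case: p h r H1 H2 sgn => [|p] h r H1 H2 sgn; first by rewrite [LHS]cochain_ord0 [RHS]cochain_ord0.
have g := ord_glue h i (ltn0Sn n); have g' := ord_glue h (s i) (ltn0Sn n).
have ro j : j != i -> r (omap p n.+1 i j) = omap p n.+1 (s i) (s j).
  by move=> ne; apply: ord_inj; rewrite (H1 j) ?(omapE h).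
have rq j : r (qmap p i j) = qmap p (s i) (t j).
  by apply: ord_inj; rewrite (H2 j) ?(qmapE h).
have tK : exists ti, cancel ti t by exists (t^-1)%g; exact: permKV.
apply: cochain_eq => w gw; rewrite [LHS]gcompE // [RHS]crelabelE.
rewrite [X in _ = _ * X]gcompE ?good_relabel //.
have uE := upp_act (permK r) (permKV r) rq tK w.
have [gu|ngu] := boolP (good (upp (qmap (n := n.+1) p (s i)) w)); last first.
  by rewrite uE (cochain_supp b) ?(cochain_supp (crelabel b t)) ?good_relabel // !mulr0.
have [sw _] := glue_good (glue_oI g') (glue_qI g') (glue_oB g') (glue_oq g') (glue_card g') gw gu.
have lE := low_act g g' (permK r) (permKV r) (erefl (s i)) ro rq tK sw.
have szE : size (upp (qmap (n := n.+1) p i) (pull r w)) = size (upp (qmap (n := n.+1) p (s i)) w).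
  by rewrite uE size_map.
rewrite /gsign (cross_act (permK r) (permKV r) rq tK) szE uE lE !crelabelE.
set va := a _; set vb := b _.
have E : (-1) ^+ (cross (isblk (qmap (n := n.+1) p (s i))) (predC (isblk (qmap (n := n.+1) p (s i)))) w +
  m.-1 * size (upp (qmap (n := n.+1) p (s i)) w) + s i * n) * ((-1) ^+ s * (-1) ^+ t) =
  (-1) ^+ r * (-1) ^+ (cross (isblk (qmap (n := n.+1) p (s i))) (predC (isblk (qmap (n := n.+1) p (s i)))) w +
  m.-1 * size (upp (qmap (n := n.+1) p (s i)) w) + i * n) :> K.
  rewrite -!exprD; apply: signr_parity; rewrite !oddD sgn !oddb !(oddM, oddD) /= !negbK.
  move: (odd (cross _ _ _)) (odd m.-1 && _) (odd_perm s) (odd_perm t) (odd (s i)) (odd i) (odd n) => x1 x2 x3 x4 x5 x6 x7.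
  by case: x1; case: x2; case: x3; case: x4; case: x5; case: x6; case: x7.
by rewrite [X in _ * X = _]mulrACA [LHS]mulrA E [RHS]mulrA.
Qed.

Definition toperad : operad K :=
  @Operad K (csmodule K) cunit pcomp_F cunit_homog pcomp_linearl pcomp_linearr
    pcomp_homog pcomp_1l pcomp_1r pcomp_seq pcomp_par pcomp_act.

Lemma cdiff_relabel n (a : F n) (s : 'S_n) : cdiff (crelabel a s) = crelabel (cdiff a) s.
Proof.
apply: cochain_eq => w gw; rewrite cdiffE // crelabelE cdiffE ?good_relabel //.
rewrite -DsumZ cl_pull [RHS]Dsum_map.
apply: eq_Dsum => C u v E.
have sT : (s @^-1: C == setT) = (C == setT).
  apply/eqP/eqP => [h|->]; last by apply/setP => x; rewrite !inE.
  apply/setP => x; have : (s^-1)%g x \in s @^-1: C by rewrite h.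
  by rewrite !inE permKV.
rewrite sT; case: ifP => CT; first by rewrite mulr0.
rewrite crelabelE; congr (_ * a _); rewrite /pull /mkw -!map_comp; apply: eq_map => A /=; congr (_, _).
have Cw : C \in cl w by rewrite E mem_cat mem_head orbT.
have gw' : good (pull s w) by rewrite good_relabel.
have inj (A' B' : {set 'I_n}) : (s @^-1: A' == s @^-1: B') = (A' == B').
  by rewrite !eqEsubset !(sub_bij (permKV s)).
have vE (A' : {set 'I_n}) : val (pull s w) (s @^-1: A') = val w A'.
  by rewrite /val /pull !big_map /=; congr (_, _); apply: eq_bigl => l'; rewrite inj.
have iC := inner_good gw Cw (negbT CT); have [pP Cp minP] := parP (good_nested gw) iC.
have parE : par (val (pull s w)) (s @^-1: C) = s @^-1: par (val w) C.
  apply: par_eq.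
  - by rewrite /pr vE.
  - by rewrite properE !(sub_bij (permKV s)) -properE.
  - move=> S pS CS.
    have ES : S = s @^-1: ((s^-1)%g @^-1: S) by apply/setP => x; rewrite !inE permK.
    move: pS CS; rewrite ES /pr vE properE !(sub_bij (permKV s)) -properE; exact: minP.
by rewrite -/(pull s w) /contr parE !inj !vE.
Qed.

Lemma cdiff_pcomp m n p (h : (m + n = p.+1)%N) (i : 'I_m) (d : int) (a : F m) (b : F n) :
  chomog d a ->
  cdiff (pcomp_F h i a b) = pcomp_F h i (cdiff a) b + (-1) ^ d *: pcomp_F h i a (cdiff b).
Proof.
move=> ha; rewrite /pcomp_F; case: n b h => [|n] b h.
  by rewrite [cdiff b]cochain_ord0 [b]cochain_ord0 !pcmp0r scaler0 addr0 linear0.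
case: p h => [|p] h; first by rewrite [LHS]cochain_ord0 [RHS]cochain_ord0.
have g := ord_glue h i (ltn0Sn n).
by apply: (gcomp_diff _ (glue_oI g) (glue_qI g) (glue_oB g) (glue_oq g) (glue_card g)) => //; rewrite card_ord.
Qed.

Definition tdiff n : {linear toperad n -> toperad n} := @cdiff K 'I_n.

Definition tdg : dg_operad K :=
  @DGOperad K toperad tdiff (fun n => @cdiff_homog K 'I_n) (fun n => @cdiff_sq K 'I_n)
    cdiff_relabel cdiff_pcomp.

End TreeOperad.

(** * Shuffles and subsets *)

Section Shuffles.
Variable n : nat.

Definition block (k : nat) : {set 'I_n} := [set j : 'I_n | (j < k)%N].

Lemma enum_filter (S : {set 'I_n}) : enum S = filter (mem S) (enum 'I_n).
Proof. by rewrite enumT. Qed.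

Lemma card_block k : (k <= n)%N -> #|block k| = k.
Proof.
move=> kn; rewrite cardE /block; transitivity (size (filter (fun j => j < k)%N (iota 0 n))).
  rewrite -val_enum_ord filter_map size_map enum_filter; congr size.
  by apply: eq_filter => j; rewrite /= inE.
rewrite -{1}(subnKC kn) iotaD filter_cat size_cat !size_filter add0n.
rewrite (eq_in_count (a2 := predT)) => [|j]; last by rewrite mem_iota.
rewrite count_predT size_iota [X in (_ + X)%N](_ : _ = 0%N) ?addn0 //.
apply/eqP; rewrite -leqn0 leqNgt -has_count; apply/hasPn => j; rewrite mem_iota -leqNgt.
by case/andP.
Qed.

Lemma shuffleP k (t : 'S_n) : reflect
  (forall i j : 'I_n, (i < j)%N -> (j < k)%N || (k <= i)%N -> (t i < t j)%N) (is_shuffle k t).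
Proof.
apply: (iffP forallP) => [h i j ij jk|h i].
  by have /forallP/(_ j)/implyP := h i; rewrite ij; apply.
by apply/forallP => j; apply/implyP => /andP[]; exact: h.
Qed.

Lemma rank_mono (A S : {set 'I_n}) (t : 'I_n -> 'I_n) :
  {in A &, {mono t : i j / (i < j)%N}} -> t @: A = S ->
  forall j, j \in A -> #|[set y in S | (y < t j)%N]| = #|[set i in A | (i < j)%N]|.
Proof.
move=> tm tS j jA; rewrite -[RHS](card_in_imset (f := t)).
  apply: eq_card => y; rewrite inE -tS; apply/andP/imsetP.
    move=> [/imsetP[i iA ->]]; rewrite tm // => ij; exists i => //; by rewrite inE iA.
  by move=> [i]; rewrite inE => /andP[iA ij] ->; rewrite imset_f // tm.
move=> i i'; rewrite !inE => /andP[iA _] /andP[i'A _] E; apply: ord_inj.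
have := tm _ _ iA i'A; have := tm _ _ i'A iA; rewrite E ltnn; lia.
Qed.

(** An increasing map is determined by its image, since it preserves ranks. Applied to a block and
    its complement, this makes a shuffle the same thing as a subset. *)
Lemma mono_unique (A S : {set 'I_n}) (t t' : 'I_n -> 'I_n) :
  {in A &, {mono t : i j / (i < j)%N}} -> {in A &, {mono t' : i j / (i < j)%N}} ->
  t @: A = S -> t' @: A = S -> {in A, t =1 t'}.
Proof.
move=> tm tm' tS tS' j jA; have := rank_mono tm tS jA; rewrite -(rank_mono tm' tS' jA) => E.
have tjS : t j \in S by rewrite -tS imset_f.
have tjS' : t' j \in S by rewrite -tS' imset_f.
apply: ord_inj; case: (ltngtP (t j) (t' j)) => // lt; exfalso; move: E.
- rewrite [RHS](cardsD1 (t j)) inE tjS lt /= add1n => E.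
  suff h : (#|[set y in S | (y < t j)%N]| <= #|[set y in S | (y < t' j)%N] :\ t j|)%N by rewrite E ltnn in h.
  apply/subset_leq_card/subsetP => y; rewrite !inE => /andP[-> yl] /=.
  by rewrite (ltn_trans yl lt) andbT; apply/eqP => e; rewrite e ltnn in yl.
- rewrite [LHS](cardsD1 (t' j)) inE tjS' lt /= add1n => E.
  suff h : (#|[set y in S | (y < t' j)%N]| <= #|[set y in S | (y < t j)%N] :\ t' j|)%N by rewrite -E ltnn in h.
  apply/subset_leq_card/subsetP => y; rewrite !inE => /andP[-> yl] /=.
  by rewrite (ltn_trans yl lt) andbT; apply/eqP => e; rewrite e ltnn in yl.
Qed.

Lemma shuffle_mono k (t : 'S_n) : is_shuffle k t ->
  {in block k &, {mono t : i j / (i < j)%N}} /\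
  {in ~: block k &, {mono t : i j / (i < j)%N}}.
Proof.
move=> /shuffleP h; split=> i j; rewrite !inE ?(=^~ leqNgt) => ik jk.
  apply/idP/idP => [lt|ij]; last by rewrite h // jk.
  rewrite ltnNge; apply/negP => ji; have [E|ne] := eqVneq (j : nat) i.
    by rewrite (ord_inj E) ltnn in lt.
  have : (t j < t i)%N by rewrite h ?ik // ltn_neqAle ne.
  by rewrite ltnNge (ltnW lt).
apply/idP/idP => [lt|ij]; last by rewrite h // ik orbT.
rewrite ltnNge; apply/negP => ji; have [E|ne] := eqVneq (j : nat) i.
  by rewrite (ord_inj E) ltnn in lt.
have : (t j < t i)%N by rewrite h ?jk ?orbT // ltn_neqAle ne.
by rewrite ltnNge (ltnW lt).
Qed.

Lemma shuffle_unique k (S : {set 'I_n}) (t t' : 'S_n) : is_shuffle k t -> is_shuffle k t' ->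
  t @: block k = S -> t' @: block k = S -> t = t'.
Proof.
move=> /shuffle_mono[m1 m2] /shuffle_mono[m1' m2'] tS tS'.
have imC (r : 'S_n) : r @: block k = S -> r @: (~: block k) = ~: S.
  move=> rS; apply/setP => y; rewrite inE -rS; apply/imsetP/idP => [[x + ->]|nS].
    by rewrite inE; apply: contra => /imsetP[z zb /perm_inj ->].
  exists ((r^-1)%g y); rewrite ?permKV // inE; apply: contra nS => yb.
  by rewrite -(permKV r y) imset_f.
apply/permP => j; case: (boolP (j \in block k)) => jb.
  exact: (mono_unique m1 m1' tS tS').
by apply: (mono_unique m2 m2' (imC _ tS) (imC _ tS')); rewrite inE.
Qed.

Lemma enum_mono (S : {set 'I_n}) : sorted (fun i j : 'I_n => i < j)%N (enum S).
Proof.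
rewrite enum_filter; apply: sorted_filter; first by move=> i j k; exact: ltn_trans.
have := iota_ltn_sorted 0 n; rewrite -val_enum_ord; elim: (enum 'I_n) => //= x s IH.
rewrite !(path_sortedE) //; try by move=> i j k; exact: ltn_trans.
by rewrite all_map => /andP[-> /IH].
Qed.

Lemma shuffle_exists k (S : {set 'I_n}) : #|S| = k ->
  exists t : 'S_n, is_shuffle k t /\ t @: block k = S.
Proof.
move=> Sk; pose e := enum S ++ enum (~: S).
have se : size e = n by rewrite size_cat -!cardE cardsC card_ord.
have ue : uniq e.
  rewrite cat_uniq !enum_uniq andbT; apply/hasPn => x.
  by rewrite !mem_enum inE.
have lt (j : 'I_n) : (j < size e)%N by rewrite se.
pose f (j : 'I_n) : 'I_n := nth j e j.
have fI : injective f.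
  move=> i j; rewrite /f (set_nth_default j) // => /eqP; rewrite nth_uniq // => /eqP.
  exact: ord_inj.
exists (perm fI); split.
  apply/shuffleP => i j ij jk; rewrite !permE /f (set_nth_default j) //.
  have tr : transitive (fun i j : 'I_n => i < j)%N by move=> a b c; exact: ltn_trans.
  rewrite !nth_cat -cardE Sk; have [jlt|jge] := ltnP j k.
    rewrite (ltn_trans ij jlt); apply: (sorted_ltn_nth tr) => //; first exact: enum_mono.
      by rewrite inE -cardE Sk (ltn_trans ij).
    by rewrite inE -cardE Sk.
  move: jk; rewrite ltnNge jge /= => ki; rewrite (ltnNge i k) ki /=.
  have cC : #|~: S| = (n - k)%N by rewrite cardsCs setCK Sk card_ord.
  apply: (sorted_ltn_nth tr) => //; first exact: enum_mono.
  - by rewrite inE -cardE cC ltn_sub2r // (leq_ltn_trans ki).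
  - by rewrite inE -cardE cC ltn_sub2r // (leq_ltn_trans jge).
  - by rewrite ltn_sub2r // (leq_ltn_trans ki).
apply/eqP; rewrite eqEcard card_imset; last exact: perm_inj.
rewrite card_block -?Sk ?leqnn; last by rewrite -[X in (_ <= X)%N]card_ord max_card.
rewrite andbT; apply/subsetP => y /imsetP[j]; rewrite inE => jk ->.
by rewrite permE /f nth_cat -cardE jk -mem_enum mem_nth // -cardE.
Qed.

End Shuffles.

(** * The generators and their differential *)

Section Generators.
Variable K : fieldType.
Local Notation F n := (cochain K 'I_n).

(** The i-th coordinate written as a sum: total in [i], and free of transport along the equality of
    [gen_mult n] and [n]. *)
Definition gcoef n (v : gens K n) (i : nat) : K :=
  \sum_(k < gen_mult n | k == i :> nat) (v : 'rV[K]_(gen_mult n)) 0 k.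

Lemma gcoef_linear n i : linear (fun v : gens K n => (gcoef v i : K^o)).
Proof.
move=> c u v; rewrite /gcoef.
have -> : c *: (\sum_(k < gen_mult n | k == i :> nat) (u : 'rV[K]_(gen_mult n)) 0 k : K^o) =
  \sum_(k < gen_mult n | k == i :> nat) c * (u : 'rV[K]_(gen_mult n)) 0 k by rewrite scaler_sumr.
by rewrite -big_split /=; apply: eq_bigr => k _; rewrite !mxE.
Qed.

Lemma gcoef_basis n i i' : (i < gen_mult n)%N -> gcoef (gen_basis K n i) i' = (i == i')%:R.
Proof.
move=> lt; rewrite /gcoef; have [<-|ne] := eqVneq i i'.
  rewrite (big_pred1 (Ordinal lt)); first by rewrite mxE eqxx.
  by [].
rewrite big1 // => k /eqP ki; rewrite mxE ki.
by rewrite eq_sym (negbTE ne).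
Qed.

(** Only the first weight is read: in a good one-letter word the arity determines the second. *)
Definition gfun1 n (v : gens K n) (w : word 'I_n) : K :=
  if good w then (if w is [:: l] then gcoef v l.2.1 else 0) else 0.

Fact gfun1_cochain n (v : gens K n) : is_cochain (gfun1 v).
Proof.
split=> [u x y u'|w /negbTE gw]; last by rewrite /gfun1 gw.
rewrite /gfun1; do 2!case: ifP => _; case: u => [|z u] /=; rewrite ?oppr0 //;
  by case: u => //=; rewrite oppr0.
Qed.

Definition giota_fun n (v : gens K n) : F n := mkcochain (gfun1_cochain v).
Arguments giota_fun : simpl never.

Lemma giotaE n (v : gens K n) w : giota_fun v w = gfun1 v w. Proof. by []. Qed.

Fact giota_linear n : linear (@giota_fun n).
Proof.
move=> c u v; apply: cochain_eq => w gw; rewrite evD evZ !giotaE /gfun1 gw.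
case: w gw => [|l [|l' w]] gw; rewrite ?mulr0 ?addr0 //.
exact: (@gcoef_linear n l.2.1 c u v).
Qed.

HB.instance Definition _ n :=
  GRing.isLinear.Build K (gens K n) (F n) *:%R (@giota_fun n) (@giota_linear n).

Definition giota n : {linear gens K n -> tdg K n} := @giota_fun n.

Lemma giota_morphism : is_smodule_morphism (P := gens K) (Q := tdg K) giota.
Proof.
split=> [n d v hv w|n v s].
  change (gfun1 v w != 0 -> wdeg w = d); rewrite /gfun1; case: ifP => [gw|_]; last by rewrite eqxx.
  case: w gw => [|l [|l' w]] gw; rewrite ?eqxx //= => nz.
  case: hv => [hd|v0]; last first.
    by move: nz; rewrite v0 /gcoef big1 ?eqxx // => k _; rewrite mxE.
  by rewrite /wdeg /= card_ord; lia.
apply: cochain_eq => w gw.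
change (giota_fun (gen_act v s) w = crelabel (giota_fun v) s w).
rewrite crelabelE /gen_act linearZ evZ.
change ((-1) ^+ s * gfun1 v w = (-1) ^+ s * gfun1 v (pull s w)); rewrite /gfun1 good_relabel gw.
by case: w {gw} => [|l [|l' w]].
Qed.

Lemma gen_multE n : (2 <= n)%N -> gen_mult n = n.
Proof. by rewrite /gen_mult => ->. Qed.

Lemma good_pair n (S : {set 'I_n}) (u v : nat * nat) : good [:: (setT, u); (S, v)] ->
  [/\ S != setT, #|S| = (v.1 + v.2).+1, n = (u.1 + u.2 + v.1 + v.2).+1, (0 < u.1 + u.2)%N & (0 < v.1 + v.2)%N].
Proof.
move=> gw; have /and5P[uw /and3P[p1 p2 _] _ /and3P[/eqP c1 /eqP c2 _] _] := gw.
have ST : S != setT by move: uw; rewrite /= inE andbT eq_sym.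
have S1 : (1 < #|S|)%N by apply: (good_gt1 gw); rewrite !inE eqxx orbT.
have n1 : (1 < n)%N by have := subset_leq_card (subsetT S); rewrite cardsT card_ord; lia.
move: c1 c2; rewrite /csum !big_cons !big_nil /= !subsetT cardsT card_ord subTset (negbTE ST) subxx.
rewrite /wt /= in p1 p2 *; move=> c1 c2; split=> //; lia.
Qed.

Lemma good_shape n (w : word 'I_n) : good w -> size w = 2%N ->
  exists S u v, w = [:: (setT, u); (S, v)] \/ w = [:: (S, v); (setT, u)].
Proof.
case: w => [|[S v] [|[T u] [|]]] //= gw _.
have : setT \in cl [:: (S, v); (T, u)] by apply: (setT_root gw); exact: mem_head.
rewrite !inE /= => /orP[] /eqP E; rewrite -E.
  by exists T, v, u; left.
by exists S, u, v; right.
Qed.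

Lemma mem_qblock n k p : (n + k = p.+2)%N -> (0 < n)%N ->
  qmap (n := k) p 0 @: setT = block p.+1 k.
Proof.
move=> h n0; have h' : (n.-1.+1 + k = p.+2)%N by rewrite prednK.
apply/setP => u; have := mem_block h' (ord0 : 'I_n.-1.+1) u; rewrite /= => ->.
by rewrite inE.
Qed.

Section Pair.
Variables (n : nat) (S : {set 'I_n.+1}) (a b c d : nat).
Local Notation w := [:: (setT, (a, b)); (S, (c, d))].
Hypothesis gw : good w.

(** A two-vertex tree is, up to sign, the dual vector of one two-letter word. The sign is that of
    the differential formula times -1, and the same -1 occurs in [face_pair]. *)
Lemma pair_tree (k : 'I_n.+1) (t : 'S_n.+1) (i1 i2 : nat) :
  (2 <= k)%N -> (i1 < k)%N -> (i2 < (n.+1 - k).+1)%N ->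
  (two_vertex_tree (F := tdg K) t (gen_degree k) (gen_degree (n.+1 - k).+1)
    (giota k (gen_basis K k i1)) (giota _ (gen_basis K (n.+1 - k).+1 i2)) : F n.+1) w
  = (-1) ^+ (odd_perm t + (k - 1) * (n.+1 - k + 1))%N *
    - ((t @: block n.+1 k == S) && ((i1 == c) && (i2 == a)))%:R.
Proof.
move=> k2 i1k i2k; have kn := ltn_ord k; set m := (n.+1 - k).+1.
have h : (m + k = n.+2)%N by rewrite /m; lia.
have [ST cS nE ab cd] := good_pair gw.
pose v := giota m (gen_basis K m i2) : F m; pose u := giota k (gen_basis K k i1) : F k.
have uE x : u x = gfun1 (gen_basis K k i1) x by [].
have vE x : v x = gfun1 (gen_basis K m i2) x by [].
rewrite /two_vertex_tree.
set rhs := (X in _ = X).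
change (((-1 : K) ^ (gen_degree k * gen_degree m) *: crelabel (pcmp n.+1 0 v u) t) w = rhs).
rewrite evZ crelabelE {}/rhs.
have gt : good (pull t w) by rewrite good_relabel.
have g := ord_glue h (ord0 : 'I_m) (ltnW k2).
rewrite [pcmp _ _ _ _ _]gcompE //.
have qE : qmap (n := k) n 0 @: setT = block n.+1 k by apply: mem_qblock h _.
have bT : ~~ (setT \subset qmap (n := k) n 0 @: setT).
  apply/negP => /subset_leq_card; rewrite cardsT card_ord (card_imset _ (glue_qI g)) cardsT card_ord; lia.
have -> : (-1) ^ (gen_degree k * gen_degree m) = (-1) ^+ (k * m) :> K.
  rewrite /gen_degree -(signz_sub _ _ (k + m - 2)).
  congr (_ ^ _); have e : ((k + m - 2) * 2)%N%:Z = (k%:Z + m%:Z - 2) * 2.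
    by rewrite PoszM -subzn ?PoszD //; lia.
  rewrite e PoszM; ring.
have tS : (t @: block n.+1 k == S) = (t @^-1: S == block n.+1 k).
  apply/eqP/eqP => [<-|<-]; apply/setP => x; rewrite ?inE.
    by rewrite (mem_imset _ _ (@perm_inj _ t)) inE.
  apply/imsetP/idP => [[y + ->]|xS]; first by rewrite inE.
  by exists ((t^-1)%g x); rewrite ?inE permKV.
rewrite tS -qE.
have lT : pull t w = [:: (setT, (a, b)); (t @^-1: S, (c, d))].
  by rewrite /pull /=; congr [:: (_, _); _]; apply/setP => x; rewrite !inE.
have [E|nE'] := eqVneq (t @^-1: S) (qmap (n := k) n 0 @: setT); last first.
  rewrite andFb mulr0n oppr0 mulr0 lT.
  have [sub|nsub] := boolP (t @^-1: S \subset qmap (n := k) n 0 @: setT); last first.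
    have -> : upp (qmap (n := k) n 0) [:: (setT, (a, b)); (t @^-1: S, (c, d))] = [::].
      by rewrite /upp /= /isblk /= (negbTE bT) (negbTE nsub).
    by rewrite uE /gfun1 if_same !mulr0.
  have eu : upp (qmap (n := k) n 0) [:: (setT, (a, b)); (t @^-1: S, (c, d))] =
      [:: (qmap (n := k) n 0 @^-1: (t @^-1: S), (c, d))].
    by rewrite /upp /= /isblk /= (negbTE bT) sub.
  rewrite eu uE /gfun1.
  case: ifP => [gu|_]; last by rewrite !mulr0.
  have := good_root gu; rewrite card_ord gtn_eqF //= inE => /eqP e.
  by case/eqP: nE'; rewrite -(imset_q sub) -e.
have k1 : k = (c + d).+1 :> nat.
  have := congr1 (fun A : {set 'I_n.+1} => #|A|) E.
  rewrite (card_imset _ (glue_qI g)) cardsT card_ord => <-.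
  by rewrite (card_bij (permK t) (permKV t)).
have gu : good (upp (qmap (n := k) n 0) (pull t w)).
  apply: (good_upp_B (glue_oI g) (glue_qI g) (glue_oB g) (glue_oq g) (glue_card g)) => //.
  by left; rewrite lT -E !inE eqxx orbT.
have [_ gl] := glue_good (glue_oI g) (glue_qI g) (glue_oB g) (glue_oq g) (glue_card g) gt gu.
rewrite lT in gu gl *.
have eu : upp (qmap (n := k) n 0) [:: (setT, (a, b)); (t @^-1: S, (c, d))] =
      [:: (qmap (n := k) n 0 @^-1: (t @^-1: S), (c, d))].
  by rewrite /upp /= /isblk /= (negbTE bT) E subxx.
have el : low (omap (m := m) n k 0) (qmap (n := k) n 0) [:: (setT, (a, b)); (t @^-1: S, (c, d))] =
      [:: (omap (m := m) n k 0 @^-1: setT, (a, b))].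
  by rewrite /low /= /isblk /= (negbTE bT) E subxx.
rewrite /gsign eu el; rewrite eu in gu; rewrite el in gl.
rewrite uE vE /gfun1 gu gl /=.
rewrite !gcoef_basis ?gen_multE //; try by rewrite /m; lia.
rewrite /isblk /= (negbTE bT) E subxx /= ?mul0n ?addn0 muln1.
rewrite (eq_sym i1) (eq_sym i2).
(* The three exponents are the Koszul sign of reordering upper and lower vertex, the sign of [t],
   and the suspension sign (m - 1) times one upper vertex. *)
have sg : (-1) ^+ (k * m) * ((-1) ^+ t * (-1) ^+ (0 + (n.+1 - k))) =
    - (-1) ^+ (t + (k - 1) * (n.+1 - k + 1))%N :> K.
  rewrite -!exprD -[RHS]mulN1r -exprS; apply: signr_parity.
  have -> : (k * m = (k - 1) * (n.+1 - k + 1) + (n.+1 - k) + 1)%N.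
    have H k' l : (0 < k' -> k' * l.+1 = (k' - 1) * (l + 1) + l + 1)%N.
      by case: k' => // k' _; rewrite subn1 /= addn1 mulSn; lia.
    exact: H (ltnW k2).
  rewrite !add0n !oddD /= !oddD; case: (odd (n.+1 - k)); case: (odd (_ * _)); case: (odd t) => //.
rewrite (_ : (a == i2)%:R * _ = ((c == i1) && (a == i2))%:R); last first.
  by rewrite -natrM mulnb andbC.
by rewrite mulrN -mulNr -sg -!mulrA.
Qed.

(** The contracted vertex [S] stands second in the word, whence the minus sign; the first weights
    add up. *)
Lemma face_pair (v : gens K n.+1) : cdiff (giota_fun v) w = - gcoef v (a + c).
Proof.
have [ST _ _ _ _] := good_pair gw.
rewrite cdiffE //= eqxx (negbTE ST) subr0 sub0r; congr (- _).
have gf : good (mkw (contr (val w) S) [:: setT]).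
  by have [] := @good_face _ w S [:: setT] [::] gw erefl ST.
have pS : par (val w) S = setT.
  apply/setP => x; rewrite inE; apply/bigcapP => A /andP[pA].
  have : A \in cl w by rewrite (good_pr gw).
  by rewrite !inE => /orP[] /eqP -> //; rewrite properxx.
rewrite giotaE /gfun1 gf /= /contr (eq_sym setT) (negbTE ST) pS eqxx.
by rewrite (val_uniq (good_uniq gw) (mem_head _ _)) (@val_uniq _ w (S, (c, d)) (good_uniq gw)) // !inE eqxx orbT.
Qed.

End Pair.

(** Exactly one shuffle has [S] as the set of inputs of the upper vertex, so summing over shuffles
    lists each two-vertex tree once. *)
Lemma sum_shuffle n k (S : {set 'I_n}) (B : bool) : (k <= n)%N ->
  \sum_(t : 'S_n | is_shuffle k t) ((t @: block n k == S) && B)%:R = ((k == #|S|) && B)%:R :> K.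
Proof.
move=> kn; case: B; last by rewrite big1 ?andbF // => t _; rewrite andbF.
rewrite andbT; have [E|ne] := eqVneq k #|S|.
  have [t [st tS]] := shuffle_exists (esym E).
  rewrite (bigD1 t) //= tS eqxx big1 ?addr0 // => t' /andP[st' ne]; rewrite andbT.
  case: eqP => // tS'; case/eqP: ne; exact: (shuffle_unique st' st tS' tS).
rewrite big1 // => t _; rewrite andbT; case: eqP => // tS; case/eqP: ne.
by rewrite -tS card_imset ?card_block //; exact: perm_inj.
Qed.

Lemma tree_size n (k : 'I_n) (t : 'S_n) (u : gens K k) (v : gens K (n - k).+1) (w : word 'I_n) :
  good w -> size w != 2%N ->
  (two_vertex_tree (F := tdg K) t (gen_degree k) (gen_degree (n - k).+1)
    (giota k u) (giota _ v) : F n) w = 0.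
Proof.
case: n k t u v w => [|n] k t u v w gw s2; first by have := ltn_ord k; rewrite ltn0.
have kn := ltn_ord k; set m := (n.+1 - k).+1 in v *.
have h : (m + k = n.+2)%N by rewrite /m; lia.
pose v' := giota m v : F m; pose u' := giota k u : F k.
have uE x : u' x = gfun1 u x by [].
have vE x : v' x = gfun1 v x by [].
change (((-1 : K) ^ (gen_degree k * gen_degree m) *: crelabel (pcmp n.+1 0 v' u') t) w = 0).
rewrite evZ crelabelE; have gt : good (pull t w) by rewrite good_relabel.
rewrite [pcmp _ _ _ _ _]gcompE //.
have [//|nz] := eqVneq (u' (upp (qmap (n := k) n 0) (pull t w))) 0.
  by move=> ->; rewrite !mulr0.
have [|nz'] := eqVneq (v' (low (omap (m := m) n k 0) (qmap (n := k) n 0) (pull t w))) 0.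
  by move=> ->; rewrite mul0r !mulr0.
have S1 p (y : gens K p) x : gfun1 y x != 0 -> size x = 1%N.
  by rewrite /gfun1; case: ifP => _; case: x => [|? [|]] //=; rewrite eqxx.
rewrite uE in nz; rewrite vE in nz'; have := size_low_upp (omap (m := m) n k 0) (qmap (n := k) n 0) (pull t w).
rewrite (S1 _ _ _ nz) (S1 _ _ _ nz') size_map => E; by rewrite -E in s2.
Qed.

(** Both sides live on two-letter words, and by antisymmetry the root may be listed first. At such a
    word only the term with k = #|S|, i1 = c, i2 = a and the shuffle of [S] survives. *)
Theorem cdiff_gen n (i : 'I_n) : (2 <= n)%N ->
  diff (tdg K) (giota n (gen_basis K n i)) =
        \sum_(k < n | (2 <= k)%N)
        \sum_(i1 < k) \sum_(i2 < (n - k).+1 | (i1 + i2 == i)%N)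
        \sum_(t : 'S_n | is_shuffle k t)
          (-1) ^+ (odd_perm t + (k - 1) * (n - k + 1))%N *:
          two_vertex_tree (F := tdg K) t (gen_degree k) (gen_degree (n - k).+1)
            (giota k (gen_basis K k i1))
            (giota (n - k).+1 (gen_basis K (n - k).+1 i2)).
Proof.
case: n i => // n i n2.
pose T (k : 'I_n.+1) (i1 : 'I_k) (i2 : 'I_(n.+1 - k).+1) (t : 'S_n.+1) : F n.+1 := two_vertex_tree (F := tdg K) t (gen_degree k) (gen_degree (n.+1 - k).+1)
            (giota k (gen_basis K k i1))
            (giota (n.+1 - k).+1 (gen_basis K (n.+1 - k).+1 i2)).
pose s (k : 'I_n.+1) (t : 'S_n.+1) : K := (-1) ^+ (odd_perm t + (k - 1) * (n.+1 - k + 1))%N.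
have E (w : word 'I_n.+1) : (\sum_(k < n.+1 | (2 <= k)%N)
        \sum_(i1 < k) \sum_(i2 < (n.+1 - k).+1 | (i1 + i2 == i)%N)
        \sum_(t : 'S_n.+1 | is_shuffle k t) s k t *: T k i1 i2 t : F n.+1) w =
   \sum_(k < n.+1 | (2 <= k)%N)
        \sum_(i1 < k) \sum_(i2 < (n.+1 - k).+1 | (i1 + i2 == i)%N)
        \sum_(t : 'S_n.+1 | is_shuffle k t) s k t * T k i1 i2 t w.
  rewrite ev_sum; apply: eq_bigr => k _; rewrite ev_sum; apply: eq_bigr => i1 _.
  by rewrite ev_sum; apply: eq_bigr => i2 _; rewrite ev_sum; apply: eq_bigr => t _; rewrite evZ.
apply: cochain_eq => w gw; rewrite [RHS]E.
change (cdiff (giota_fun (gen_basis K n.+1 i)) w = \sum_(k < n.+1 | (2 <= k)%N)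
        \sum_(i1 < k) \sum_(i2 < (n.+1 - k).+1 | (i1 + i2 == i)%N)
        \sum_(t : 'S_n.+1 | is_shuffle k t) s k t * T k i1 i2 t w).
have [s2|s2] := eqVneq (size w) 2%N; last first.
  rewrite [RHS]big1 => [|k _]; last first.
    by rewrite big1 // => i1 _; rewrite big1 // => i2 _; rewrite big1 // => t _; rewrite [T _ _ _ _ _]tree_size ?mulr0.
  rewrite cdiffE //; apply: Dsum0 => x u v wE; case: ifP => // xT; rewrite giotaE /gfun1.
  case: ifP => // _; have := congr1 size wE; rewrite size_map size_cat /= addnS -size_cat => wS.
  rewrite wS in s2; case: (u ++ v) s2 => [|z [|]] //=.
wlog [S [[a b] [[c d] wE]]] : w gw s2 / exists S u v, w = [:: (setT, u); (S, v)].
  move=> H; have [S [u [v [wE|wE]]]] := good_shape gw s2; first by apply: H => //; exists S, u, v.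
  have gw' : good [:: (setT, u); (S, v)] by rewrite -(@good_cat_swap _ [::]) -wE.
  have H' := H _ gw' erefl (ex_intro _ S (ex_intro _ u (ex_intro _ v erefl))).
  rewrite wE (cochain_antisym (cdiff _) [::]) H' -sumrN; apply: eq_bigr => k _.
  rewrite -sumrN; apply: eq_bigr => i1 _; rewrite -sumrN; apply: eq_bigr => i2 _.
  rewrite -sumrN; apply: eq_bigr => t _; by rewrite [in RHS](cochain_antisym (T _ _ _ _) [::]) mulrN.
rewrite wE in gw *; rewrite face_pair // gcoef_basis ?gen_multE //.
have [ST cS nE ab cd] := good_pair gw; rewrite /= in cS nE ab cd.
have kS : (#|S| < n.+1)%N by rewrite cS; lia.
have ck (k : 'I_n.+1) (i1 : 'I_k) (i2 : 'I_(n.+1 - k).+1) : (2 <= k)%N ->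
    \sum_(t : 'S_n.+1 | is_shuffle k t) s k t * T k i1 i2 t [:: (setT, (a, b)); (S, (c, d))] =
    - ((k == #|S| :> nat) && ((i1 == c :> nat) && (i2 == a :> nat)))%:R.
  move=> k2; rewrite -sum_shuffle ?(ltnW (ltn_ord k)) // -sumrN; apply: eq_bigr => t _.
  by rewrite [T _ _ _ _ _]pair_tree // mulrA -expr2 sqrr_sign mul1r.
pose k0 : 'I_n.+1 := Ordinal kS.
have k02 : (2 <= k0)%N by rewrite /= cS; lia.
have cK : (c < k0)%N by rewrite /= cS; lia.
have aK : (a < (n.+1 - k0).+1)%N by rewrite /= cS; lia.
rewrite (bigD1 k0) //= [X in _ = _ + X]big1 ?addr0 => [|k /andP[k2 ne]]; last first.
  rewrite big1 // => i1 _; rewrite big1 // => i2 _; rewrite ck //.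
  by rewrite (negbTE (_ : k != #|S| :> nat)) ?oppr0 //; apply: contra ne => /eqP e; apply/eqP/ord_inj.
rewrite (bigD1 (Ordinal cK)) //= [X in _ = _ + X]big1 ?addr0 => [|i1 ne]; last first.
  rewrite big1 // => i2 _; rewrite [LHS](ck k0 i1 i2 k02) (negbTE (_ : i1 != c :> nat)) ?andbF ?oppr0 //.
rewrite big_mkcond (bigD1 (Ordinal aK)) //= [X in _ = _ + X]big1 ?addr0 => [|i2 ne]; last first.
  case: ifP => // _; rewrite [LHS](ck k0 _ i2 k02) (negbTE (_ : i2 != a :> nat)) ?andbF ?oppr0 //.
rewrite [X in _ = if _ then X else _](ck k0 _ _ k02) /= !eqxx addnC eq_sym.
by case: eqP => // _; rewrite oppr0.
Qed.

End Generators.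

(** * Freeness *)

Section Basic.
Variables (K : fieldType) (X : finType).
Implicit Types (a b : cochain K X) (w : word X).

(* [a] is, up to sign, the dual basis vector of one tree. *)
Definition basic a := exists w, [/\ good w, exists e : bool, a w = (-1) ^+ e
  & forall w', a w' != 0 -> perm_eq w w'].

Lemma ev_good a w : a w != 0 -> good w.
Proof. by apply: contraNT => /(cochain_supp a) ->. Qed.

Lemma basic_sign a w : basic a -> a w != 0 -> exists e : bool, a w = (-1) ^+ e.
Proof.
move=> [w0 [_ [e ae] h]] /h /antisym_perm -/(_ K) [e' /(_ a (@cochain_antisym _ _ a))].
by rewrite ae -signr_addb; exists (e' (+) e).
Qed.

Lemma basic_perm a w w' : basic a -> a w != 0 -> a w' != 0 -> perm_eq w w'.
Proof.
by move=> [w0 [_ _ h]] /h p1 /h p2; rewrite (perm_trans _ p2) // perm_sym.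
Qed.

Lemma basic_eq a b w : basic a -> basic b -> a w != 0 -> b w != 0 -> a = (a w * b w) *: b.
Proof.
move=> ba bb aw bw; have [e bwE] := basic_sign bb bw.
apply: cochain_eq => x _; rewrite evZ; have [pw|np] := boolP (perm_eq w x).
  have [e' h] := antisym_perm K pw; rewrite !h; try exact: cochain_antisym.
  by rewrite mulrCA -(mulrA (a w)) bwE -expr2 sqrr_sign mulr1.
have z c : basic c -> c w != 0 -> c x = 0 by move=> bc cw; apply: contraNeq np; exact: basic_perm.
by rewrite !z // mulr0.
Qed.

Lemma basicN a : basic a -> basic (- a).
Proof.
move=> [w [gw [e ae] h]]; exists w; split=> // [|w']; last by rewrite evN oppr_eq0; exact: h.
by exists (~~ e); rewrite evN ae signrN.
Qed.

Lemma basic_neq0 a : basic a -> exists w, a w != 0.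
Proof. by move=> [w [_ [e ae] _]]; exists w; rewrite ae signr_eq0. Qed.

End Basic.

(** * Gluing words and splitting permutations *)

Section Join.
Variables (K : fieldType) (U V Y : finType) (o : U -> Y) (q : V -> Y) (i : U).
Hypothesis g : glue o q i.
Local Notation B := (q @: setT).

Definition lift_low (S : {set U}) : {set Y} := o @: S :|: (if i \in S then B else set0).

Definition join (w1 : word U) (w2 : word V) : word Y :=
  [seq (lift_low l.1, l.2) | l : {set U} * (nat * nat) <- w1] ++
  [seq (q @: l.1, l.2) | l : {set V} * (nat * nat) <- w2].

Lemma lift_lowK S : o @^-1: lift_low S = S.
Proof.
apply/setP => j; rewrite !inE (mem_imset _ _ (glue_oI g)).
case: (boolP (j \in S)) => //= jS; case: ifP => iS; rewrite ?inE // (glue_oB g).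
by apply/negbTE; apply: contraNneq jS => ->.
Qed.

Lemma lift_low_lowt S : lowt q (lift_low S).
Proof.
rewrite /lowt /lift_low; case: ifP => iS; first by rewrite subsetUr.
rewrite setU0; apply/orP; right; rewrite disjoint_subset; apply/subsetP => y /imsetP[j jS ->].
rewrite inE (glue_oB g); by apply: contraFneq iS => <-.
Qed.

Lemma lift_low_nblk (S : {set U}) : (1 < #|S|)%N -> lift_low S \subset B = false.
Proof.
move=> S1; apply/negbTE; apply: contraL S1 => h; rewrite -leqNgt.
rewrite -(cards1 i); apply/subset_leq_card/subsetP => j jS; rewrite inE -(glue_oB g).
by apply: (subsetP h); rewrite inE imset_f.
Qed.

Lemma low_join w1 w2 : good w1 -> low o q (join w1 w2) = w1.
Proof.
move=> gw; rewrite /low filter_cat (eq_in_filter (a2 := predT)); last first.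
  move=> l /mapP[l' lw ->]; rewrite /isblk /= lift_low_nblk //.
  by apply: (good_gt1 gw); exact: map_f.
rewrite filter_predT (eq_in_filter (a2 := pred0)); last first.
  by move=> l /mapP[l' lw ->]; rewrite /isblk /= imsetS ?subsetT.
rewrite filter_pred0 cats0 /pull -map_comp map_id_in // => l _ /=.
by rewrite lift_lowK -surjective_pairing.
Qed.

Lemma upp_join w1 w2 : good w1 -> upp q (join w1 w2) = w2.
Proof.
move=> gw; rewrite /upp filter_cat (eq_in_filter (a2 := pred0)); last first.
  move=> l /mapP[l' lw ->]; rewrite /isblk /= lift_low_nblk //.
  by apply: (good_gt1 gw); exact: map_f.
rewrite filter_pred0 (eq_in_filter (a2 := predT)); last first.
  by move=> l /mapP[l' lw ->]; rewrite /isblk /= imsetS ?subsetT.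
rewrite filter_predT /pull -map_comp map_id_in // => l _ /=.
rewrite (_ : q @^-1: _ = l.1) -?surjective_pairing //.
by apply/setP => j; rewrite inE (mem_imset _ _ (glue_qI g)).
Qed.

Lemma join_sat w1 w2 : all (fun l => sat q l.1) (join w1 w2).
Proof.
rewrite all_cat; apply/andP; split; apply/allP => l /mapP[l' _ ->] /=; first by rewrite /sat -[X in _ || X]/(lowt q _) lift_low_lowt orbT.
by rewrite /sat imsetS ?subsetT.
Qed.

Lemma good_join w1 w2 : good w1 -> good w2 -> good (join w1 w2).
Proof.
move=> g1 g2; have := good_glue (glue_oI g) (glue_qI g) (glue_oB g) (glue_oq g) (join w1 w2) (glue_card g).
by rewrite join_sat low_join // upp_join // g1 g2 => /andP[].
Qed.

Lemma join_low_upp w : all (fun l => sat q l.1) w -> perm_eq (join (low o q w) (upp q w)) w.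
Proof.
move=> sw; rewrite perm_sym -(perm_filterC (predC (isblk q)) w) perm_sym /join /low /upp /pull -!map_comp.
rewrite [X in perm_eq (X ++ _)]map_id_in; last first.
  move=> l; rewrite mem_filter => /andP[lB lw] /=.
  have lt : lowt q l.1 by apply: lowtP => //; have /allP := sw; apply.
  rewrite [RHS]surjective_pairing; congr (_, _); apply: (o_inj (i := i) (glue_oB g) (glue_oq g)) => //.
    exact: lift_low_lowt.
  exact: lift_lowK.
rewrite [X in perm_eq (_ ++ X)]map_id_in; last first.
  by move=> l; rewrite mem_filter => /andP[lB lw] /=; rewrite imset_q // -surjective_pairing.
by rewrite perm_cat2l (eq_filter (a2 := isblk q)) // => l /=; rewrite negbK.
Qed.

Lemma join_perm w1 w1' w2 w2' : perm_eq w1 w1' -> perm_eq w2 w2' ->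
  perm_eq (join w1 w2) (join w1' w2').
Proof. by move=> p1 p2; apply: perm_cat; apply: perm_map. Qed.

Variables e f : nat.

Lemma gcomp_neq0 (a : cochain K U) (b : cochain K V) w : gcomp o q e f a b w != 0 ->
  [/\ good w, all (fun l => sat q l.1) w, a (low o q w) != 0, b (upp q w) != 0 &
      gcomp o q e f a b w = (-1) ^+ gsign q e f w * (a (low o q w) * b (upp q w))].
Proof.
move=> nz; have gw := ev_good nz; have := nz; rewrite gcompE // !mulf_eq0 !negb_or => /and3P[_ na nb]; split=> //; rewrite -?gcompE //.
by have [] := glue_good (glue_oI g) (glue_qI g) (glue_oB g) (glue_oq g) (glue_card g) gw (ev_good nb).
Qed.

Lemma gcomp_basic (a : cochain K U) (b : cochain K V) : basic a -> basic b -> basic (gcomp o q e f a b).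
Proof.
move=> ba bb; have [w1 [g1 [e1 a1] h1]] := ba; have [w2 [g2 [e2 b2] h2]] := bb.
have gj := good_join g1 g2; exists (join w1 w2); split=> // [|w' /gcomp_neq0[gw sw /h1 p1 /h2 p2 _]].
  rewrite gcompE // low_join // upp_join // a1 b2 -!exprD -signr_odd.
  by eexists; reflexivity.
by rewrite (perm_trans (join_perm p1 p2)) // join_low_upp.
Qed.

End Join.

Lemma perm_choice (T : finType) (R : T -> T -> Prop) :
  (forall x, exists y, R x y) -> (forall x x' y, R x y -> R x' y -> x = x') ->
  exists s : {perm T}, forall x, R x (s x).
Proof.
move=> /choice[f fR] Ri; have fI : injective f.
  by move=> x x' E; apply: (Ri _ _ (f x)) => //; rewrite E.
by exists (perm fI) => x; rewrite permE.
Qed.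

Lemma block_perm n k (S : {set 'I_n}) : #|S| = k ->
  exists s : 'S_n, forall u, (s u \in S) = (u < k)%N.
Proof.
move=> /shuffle_exists[s [_ <-]]; exists s => u.
by rewrite (mem_imset _ _ (@perm_inj _ s)) inE.
Qed.

Section Induced.
Variables (m n p : nat) (h : (m + n = p.+2)%N) (n0 : (0 < n)%N).

(* [r] permutes the inputs of a composite as [s] and [t] permute those of its factors. *)
Definition induced (i : 'I_m) (s : 'S_m) (t : 'S_n) (r : 'S_p.+1) :=
  (forall j, j != i -> r (omap p n i j) = omap p n (s i) (s j)) /\
  (forall j, r (qmap p i j) = qmap p (s i) (t j)).

Lemma induced_exists i s t : exists r, induced i s t r.
Proof.
have g := ord_glue h i n0; have g' := ord_glue h (s i) n0.
pose R u y := (exists j, [/\ j != i, u = omap p n i j & y = omap p n (s i) (s j)]) \/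
  (exists j, u = qmap p i j /\ y = qmap p (s i) (t j)).
have qB (j : 'I_n) : qmap p i j \in qmap (n := n) p i @: setT by rewrite imset_f.
have qB' (j : 'I_n) : qmap p (s i) j \in qmap (n := n) p (s i) @: setT by rewrite imset_f.
have E : forall x x' y, R x y -> R x' y -> x = x'.
  move=> x x' y [[j [ji -> ->]]|[j [-> ->]]] [[j' [ji' -> ]]|[j' [-> ]]] e.
  - by rewrite (perm_inj (glue_oI g' e)).
  - by have := qB' (t j'); rewrite -e (glue_oB g') (inj_eq (@perm_inj _ s)) (negbTE ji).
  - by have := qB' (t j); rewrite e (glue_oB g') (inj_eq (@perm_inj _ s)) (negbTE ji').
  - by rewrite (perm_inj (glue_qI g' e)).
have [|r rR] := @perm_choice _ R _ E.
  move=> u; have [/imsetP[j _ ->]|uB] := boolP (u \in qmap (n := n) p i @: setT).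
    by exists (qmap p (s i) (t j)); right; exists j.
  case: (glue_oq g u) => [uB'|[j uE]]; first by rewrite uB' in uB.
  by exists (omap p n (s i) (s j)); left; exists j; rewrite -(glue_oB g) -uE.
exists r; split=> [j ji|j].
  case: (rR (omap p n i j)) => [[j' [_ /(glue_oI g) -> ->]] //|[j' [e _]]].
  by have := qB j'; rewrite -e (glue_oB g) (negbTE ji).
case: (rR (qmap p i j)) => [[j' [ji' e _]]|[j' [/(glue_qI g) -> ->]] //].
by have := qB j; rewrite e (glue_oB g) (negbTE ji').
Qed.

Lemma induced_act (K : fieldType) (Q : operad K) (a : Q m) (b : Q n) i s t r : induced i s t r ->
  Defs.pcomp h (s i) (relabel a s) (relabel b t) = relabel (Defs.pcomp h i a b) r.
Proof.
move=> [r1 r2]; apply: Defs.comp_act => j u.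
  move=> ji uE; rewrite -(omapE h) // -r1 //; congr (nat_of_ord (r _)).
  by apply: ord_inj; rewrite (omapE h).
move=> uE; rewrite -(qmapE h) -r2; congr (nat_of_ord (r _)).
by apply: ord_inj; rewrite (qmapE h).
Qed.

(** Converse of [induced_exists]: a permutation carrying the block at [i0] to the block at [i]
    permutes the factors separately. It lets a composite at any input be rewritten as one at input
    0. *)
Lemma induced_split (i0 i : 'I_m) (r : 'S_p.+1) :
  (forall u, (i <= r u < i + n)%N = (i0 <= u < i0 + n)%N) ->
  exists (s : 'S_m) (t : 'S_n), s i0 = i /\ induced i0 s t r.
Proof.
move=> hr; have g := ord_glue h i n0; have g0 := ord_glue h i0 n0.
have rB u : (r u \in qmap (n := n) p i @: setT) = (u \in qmap (n := n) p i0 @: setT).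
  by rewrite !(mem_block h).
have [t tE] : exists t : 'S_n, forall j, r (qmap p i0 j) = qmap p i (t j).
  apply: (@perm_choice _ (fun j v => r (qmap p i0 j) = qmap p i v)) => [j|j j' v <- /perm_inj/(glue_qI g0) ->] //.
  have : r (qmap p i0 j) \in qmap (n := n) p i @: setT by rewrite rB imset_f.
  by move=> /imsetP[v _ ->]; exists v.
have [s sE] : exists s : 'S_m, forall j, if j == i0 then s j = i else r (omap p n i0 j) = omap p n i (s j).
  apply: (@perm_choice _ (fun j v => if j == i0 then v = i else r (omap p n i0 j) = omap p n i v)).
    move=> j; case: (boolP (j == i0)) => ji; first by exists i.
    case: (glue_oq g (r (omap p n i0 j))) => // rj.
    by move: rj; rewrite rB (glue_oB g0) (negbTE ji).
  move=> j j' v; case: eqP => [->|/eqP ji]; case: eqP => [-> //|/eqP ji'] e e'.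
  - by have := glue_oB g v; rewrite -e' rB (glue_oB g0) e eqxx (negbTE ji').
  - by have := glue_oB g v; rewrite -e rB (glue_oB g0) e' eqxx (negbTE ji).
  - by apply: (glue_oI g0); apply: (@perm_inj _ r); rewrite e e'.
have si : s i0 = i by have := sE i0; rewrite eqxx.
exists s, t; split=> //; split=> [j /negbTE ji|j]; rewrite si //.
by have := sE j; rewrite ji.
Qed.

End Induced.

(** * Trees built from generators together with their values *)

Section TreePairs.
Variables (K : fieldType) (P : operad K) (g : forall n, {linear gens K n -> P n}).
Hypothesis gM : is_smodule_morphism g.
Local Notation T := (toperad K).
Local Notation F n := (cochain K 'I_n).
Implicit Types m n p q r k : nat.

(* The pairs consisting of a tree built from the generators and its value in P,
   up to sign; freeness amounts to this being the graph of a function. *)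
Inductive mon : forall n, T n -> P n -> Prop :=
| mon_unit : mon (unit_op T) (unit_op P)
| mon_gen n (i : 'I_n) : (2 <= n)%N -> mon (giota K n (gen_basis K n i)) (g n (gen_basis K n i))
| mon_opp n (c : T n) x : mon c x -> mon (- c) (- x)
| mon_comp m n p (h : (m + n = p.+1)%N) (i : 'I_m) (a : T m) x (b : T n) y :
    mon a x -> mon b y -> mon (Defs.pcomp h i a b) (Defs.pcomp h i x y)
| mon_act n (c : T n) x (s : 'S_n) : mon c x -> mon (relabel c s) (relabel x s).

Lemma gen_basis_homog n i : homog (gen_degree n) (gen_basis K n i).
Proof. by left; rewrite /gen_degree; lia. Qed.

Lemma mon_homog n (c : T n) x : mon c x -> exists d, homog d c /\ homog d x.
Proof.
elim=> [|m i m2|m c' x' _ [d [hc hx]]|m l p h i a x' b y _ [d [ha hx]] _ [e [hb hy]]|m c' x' s _ [d [hc hx]]].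
- by exists 0; split; exact: unit_homog.
- exists (gen_degree m); split; first exact: (giota_morphism K).1 (gen_basis_homog _ _).
  exact: gM.1 (gen_basis_homog _ _).
- exists d; split; rewrite -[X in homog _ X]addr0 -scaleN1r; apply: homog_linear => //; exact: homog0.
- by exists (d + e); split; exact: comp_homog.
- by exists d; split; exact: act_homog.
Qed.

Lemma mon_gt0 n (c : T n) x : mon c x -> (0 < n)%N.
Proof.
elim=> //= [m i|m l p h _ _ _ _ _ _ m0 _ l0]; [exact: ltnW | lia].
Qed.

Lemma mon_sign n (c : T n) x (e : bool) : mon c x -> mon ((-1) ^+ e *: c) ((-1) ^+ e *: x).
Proof.
by case: e => m; rewrite ?expr0 ?expr1 ?scale1r ?scaleN1r //; exact: mon_opp.
Qed.

Lemma crelabel_basic n (c : F n) (s : 'S_n) : basic c -> basic (crelabel c s).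
Proof.
move=> [w [gw [e cE] h]]; exists (pull (s^-1)%g w).
have sK : pull s (pull (s^-1)%g w) = w.
  by rewrite pull_pull (@eq_pull _ _ _ id) ?pull_id // => x /=; rewrite permK.
split=> [||w']; first by rewrite good_relabel.
  by exists (s (+) e); rewrite crelabelE sK cE signr_addb.
rewrite crelabelE mulf_eq0 signr_eq0 /= => /h /(perm_map (fun l : {set 'I_n} * (nat * nat) => ((s^-1)%g @^-1: l.1, l.2))).
move=> /perm_trans -> //; rewrite -/(pull _ _) pull_pull (@eq_pull _ _ _ id) ?pull_id // => x /=.
by rewrite permKV.
Qed.

Lemma good_nil1 n : good ([::] : word 'I_n) = (n == 1%N).
Proof. by rewrite /good /= card_ord orbF. Qed.

Lemma cunit_basic : basic (cunit K).
Proof.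
exists [::]; split=> [|| w']; first by rewrite good_nil1.
  by exists false; rewrite cunitE.
by rewrite cunitE; case: w' => //=; rewrite eqxx.
Qed.

Lemma good_corolla n (l : {set 'I_n} * (nat * nat)) : (2 <= n)%N ->
  good [:: l] = (l == (setT, (l.2.1, (n.-1 - l.2.1)%N))) && (l.2.1 < n)%N.
Proof.
move=> n2; case: l => S [a b]; rewrite /good /= /lam subxx card_ord (gtn_eqF n2) /= !andbT inE.
rewrite /csum big_cons big_nil /= subxx addn0 [setT == S]eq_sym xpair_eqE.
have [->|_] := eqVneq S setT; last by rewrite !andbF.
rewrite cardsT card_ord xpair_eqE eqxx /= /wt /=.
by apply/idP/idP; lia.
Qed.

Lemma giota_basisE n (i : 'I_n) l : (2 <= n)%N -> good [:: l] ->
  giota_fun (gen_basis K n i) [:: l] = (i == l.2.1 :> nat)%:R.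
Proof. by move=> n2 gl; rewrite giotaE /gfun1 gl gcoef_basis // gen_multE. Qed.

Lemma giota_basic n (i : 'I_n) : (2 <= n)%N -> basic (giota_fun (gen_basis K n i)).
Proof.
move=> n2; have gl : good [:: (setT : {set 'I_n}, (nat_of_ord i, (n.-1 - i)%N))].
  by rewrite good_corolla //= eqxx ltn_ord.
exists [:: (setT, (nat_of_ord i, (n.-1 - i)%N))]; split=> //.
  by exists false; rewrite giota_basisE // eqxx.
move=> w' nz; have gw := ev_good nz; case: w' gw nz => [|l [|l' w]] gw; rewrite ?giotaE /gfun1 ?gw ?eqxx //.
rewrite gcoef_basis ?gen_multE //; have := gw; rewrite good_corolla // => /andP[/eqP lE _].
have [e _|] := eqVneq (nat_of_ord i) l.2.1; [by rewrite lE -e | by rewrite eqxx].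
Qed.

Lemma pcomp_neq0 m n p (h : (m + n = p.+2)%N) (i : 'I_m) (a : F m) (b : F n) w : (0 < n)%N ->
  pcomp_F h i a b w != 0 ->
  [/\ good w, all (fun l => sat (qmap (n := n) p i) l.1) w,
     a (low (omap (m := m) p n i) (qmap (n := n) p i) w) != 0 & b (upp (qmap (n := n) p i) w) != 0].
Proof. by move=> n0 /(gcomp_neq0 (ord_glue h i n0))[]. Qed.

Lemma mon_basic n (c : T n) x : mon c x -> basic (c : F n).
Proof.
elim=> [|m i m2|m c' x' _ bc|m l p h i a x' b y ma ba mb bb|m c' x' s _ bc].
- exact: cunit_basic.
- exact: giota_basic.
- exact: basicN.
- have l0 := mon_gt0 mb; have m0 := mon_gt0 ma; case: p h => [|p] h; first by lia.
  exact: (gcomp_basic (ord_glue h i l0)).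
- exact: crelabel_basic.
Qed.

End TreePairs.

Lemma signz_bool (K : fieldType) (d : int) : exists e : bool, (-1 : K) ^ d = (-1) ^+ e.
Proof.
case: d => d; [exists (odd d) | exists (odd d.+1)]; rewrite signr_odd //.
exact: invr_sign.
Qed.

Section OperadIdentities.
Variables (K : fieldType) (Q : operad K).
Implicit Types m n p q k l : nat.

Lemma relabelK n (a : Q n) (s : 'S_n) : relabel (relabel a s^-1) s = a.
Proof. by rewrite Defs.actM mulVg Defs.act1. Qed.

Lemma pcomp_relabelr m n p (h : (m + n = p.+2)%N) (n0 : (0 < n)%N) (i : 'I_m) (a : Q m) (b : Q n)
    (t : 'S_n) (r : 'S_p.+1) : induced i (1%g : 'S_m) t r ->
  Defs.pcomp h i a (relabel b t) = relabel (Defs.pcomp h i a b) r.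
Proof. by move=> /(induced_act h n0 a b); rewrite Defs.act1 perm1. Qed.

Lemma pcomp_relabell m n p (h : (m + n = p.+2)%N) (n0 : (0 < n)%N) (i : 'I_m) (a : Q m) (b : Q n)
    (s : 'S_m) (r : 'S_p.+1) : induced i s (1%g : 'S_n) r ->
  Defs.pcomp h (s i) (relabel a s) b = relabel (Defs.pcomp h i a b) r.
Proof. by move=> /(induced_act h n0 a b); rewrite Defs.act1. Qed.

End OperadIdentities.

(** * Cutting a construction at a prescribed inner edge *)

Section Decomposition.
Variables (K : fieldType) (P : operad K) (g : forall n, {linear gens K n -> P n}).
Hypothesis gM : is_smodule_morphism g.
Local Notation T := (toperad K).
Local Notation F n := (cochain K 'I_n).
Local Notation mon := (mon g).
Implicit Types m n p q k l : nat.

(** A simultaneous cut of the tree and of its value. The upper factor sits at input 0, and [s]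
    carries its inputs, the first [k], to the leaves of the cluster at which the cut is made. *)
Definition dec m k p (h : (m.+1 + k = p.+1)%N) (s : 'S_p) (c : T p) (x : P p) :=
  exists (a : T m.+1) y (b : T k) z, [/\ mon a y, mon b z,
    c = relabel (Defs.pcomp h ord0 a b) s & x = relabel (Defs.pcomp h ord0 y z) s].

Lemma relabelN (Q : operad K) n (a : Q n) (s : 'S_n) : relabel (- a) s = - relabel a s.
Proof. by have := act_linear s (-1) a 0; rewrite act0 !addr0 !scaleN1r. Qed.

Lemma compNl (Q : operad K) m n p (h : (m + n = p.+1)%N) i (a : Q m) (b : Q n) :
  Defs.pcomp h i (- a) b = - Defs.pcomp h i a b.
Proof. by have := comp_linearl h i b (-1) a 0; rewrite comp0l !addr0 !scaleN1r. Qed.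

Lemma dec_opp m k p (h : (m.+1 + k = p.+1)%N) (s : 'S_p) c x : dec h s c x -> dec h s (- c) (- x).
Proof.
move=> [a [y [b [z [ma mb -> ->]]]]]; exists (- a), (- y), b, z.
by rewrite !compNl !relabelN; split=> //; exact: mon_opp.
Qed.

Lemma dec_sign m k p (h : (m.+1 + k = p.+1)%N) (s : 'S_p) c x (e : bool) :
  dec h s c x -> dec h s ((-1) ^+ e *: c) ((-1) ^+ e *: x).
Proof. by case: e => m'; rewrite ?expr0 ?expr1 ?scale1r ?scaleN1r //; exact: dec_opp. Qed.

(** Here the cut is already the outermost composition; only its input and the permutation are
    normalised, through [induced_split]. *)
Lemma dec_comp m n p (h : (m.+1 + n = p.+2)%N) (i : 'I_m.+1) (a : T m.+1) y (b : T n) z (r s : 'S_p.+1) :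
  mon a y -> mon b z -> (forall u v, r v = s u -> (i <= v < i + n)%N = (u < n)%N) ->
  dec h s (relabel (Defs.pcomp h i a b) r) (relabel (Defs.pcomp h i y z) r).
Proof.
move=> ma mb hr; have n0 := mon_gt0 mb.
have hs u : (i <= (s * r^-1)%g u < i + n)%N = (@ord0 m <= u < @ord0 m + n)%N.
  by rewrite (hr u) // permM permKV.
have [s1 [t1 [s1i ind]]] := induced_split h n0 hs.
exists (relabel a s1^-1), (relabel y s1^-1), (relabel b t1^-1), (relabel z t1^-1).
have E (Q : operad K) (a' : Q m.+1) (b' : Q n) : relabel (Defs.pcomp h i a' b') r =
    relabel (Defs.pcomp h ord0 (relabel a' s1^-1) (relabel b' t1^-1)) s.
  rewrite -{1}(relabelK a' s1) -{1}(relabelK b' t1) -{1}s1i (induced_act h n0 _ _ ind).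
  by rewrite Defs.actM mulgKV.
by split; rewrite ?E //; exact: mon_act.
Qed.


Section Graft.
Variables (m n p : nat) (h' : (m + n = p.+2)%N) (i : 'I_m) (a : T m) (y : P m) (b : T n) (z : P n).
Hypotheses (ma : mon a y) (mb : mon b z).
Let n0 : (0 < n)%N. Proof. exact: mon_gt0 mb. Qed.
Let gg := ord_glue h' i n0.
Local Notation B := (qmap (n := n) p i @: setT).
Variables (S : {set 'I_p.+1}) (m0 k : nat) (h : (m0.+1 + k = p.+2)%N) (s : 'S_p.+1).
Hypothesis sS : forall u, (s u \in S) = (u < k)%N.

(** First of the four positions of [S] relative to the block [B] of the last grafting: the desired
    cut is this grafting. *)
Lemma dec_block : S = B -> dec h s (Defs.pcomp h' i a b : T p.+1) (Defs.pcomp h' i y z).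
Proof.
move=> SB; have kn : k = n.
  have : #|s @^-1: S| = #|block p.+1 k| by apply: eq_card => u; rewrite !inE sS.
  rewrite card_block; last by lia.
  by rewrite (card_bij (permK s) (permKV s)) SB (card_imset _ (glue_qI gg)) cardsT card_ord.
clear gg; have mm : m = m0.+1 by lia.
subst k m; rewrite (eq_irrelevance h h') -[Defs.pcomp h' i a b]Defs.act1 -[Defs.pcomp h' i y z]Defs.act1.
apply: dec_comp => // u v; rewrite perm1 => vE.
by rewrite -sS -vE SB (mem_block h').
Qed.

(** The upper factor is cut at [S], and sequential associativity moves the lower half of [b] into
    the lower factor. *)
Lemma dec_upp m1 (hb : (m1.+1 + k = n.+1)%N) (s2 : 'S_n) : S \subset B -> dec hb s2 b z ->
  (forall j, (qmap p i (s2 j) \in S) = (j < k)%N) ->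
  dec h s (Defs.pcomp h' i a b : T p.+1) (Defs.pcomp h' i y z).
Proof.
move=> SB [b1 [z1 [b2 [z2 [mb1 mb2 bE zE]]]]] hs2.
have [r ind] := induced_exists h' n0 i 1%g s2.
have hab : (m + m1.+1 = m0.+2)%N by lia.
have xlt : (i < m0.+1)%N by have := ltn_ord i; lia.
have E (Q : operad K) (a' : Q m) (c1 : Q m1.+1) (c2 : Q k) :
    Defs.pcomp h' i a' (relabel (Defs.pcomp hb ord0 c1 c2) s2) =
    relabel (Defs.pcomp h (Ordinal xlt) (Defs.pcomp hab i a' c1) c2) r.
  rewrite (pcomp_relabelr h' n0 _ _ ind) (@Defs.comp_seq _ Q _ _ _ _ _ _ hab h hb h' i ord0) //=.
  by rewrite addn0.
rewrite bE zE !E; apply: dec_comp => //; first exact: mon_comp.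
move=> u v vE /=; rewrite -sS -vE.
have [/imsetP[j _ ->]|vB] := boolP (v \in B).
  by rewrite ind.2 perm1 hs2 (qmapE h') leq_addr ltn_add2l.
case: (glue_oq gg v) => [vB'|[j vj]]; first by rewrite vB' in vB.
rewrite vj in vB *.
rewrite (glue_oB gg) in vB; rewrite ind.1 // !perm1.
have nB : omap p n i j \notin B by rewrite (glue_oB gg).
have -> : omap p n i j \in S = false by apply: contraNF nB; exact: (subsetP SB).
have kn : (k <= n)%N by lia.
by apply: contraNF nB; rewrite (mem_block h') => /andP[-> /leq_trans]; apply; rewrite leq_add2l.
Qed.

(** The lower factor is cut, and since [S] contains the block, [b] is grafted onto the upper half of
    that cut. *)
Lemma dec_low_in k' (ha : (m0.+1 + k' = m.+1)%N) (s1 : 'S_m) : B \subset S -> dec ha s1 a y ->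
  (forall j, (omap p n i (s1 j) \in S) = (j < k')%N) ->
  dec h s (Defs.pcomp h' i a b : T p.+1) (Defs.pcomp h' i y z).
Proof.
move=> BS [a1 [y1 [a2 [y2 [ma1 ma2 aE yE]]]]] hs1; pose i' := (s1^-1)%g i.
have [r ind] := induced_exists h' n0 i' s1 1%g.
have s1i : s1 i' = i by rewrite permKV.
have i'k : (i' < k')%N by rewrite -hs1 s1i (subsetP BS) // (glue_oB gg).
have hbc : (k' + n = k.+1)%N by lia.
have E (Q : operad K) (c : Q n) (a1' : Q m0.+1) (a2' : Q k') :
    Defs.pcomp h' i (relabel (Defs.pcomp ha ord0 a1' a2') s1) c =
    relabel (Defs.pcomp h ord0 a1' (Defs.pcomp hbc (Ordinal i'k) a2' c)) r.
  rewrite -{1}s1i (pcomp_relabell h' n0 _ _ ind).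
  by rewrite (@Defs.comp_seq _ Q _ _ _ _ _ _ ha h' hbc h ord0 (Ordinal i'k)).
rewrite aE yE !E; apply: dec_comp => //; first exact: mon_comp.
move=> u v vE /=; rewrite -sS -vE ?add0n /=.
have gi := ord_glue h' i' n0.
have [/imsetP[j _ ->]|vB] := boolP (v \in qmap (n := n) p i' @: setT).
  rewrite ind.2 perm1 s1i (subsetP BS) ?imset_f // (qmapE h').
  by have := ltn_ord j; lia.
case: (glue_oq gi v) => [vB'|[j vj]]; first by rewrite vB' in vB.
rewrite vj in vB *.
rewrite (glue_oB gi) in vB; rewrite ind.1 // s1i hs1 (omapE h') // /outer_pos.
have : j != i' :> nat by []; case: ifP => ? ne; lia.
Qed.

(** For disjoint [S] and [B] the two graftings are exchanged by parallel associativity. Its Koszul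
    sign is the same in both operads because a tree and its value have a common degree. *)
Lemma dec_low_out m1 (ha : (m1.+1 + k = m.+1)%N) (s1 : 'S_m) : [disjoint S & B] -> dec ha s1 a y ->
  (forall j, (omap p n i (s1 j) \in S) = (j < k)%N) ->
  dec h s (Defs.pcomp h' i a b : T p.+1) (Defs.pcomp h' i y z).
Proof.
move=> dSB [a1 [y1 [a2 [y2 [ma1 ma2 aE yE]]]]] hs1; pose i' := (s1^-1)%g i.
have [r ind] := induced_exists h' n0 i' s1 1%g.
have s1i : s1 i' = i by rewrite permKV.
have ki' : (k <= i')%N.
  rewrite leqNgt -hs1 s1i (disjointFl dSB) // (glue_oB gg) //.
have k0 := mon_gt0 ma2; have i'm := ltn_ord i'.
have hac : (m1.+1 + n = m0.+2)%N by lia.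
have klt : (i' - k + 1 < m1.+1)%N by lia.
have [d2 [h2 h2']] := mon_homog gM ma2; have [db [hb hb']] := mon_homog gM mb.
have [e eE] := signz_bool K (d2 * db).
have E (Q : operad K) (c : Q n) (a1' : Q m1.+1) (a2' : Q k) : homog d2 a2' -> homog db c ->
    Defs.pcomp h' i (relabel (Defs.pcomp ha ord0 a1' a2') s1) c =
    (-1) ^+ e *: relabel (Defs.pcomp h ord0 (Defs.pcomp hac (Ordinal klt) a1' c) a2') r.
  move=> ho2 hoc; rewrite -{1}s1i (pcomp_relabell h' n0 _ _ ind).
  rewrite (@Defs.comp_par _ Q _ _ _ _ _ _ ha h' hac h ord0 (Ordinal klt) i' ord0 d2 db) //=; try lia.
    rewrite eE; have := act_linear r ((-1) ^+ e) (Defs.pcomp h ord0 (Defs.pcomp hac (Ordinal klt) a1' c) a2') 0.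
    by rewrite Defs.act0 !addr0.
    by rewrite /outer_pos ltn0; lia.
  by rewrite /outer_pos addn1.
rewrite aE yE !E //; apply: dec_sign; apply: dec_comp => //; first exact: mon_comp.
move=> u v vE /=; rewrite -sS -vE ?add0n /=.
have gi := ord_glue h' i' n0.
have [/imsetP[j _ ->]|vB] := boolP (v \in qmap (n := n) p i' @: setT).
  rewrite ind.2 perm1 s1i (disjointFl dSB) ?imset_f // (qmapE h').
  by apply/negbTE; lia.
case: (glue_oq gi v) => [vB'|[j vj]]; first by rewrite vB' in vB.
rewrite vj in vB *.
rewrite (glue_oB gi) in vB; rewrite ind.1 // s1i hs1 (omapE h') // /outer_pos.
have : j != i' :> nat by []; case: ifP => ? ne; lia.
Qed.

End Graft.
End Decomposition.

Section Decompose.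
Variables (K : fieldType) (P : operad K) (g : forall n, {linear gens K n -> P n}).
Hypothesis gM : is_smodule_morphism g.
Local Notation T := (toperad K).
Local Notation F n := (cochain K 'I_n).
Local Notation mon := (mon g).
Local Notation dec := (dec g).
Implicit Types m n p q k l : nat.

Lemma dec_relabel m k p (h : (m.+1 + k = p.+1)%N) (s t : 'S_p) (c : T p) x :
  dec h (s * t^-1)%g c x -> dec h s (relabel c t) (relabel x t).
Proof.
move=> [a [y [b [z [ma mb -> ->]]]]]; exists a, y, b, z.
by split=> //; rewrite Defs.actM mulgKV.
Qed.

Lemma block_card n k (S : {set 'I_n}) (s : 'S_n) : (k <= n)%N ->
  (forall u, (s u \in S) = (u < k)%N) -> #|S| = k.
Proof.
move=> kn sS; rewrite -(card_block kn) -(card_bij (permK s) (permKV s)).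
by apply: eq_card => u; rewrite !inE sS.
Qed.

(** Whatever the construction, its outermost step can be chosen to be any given inner edge of the
    tree. In the composition case, laminarity leaves the four positions treated above. *)
Lemma mon_dec n (c : T n) x : mon c x -> forall (w : word 'I_n) (S : {set 'I_n}),
  (c : F n) w != 0 -> S \in cl w -> S != setT ->
  forall m k (h : (m.+1 + k = n.+1)%N) (s : 'S_n), (forall u, (s u \in S) = (u < k)%N) -> dec h s c x.
Proof.
elim=> {n c x} [|n i n2|n c x _ IH|m n p h i a y b z ma IHa mb IHb|n c x t _ IH] w S nz Sw ST m0 k h0 s sS.
- by have := good_size (ev_good nz); rewrite card_ord; case: w Sw {nz}.
- have gw := ev_good nz; have := nz; rewrite giotaE /gfun1 gw; case: w gw Sw {nz} => [|l [|]] //= gw.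
    by rewrite inE => /eqP Sl; have := gw; rewrite good_corolla // => /andP[/eqP E _]; rewrite Sl E eqxx in ST.
  by rewrite eqxx.
- by apply: dec_opp; apply: (IH w S) => //; rewrite -oppr_eq0 -evN.
- have n0 := mon_gt0 mb; have m1 := mon_gt0 ma.
  case: p h i w S nz Sw ST h0 s sS => [|p] h i w S nz Sw ST h0 s sS; first by lia.
  have g' := ord_glue h i n0; have [gw sw na nb] := @pcomp_neq0 K _ _ _ h i a b w n0 nz.
  have kS : #|S| = k by apply: (block_card _ sS); lia.
  have /mapP[l lw SE] := Sw.
  have [SB|nSB] := boolP (S \subset qmap (n := n) p i @: setT).
    have [E|ne] := eqVneq S (qmap (n := n) p i @: setT); first exact: (dec_block h ma mb h0 sS E).
    have kq : #|qmap (n := n) p i @^-1: S| = k by rewrite (card_q (glue_qI g') SB).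
    have kn : (k <= n)%N by rewrite -kq -[X in (_ <= X)%N]card_ord max_card.
    have h1 : ((n - k).+1 + k = n.+1)%N by rewrite addSn subnK.
    have [s2 s2S] := block_perm kq.
    apply: (dec_upp h ma mb h0 sS SB (hb := h1) (s2 := s2)); last by move=> j; rewrite -s2S inE.
    apply: (IHb _ _ nb) => //.
      by rewrite cl_upp map_f // mem_filter SB.
    apply: contra ne => /eqP E; rewrite eq_sym -(imset_q SB) E eqxx //.
  have lt : lowt (qmap (n := n) p i) S by apply: lowtP => //; rewrite SE; have /allP := sw; apply.
  have lT : lowt (qmap (n := n) p i) setT by rewrite /lowt subsetT.
  pose S' := omap (m := m) p n i @^-1: S.
  have S'w : S' \in cl (low (omap (m := m) p n i) (qmap (n := n) p i) w).
    by rewrite cl_low map_f // mem_filter nSB.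
  have S'T : S' != setT.
    apply: contra ST => /eqP E; apply/eqP; apply: (o_inj (glue_oB g') (glue_oq g') lt lT).
    by rewrite -/S' E; apply/setP => j; rewrite !inE.
  have kE := card_o (glue_oI g') (glue_qI g') (glue_oB g') (glue_oq g') lt.
  rewrite kS card_ord -/S' in kE.
  have km : (#|S'| <= m)%N by rewrite -[X in (_ <= X)%N]card_ord max_card.
  have [s1 s1S] := block_perm (erefl #|S'|).
  have [BS|nBS] := boolP (qmap (n := n) p i @: setT \subset S).
    rewrite BS in kE; have h1 : (m0.+1 + #|S'| = m.+1)%N by clear - h h0 kE n0; lia.
    apply: (dec_low_in h mb h0 sS (ha := h1) (s1 := s1)) => //; first exact: (IHa _ _ na S'w).
    by move=> j; rewrite -s1S inE.
  rewrite (negbTE nBS) addn0 in kE; have h1 : ((m - k).+1 + k = m.+1)%N by rewrite kE addSn subnK.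
  have dSB : [disjoint S & qmap (n := n) p i @: setT] by move: lt; rewrite /lowt (negbTE nBS).
  apply: (dec_low_out gM h mb h0 sS (ha := h1) (s1 := s1)) => //.
    by apply: (IHa _ _ na S'w) => // u; rewrite s1S -kE.
  by move=> j; rewrite kE -s1S inE.
- apply: dec_relabel; apply: (IH (pull t w) (t @^-1: S)).
  + by move: nz; rewrite [X in X != 0]crelabelE mulf_eq0 signr_eq0.
  + by rewrite cl_pull map_f.
  + apply: contra ST => /eqP E; apply/eqP/setP => u; rewrite inE.
    by have := in_setT ((t^-1)%g u); rewrite -E inE permKV.
  + by move=> u; rewrite inE permM permKV sS.
Qed.

End Decompose.

Section Linearity.
Variables (K : fieldType) (Q : operad K).
Implicit Types m n p : nat.

Lemma compZl m n p (h : (m + n = p.+1)%N) i c (a : Q m) (b : Q n) :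
  Defs.pcomp h i (c *: a) b = c *: Defs.pcomp h i a b.
Proof. by have := comp_linearl h i b c a 0; rewrite comp0l !addr0. Qed.

Lemma compZr m n p (h : (m + n = p.+1)%N) i c (a : Q m) (b : Q n) :
  Defs.pcomp h i a (c *: b) = c *: Defs.pcomp h i a b.
Proof. by have := comp_linearr h i a c b 0; rewrite comp0r !addr0. Qed.

Lemma relabelZ n c (a : Q n) (s : 'S_n) : relabel (c *: a) s = c *: relabel a s.
Proof. by have := act_linear s c a 0; rewrite Defs.act0 !addr0. Qed.

Lemma perm1E (s : 'S_1) : s = 1%g.
Proof. by apply/permP => j; rewrite [LHS]ord1 [RHS]ord1. Qed.

End Linearity.

Section SmallTrees.
Variables (K : fieldType) (P : operad K) (g : forall n, {linear gens K n -> P n}).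
Hypothesis gM : is_smodule_morphism g.
Local Notation T := (toperad K).
Local Notation F n := (cochain K 'I_n).
Local Notation mon := (mon g).
Local Notation dec := (dec g).
Implicit Types m n p q k : nat.

Lemma cochain1 (a : F 1) : a = a [::] *: cunit K.
Proof.
apply: cochain_eq => w /good_size; rewrite card_ord evZ cunitE; case: w => //= _.
by rewrite mulr1.
Qed.

(** A tree with one leaf is plus or minus the unit, and its value likewise. The equation on the
    arity stays a variable so that the induction ranges over all arities. *)
Lemma mon_unary n (c : T n) x : mon c x ->
  forall e : n = 1%N, x = (c : F n) [::] *: ecast z (P z) (esym e) (unit_op P).
Proof.
elim=> {n c x} [|n i n2|n c x _ IH|m n p h i a y b z ma IHa mb IHb|n c x s _ IH] e.
- by rewrite [e]eq_axiomK cunitE scale1r.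
- by rewrite e in n2.
- by rewrite evN scaleNr {1}(IH e).
- have n0 := mon_gt0 mb; have m0 := mon_gt0 ma.
  have [em en] : m = 1%N /\ n = 1%N by clear - h n0 m0 e; lia.
  have yE := IHa em; have zE := IHb en; clear IHa IHb ma mb n0 m0; subst m n p.
  have E : (Defs.pcomp h i a b : T 1) = (a : F 1) [::] *: b.
    by rewrite {1}(cochain1 a) [LHS](compZl (Q := T)) [X in _ *: X = _](Defs.comp1l (o := T)).
  by rewrite E evZ yE zE /= compZl compZr Defs.comp1l scalerA.
- rewrite {1}(IH e); subst n; rewrite (perm1E s) Defs.act1.
  by rewrite [relabel c _]Defs.act1.
Qed.

(** A composite with a single vertex has a factor without vertices, hence of arity 1 and a multiple
    of the unit. *)
Lemma mon_corolla n (c : T n) x : mon c x -> (2 <= n)%N ->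
  forall l, (c : F n) [:: l] != 0 -> x = (c : F n) [:: l] *: g n (gen_basis K n l.2.1).
Proof.
elim=> {n c x} [|n i n2|n c x _ IH|m n p h i a y b z ma IHa mb IHb|n c x s _ IH] // n2' l nz.
- have gl := ev_good nz; have := nz; rewrite giota_basisE //.
  have [->|_] := eqVneq (nat_of_ord i) l.2.1; [by rewrite scale1r | by rewrite eqxx].
- by rewrite evN scaleNr -IH // -oppr_eq0 -evN.
- have n0 := mon_gt0 mb; have m0 := mon_gt0 ma.
  case: p h i l nz n2' => [|p] // h i l nz n2'.
  have [gw sw na nb] := @pcomp_neq0 K _ _ _ h i a b [:: l] n0 nz.
  have sz : (_ + _)%N = 1%N := size_low_upp (omap (m := m) p n i) (qmap (n := n) p i) [:: l].
  have ga := ev_good na; have gb := ev_good nb.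
  case E: (low (omap (m := m) p n i) (qmap (n := n) p i) [:: l]) sz ga => [|l1 u] sz ga.
    have m1 : m = 1%N by apply/eqP; rewrite -good_nil1.
    have np : n = p.+1 by clear - h m1; lia.
    clear ga na sw E gb sz nb.
    have yE := mon_unary ma m1.
    subst m n.
    have E : (Defs.pcomp h i a b : T p.+1) = (a : F 1) [::] *: b.
      by rewrite {1}(cochain1 a) [LHS](compZl (Q := T)) [X in _ *: X = _](Defs.comp1l (o := T)).
    move: nz; rewrite E evZ mulf_eq0 negb_or => /andP[_ nb].
    by rewrite yE /= compZl Defs.comp1l {1}(IHb n2' l nb) scalerA.
  case Eu: (upp (qmap (n := n) p i) [:: l]) sz gb => [|? ?] sz gb; last by rewrite /= addSn addnS in sz.
  have n1 : n = 1%N by apply/eqP; rewrite -good_nil1.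
  have mp : m = p.+1 by clear - h n1; lia.
  clear ga na sw E gb sz nb Eu.
  have zE := mon_unary mb n1.
  subst m n.
  have E : (Defs.pcomp h i a b : T p.+1) = (b : F 1) [::] *: a.
    by rewrite {1}(cochain1 b) [LHS](compZr (Q := T)) [X in _ *: X = _](Defs.comp1r (o := T)).
  move: nz; rewrite E evZ mulf_eq0 negb_or => /andP[_ na].
  by rewrite zE /= compZr Defs.comp1r {1}(IHa n2' l na) scalerA.
- move: nz; rewrite [X in X != 0]crelabelE mulf_eq0 signr_eq0 /= => nz.
  rewrite [X in _ = X *: _]crelabelE {1}(IH n2' _ nz) relabelZ -gM.2.
  have -> : relabel (gen_basis K n (s @^-1: l.1, l.2).2.1) s = (-1) ^+ s *: gen_basis K n l.2.1 by [].
  by rewrite linearZ scalerA mulrC.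
Qed.

Lemma nonroot n (w : word 'I_n) : good w -> (1 < size w)%N ->
  exists2 S, S \in cl w & S != setT.
Proof.
move=> /good_uniq; case: w => [|l1 [|l2 w]] //= /andP[+ _] _; rewrite inE negb_or => /andP[ne _].
have [E|ne'] := eqVneq l1.1 setT; last by exists l1.1; rewrite ?inE ?eqxx.
by exists l2.1; rewrite ?inE ?eqxx ?orbT // -E eq_sym.
Qed.

End SmallTrees.

(** * Coherence: a tree determines its value *)

Section Coherence.
Variables (K : fieldType) (P : operad K) (g : forall n, {linear gens K n -> P n}).
Hypothesis gM : is_smodule_morphism g.
Local Notation T := (toperad K).
Local Notation F n := (cochain K 'I_n).
Local Notation mon := (mon g).
Local Notation dec := (dec g).
Implicit Types m n p q k : nat.

Lemma mon_ev_sign n (c : T n) x w : mon c x -> (c : F n) w != 0 -> exists e : bool, (c : F n) w = (-1) ^+ e.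
Proof. by move=> /mon_basic; exact: basic_sign. Qed.

Lemma mon_scale n (c : T n) x w : mon c x -> (c : F n) w != 0 ->
  mon ((c : F n) w *: c) ((c : F n) w *: x).
Proof. by move=> m nz; have [e ->] := mon_ev_sign m nz; exact: mon_sign. Qed.

Lemma nonroot_split n (S : {set 'I_n}) : S != setT -> (#|S| < n)%N.
Proof.
move=> ST; rewrite ltn_neqAle -[X in (_ <= X)%N]card_ord max_card andbT.
apply: contra ST => /eqP E; rewrite eqEcard subsetT cardsT card_ord E //=.
Qed.

(* Cut both constructions at the same inner edge and use induction on both sides. *)
Lemma coherence N : forall n (c : T n) x x' (w : word 'I_n), (size w < N)%N -> (c : F n) w != 0 ->
  mon c x -> mon c x' -> x = x'.
Proof.
elim: N => // N IH n c x x' w; rewrite ltnS => wN nz mx mx'; have gw := ev_good nz.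
case: (ltnP 1 (size w)) => w2; last first.
  case: w w2 gw nz {wN} => [|l [|]] // _ gw nz.
    have n1 : n = 1%N by apply/eqP; rewrite -good_nil1.
    by rewrite (mon_unary mx n1) (mon_unary mx' n1).
  have n2 : (1 < n)%N by have := good_size gw; rewrite card_ord.
  by rewrite (mon_corolla gM mx n2 nz) (mon_corolla gM mx' n2 nz).
have [S Sw ST] := nonroot gw w2; have kn := nonroot_split ST.
have [s sS] := block_perm (erefl #|S|).
have k2 : (1 < #|S|)%N := good_gt1 gw Sw.
case: n c x x' w gw nz mx mx' S Sw ST kn s sS k2 wN w2 => [//|p] c x x' w gw nz mx mx' S Sw ST kn s sS k2 wN w2.
have h : ((p - #|S|).+1.+1 + #|S| = p.+2)%N by rewrite !addSn subnK.
have [a [y [b [z [ma mb cE xE]]]]] := mon_dec gM mx nz Sw ST h sS.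
have [a' [y' [b' [z' [ma' mb' cE' xE']]]]] := mon_dec gM mx' nz Sw ST h sS.
pose w' := pull s w.
have nz1 : (Defs.pcomp h ord0 a b : F p.+1) w' != 0.
  by move: nz; rewrite cE [X in X != 0]crelabelE mulf_eq0 signr_eq0.
have nz2 : (Defs.pcomp h ord0 a' b' : F p.+1) w' != 0.
  by move: nz; rewrite cE' [X in X != 0]crelabelE mulf_eq0 signr_eq0.
have E12 : (Defs.pcomp h ord0 a b : F p.+1) w' = (Defs.pcomp h ord0 a' b' : F p.+1) w'.
  have : ((-1) ^+ s * (Defs.pcomp h ord0 a b : F p.+1) w' = (-1) ^+ s * (Defs.pcomp h ord0 a' b' : F p.+1) w').
    by have := congr1 (fun c : F p.+1 => c w) cE'; rewrite {1}cE.
  by apply: mulfI; rewrite signr_eq0.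
have n0 := mon_gt0 mb.
have [gw' sw' na nb] := @pcomp_neq0 K _ _ _ h ord0 a b w' n0 nz1.
have [_ _ na' nb'] := @pcomp_neq0 K _ _ _ h ord0 a' b' w' n0 nz2.
have sz := size_low_upp (omap (m := (p - #|S|).+2) p #|S| (ord0 : 'I_(p - #|S|).+2)) (qmap (n := #|S|) p (ord0 : 'I_(p - #|S|).+2)) w'.
set lo := low _ _ _ in na na' sz; set up := upp _ _ in nb nb' sz.
have lo0 : (0 < size lo)%N.
  have := ev_good na; case: (lo) => // gl; by have := good_nil1 (p - #|S|).+2; rewrite gl.
have up0 : (0 < size up)%N.
  by have := ev_good nb; case: (up) => // gl; have := good_nil1 #|S|; rewrite gl => /esym/eqP e; rewrite e in k2.
have sw : size w' = size w by rewrite size_map.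
have [loN upN] : (size lo < N)%N /\ (size up < N)%N by have : (size lo + size up <= N)%N by [rewrite sz sw]; clear - lo0 up0; lia.
have [e eE] := mon_ev_sign ma na; have [e' eE'] := mon_ev_sign ma' na'.
have [f fE] := mon_ev_sign mb nb; have [f' fE'] := mon_ev_sign mb' nb'.
have aE := basic_eq (mon_basic ma) (mon_basic ma') na na'.
have bE := basic_eq (mon_basic mb) (mon_basic mb') nb nb'.
rewrite eE eE' -signr_addb in aE; rewrite fE fE' -signr_addb in bE.
have yE : y = (-1) ^+ (e (+) e') *: y' by apply: (IH _ a _ _ lo) => //; rewrite [a]aE; exact: mon_sign.
have zE : z = (-1) ^+ (f (+) f') *: z' by apply: (IH _ b _ _ up) => //; rewrite [b]bE; exact: mon_sign.
have ab : Defs.pcomp h ord0 a b = ((-1) ^+ (e (+) e') * (-1) ^+ (f (+) f')) *: Defs.pcomp h ord0 a' b'.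
  by rewrite {1}[a]aE {1}[b]bE [LHS](compZl (Q := T)) [X in _ *: X = _](compZr (Q := T)) scalerA.
(* The factors agree up to sign only, but both composites take the same nonzero value at [w'], so
   the two signs cancel. *)
have s1 : (-1) ^+ (e (+) e') * (-1) ^+ (f (+) f') = 1 :> K.
  by move: E12; rewrite ab evZ -[RHS]mul1r; apply: mulIf.
by rewrite xE xE' yE zE compZl compZr scalerA s1 scale1r.
Qed.

Lemma mon_coherent n (c : T n) x x' : mon c x -> mon c x' -> x = x'.
Proof.
move=> m m'; have [w nz] := basic_neq0 (mon_basic m); exact: (coherence (ltnSn _) nz m m').
Qed.

Lemma mon_exists N : forall n (w : word 'I_n), (size w < N)%N -> good w ->
  exists (c : T n) x, mon c x /\ (c : F n) w != 0.
Proof.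
elim: N => // N IH n w; rewrite ltnS => wN gw.
case: (ltnP 1 (size w)) => w2; last first.
  case: w w2 gw {wN} => [|l [|]] // _ gw.
    have n1 : n = 1%N by apply/eqP; rewrite -good_nil1.
    subst n; exists (unit_op T), (unit_op P); split; first exact: mon_unit.
    by rewrite cunitE oner_eq0.
  have n2 : (1 < n)%N by have := good_size gw; rewrite card_ord.
  have := gw; rewrite good_corolla // => /andP[_ ln].
  exists (giota K n (gen_basis K n (Ordinal ln))), (g n (gen_basis K n (Ordinal ln))).
  by split; [exact: mon_gen | rewrite giota_basisE // eqxx oner_eq0].
have [S Sw ST] := nonroot gw w2; have kn := nonroot_split ST.
have [s sS] := block_perm (erefl #|S|).
have k2 : (1 < #|S|)%N := good_gt1 gw Sw.
case: n w gw S Sw ST kn s sS k2 wN w2 => [//|p] w gw S Sw ST kn s sS k2 wN w2.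
have h : ((p - #|S|).+1.+1 + #|S| = p.+2)%N by rewrite !addSn subnK.
pose w' := pull s w; have gw' : good w' by rewrite good_relabel.
have k0 : (0 < #|S|)%N by exact: ltnW.
have g' := ord_glue h ord0 k0.
have Bw : qmap (n := #|S|) p 0 @: setT \in cl w'.
  rewrite (_ : _ @: _ = s @^-1: S) ?cl_pull ?map_f //.
  by apply/setP => u; rewrite inE sS (mem_block h ord0) /= add0n.
have gu := good_upp_B (glue_oI g') (glue_qI g') (glue_oB g') (glue_oq g') (glue_card g') gw' (or_introl Bw).
have [sw gl] := glue_good (glue_oI g') (glue_qI g') (glue_oB g') (glue_oq g') (glue_card g') gw' gu.
have sz := size_low_upp (omap (m := (p - #|S|).+2) p #|S| (ord0 : 'I_(p - #|S|).+2)) (qmap (n := #|S|) p (ord0 : 'I_(p - #|S|).+2)) w'.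
set lo := low _ _ _ in gl sz; set up := upp _ _ in gu sz.
have lo0 : (0 < size lo)%N.
  by move: gl; case: (lo) => // gl; have := good_nil1 (p - #|S|).+2; rewrite gl.
have up0 : (0 < size up)%N.
  by move: gu; case: (up) => // gu; have := good_nil1 #|S|; rewrite gu => /esym/eqP e; rewrite e in k2.
have sw' : size w' = size w by rewrite size_map.
have [loN upN] : (size lo < N)%N /\ (size up < N)%N by have : (size lo + size up <= N)%N by [rewrite sz sw']; clear - lo0 up0; lia.
have [a [y [ma na]]] := IH _ _ loN gl; have [b [z [mb nb]]] := IH _ _ upN gu.
exists (relabel (Defs.pcomp h ord0 a b) s), (relabel (Defs.pcomp h ord0 y z) s); split.
  by apply: mon_act; exact: mon_comp.
rewrite [X in X != 0]crelabelE mulf_eq0 signr_eq0 /= -/w'.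
by rewrite gcompE // !mulf_eq0 signr_eq0 !negb_or na.
Qed.

End Coherence.

(** * Trees as finite sets, and the universal property *)

Section FiniteWords.
Variable n : nat.

(** The weights in a good word are smaller than [n]; up to order a tree is therefore a subset of a
    finite type, over which sums can be taken. *)
Definition letter : finType := ({set 'I_n} * 'I_n * 'I_n)%type.

Definition wordof (A : {set letter}) : word 'I_n :=
  [seq (l.1.1, (nat_of_ord l.1.2, nat_of_ord l.2)) | l : letter <- enum A].

Lemma letter_inj : injective (fun l : letter => (l.1.1, (nat_of_ord l.1.2, nat_of_ord l.2))).
Proof.
by move=> [[S a] b] [[S' a'] b'] /= [-> /ord_inj -> /ord_inj ->].
Qed.

Lemma mem_wordof A (l : letter) : ((l.1.1, (nat_of_ord l.1.2, nat_of_ord l.2)) \in wordof A) = (l \in A).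
Proof. by rewrite (mem_map letter_inj) mem_enum. Qed.

Lemma wordof_inj A A' : perm_eq (wordof A) (wordof A') -> A = A'.
Proof. by move=> /perm_mem E; apply/setP => l; rewrite -!mem_wordof E. Qed.

Lemma good_wt (w : word 'I_n) l : good w -> l \in w -> (wt l.2 < n)%N.
Proof.
move=> gw lw; have /and5P[_ _ _ /allP/(_ _ lw)/eqP cs _] := gw.
have : (wt l.2 <= csum w l.1)%N.
  by rewrite /csum (big_rem l) //= subxx leq_addr.
rewrite cs => /leq_ltn_trans; apply.
by rewrite prednK ?(ltnW (good_gt1 gw (map_f fst lw))) // -[X in (_ <= X)%N]card_ord max_card.
Qed.

Lemma wordof_ex (w : word 'I_n) : good w -> exists A, perm_eq w (wordof A).
Proof.
move=> gw; exists [set l : letter | (l.1.1, (nat_of_ord l.1.2, nat_of_ord l.2)) \in w].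
apply: uniq_perm; first exact: map_uniq (good_uniq gw).
  by rewrite (map_inj_uniq letter_inj) enum_uniq.
move=> [S [a b]]; apply/idP/idP => [lw|/mapP[l + ->]]; last by rewrite mem_enum inE.
have := good_wt gw lw; rewrite /wt /= => abn.
have an : (a < n)%N by lia.
have bn : (b < n)%N by lia.
apply/mapP; exists (S, Ordinal an, Ordinal bn) => //=; by rewrite mem_enum inE.
Qed.

End FiniteWords.

Section Free.
Variables (K : fieldType) (P : operad K) (g : forall n, {linear gens K n -> P n}).
Hypothesis gM : is_smodule_morphism g.
Local Notation T := (toperad K).
Local Notation F n := (cochain K 'I_n).
Local Notation mon := (mon g).
Implicit Types m n p q : nat.

Fact treeval_ex n (A : {set letter n}) : exists cx : T n * P n,
  good (wordof A) -> mon cx.1 cx.2 /\ (cx.1 : F n) (wordof A) = 1.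
Proof.
have [gw|] := boolP (good (wordof A)); last by exists (0, 0).
have [c [x [m nz]]] := mon_exists g (ltnSn _) gw; have m' := mon_scale m nz.
exists ((c : F n) (wordof A) *: c, (c : F n) (wordof A) *: x) => _; split=> //.
by have [e eE] := mon_ev_sign m nz; rewrite evZ eE -expr2 sqrr_sign.
Qed.

Definition treeval n (A : {set letter n}) := sval (cid (treeval_ex A)).

Lemma treevalP n (A : {set letter n}) : good (wordof A) ->
  mon (treeval A).1 (treeval A).2 /\ ((treeval A).1 : F n) (wordof A) = 1.
Proof. exact: (svalP (cid (treeval_ex A))). Qed.

(** Expands [a] in the basis of normalised trees and replaces each tree by a value found by some
    construction. The choice is harmless by coherence. *)
Definition tree_map n (a : T n) : P n :=
  \sum_(A : {set letter n}) (a : F n) (wordof A) *: (treeval A).2.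

Fact tree_map_linear n : linear (@tree_map n).
Proof.
move=> k a b; rewrite /tree_map scaler_sumr -big_split; apply: eq_bigr => A _.
by rewrite [X in X *: _]evD evZ scalerDl scalerA.
Qed.

HB.instance Definition _ n :=
  GRing.isLinear.Build K (T n) (P n) *:%R (@tree_map n) (@tree_map_linear n).

(** Only the subset of the tree [c] contributes, and [mon_coherent] identifies its chosen value with
    [x]. All clauses of an operad morphism then follow from the constructors of [mon] by
    linearity. *)
Lemma tree_map_mon n (c : T n) x : mon c x -> tree_map c = x.
Proof.
move=> m; have [w nz] := basic_neq0 (mon_basic m); have [A pA] := wordof_ex (ev_good nz).
have nzA : (c : F n) (wordof A) != 0.
  have [e ->] := antisym_perm K pA; first by rewrite mulf_neq0 ?signr_eq0.
  exact: cochain_antisym.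
rewrite /tree_map (bigD1 A) //= big1 ?addr0 => [|B BA]; last first.
  rewrite (_ : (c : F n) _ = 0) ?scale0r //; apply: contraNeq BA => nzB.
  by rewrite eq_sym; apply/eqP/wordof_inj; exact: basic_perm (mon_basic m) nzA nzB.
have [mt t1] := treevalP (ev_good nzA).
have t0 : ((treeval A).1 : F n) (wordof A) != 0 by rewrite t1 oner_eq0.
have cE := basic_eq (mon_basic m) (mon_basic mt) nzA t0.
apply: (mon_coherent gM _ m); have [e eE] := mon_ev_sign m nzA.
rewrite t1 mulr1 in cE; rewrite {1}[c]cE eE; exact: mon_sign.
Qed.

Lemma cochain_trees n (a : F n) :
  a = \sum_(A : {set letter n}) a (wordof A) *: ((treeval A).1 : F n).
Proof.
apply: cochain_eq => w gw; rewrite ev_sum; have [A pA] := wordof_ex gw.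
have gA : good (wordof A) by rewrite -(perm_good pA).
have [mt t1] := treevalP gA; have [e h] := antisym_perm K pA.
rewrite (bigD1 A) //= big1 ?addr0 => [|B BA]; rewrite evZ.
  have he : forall c : F n, c w = (-1) ^+ e * c (wordof A).
    by move=> c; rewrite (h c (@cochain_antisym _ _ c)) mulrA -expr2 sqrr_sign mul1r.
  by rewrite (he a) (he (treeval A).1) t1 mulr1 mulrC.
have [gB|gB] := boolP (good (wordof B)); last by rewrite (cochain_supp a gB) mul0r.
have [mB B1] := treevalP gB.
rewrite (_ : ((treeval B).1 : F n) w = 0) ?mulr0 //; apply: contraNeq BA => nz.
apply/eqP/wordof_inj; rewrite perm_sym (perm_trans _ (basic_perm (mon_basic mB) nz _)) ?B1 ?oner_eq0 //.
by rewrite perm_sym.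
Qed.

Lemma trees_ind n (Q : T n -> Prop) : Q 0 -> (forall k a b, Q a -> Q b -> Q (k *: a + b)) ->
  (forall c x, mon c x -> Q c) -> forall a, Q a.
Proof.
move=> Q0 QD Qm a; rewrite [a]cochain_trees; apply: (big_ind Q) => // [b c Qb Qc|A _].
  by rewrite -[b]scale1r; exact: QD.
have [gA|gA] := boolP (good (wordof A)); last by rewrite (cochain_supp (a : F n) gA) scale0r.
by rewrite -[_ *: _]addr0; apply: QD => //; apply: Qm; exact: (treevalP gA).1.
Qed.

Lemma tree_map_homog n d (a : T n) : homog d a -> homog d (tree_map a).
Proof.
move=> ha; rewrite /tree_map; apply: (big_ind (homog d)) => [|b c hb hc|A _]; first exact: homog0.
  by rewrite -[b]scale1r; exact: homog_linear.
have [->|nz] := eqVneq ((a : F n) (wordof A)) 0; first by rewrite scale0r; exact: homog0.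
have dE := ha _ nz; have [mt t1] := treevalP (ev_good nz).
have [e [he he']] := mon_homog gM mt.
rewrite -[_ *: _]addr0; apply: homog_linear; last exact: homog0.
by rewrite -dE (he (wordof A)) // t1 oner_eq0.
Qed.

Lemma tree_map_morphism : is_operad_morphism (P := T) tree_map.
Proof.
split; first split; first exact: tree_map_homog.
- move=> n a s; elim/trees_ind: a => [|k a b IHa IHb|c x m].
  + by rewrite Defs.act0 !linear0 Defs.act0.
  + by rewrite (act_linear s k a b) !linearP IHa IHb (act_linear s k).
  + by rewrite [LHS](tree_map_mon (mon_act s m)) [X in _ = relabel X _](tree_map_mon m).
- exact: tree_map_mon (mon_unit g).
- move=> m n p h i a b; elim/trees_ind: a => [|k a a' IHa IHb|c x mc].
  + by rewrite comp0l !linear0 comp0l.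
  + by rewrite (comp_linearl h i b k a a') !linearP IHa IHb (comp_linearl h i _ k).
  elim/trees_ind: b => [|k a a' IHa IHb|c' x' mc'].
  + by rewrite comp0r !linear0 comp0r.
  + by rewrite (comp_linearr h i c k a a') !linearP IHa IHb (comp_linearr h i _ k).
  + by rewrite [LHS](tree_map_mon (mon_comp h i mc mc')) [X in _ = Defs.pcomp _ _ X _](tree_map_mon mc) [X in _ = Defs.pcomp _ _ _ X](tree_map_mon mc').
Qed.

Lemma gens_ind n (Q : gens K n -> Prop) : Q 0 -> (forall k a b, Q a -> Q b -> Q (k *: a + b)) ->
  (forall i : 'I_n, (2 <= n)%N -> Q (gen_basis K n i)) -> forall v, Q v.
Proof.
move=> Q0 QD Qb v.
have [n2|n2] := leqP 2 n; last first.
  have n0 : gen_mult n = 0%N by rewrite /gen_mult leqNgt n2.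
  rewrite (_ : v = 0) //; apply/rowP => j; have := ltn_ord j; by rewrite {2}n0.
have -> : v = \sum_(j < gen_mult n) (v : 'rV[K]_(gen_mult n)) 0 j *: gen_basis K n j.
  apply/rowP => j; rewrite summxE (bigD1 j) //= !mxE eqxx mulr1 big1 ?addr0 // => j' ne.
  rewrite !mxE (_ : (j == j' :> nat) = false) ?mulr0 //; by apply/negbTE; rewrite eq_sym.
apply: (big_ind Q) => // [b c hb hc|j _]; first by rewrite -[b]scale1r; exact: QD.
rewrite -[_ *: _]addr0; apply: QD => //.
have jn : (j < n)%N by have := ltn_ord j; rewrite {2}gen_multE.
exact: (Qb (Ordinal jn)).
Qed.

Lemma tree_map_gens n (v : gens K n) : tree_map (giota K n v) = g n v.
Proof.
elim/gens_ind: v => [|k a b IHa IHb|i n2]; first by rewrite !linear0.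
  have -> : tree_map (giota K n (k *: a + b)) = k *: tree_map (giota K n a) + tree_map (giota K n b).
    by rewrite !linearP.
  by rewrite IHa IHb linearP.
by rewrite [LHS](tree_map_mon (mon_gen g i n2)).
Qed.

Lemma tree_map_unique (f : forall n, {linear T n -> P n}) : is_operad_morphism f ->
  (forall n v, f n (giota K n v) = g n v) -> forall n x, f n x = tree_map x.
Proof.
move=> [[_ fs] fu fc] fg n a; elim/trees_ind: a => [|k a b IHa IHb|c x m].
- by rewrite !linear0.
- by rewrite !linearP IHa IHb.
rewrite (tree_map_mon m); elim: m => {n c x} [|n i n2|n c x _ IH|m n p h i c x c' x' _ IH _ IH'|n c x s _ IH] //.
- by rewrite linearN IH.
- by rewrite fc IH IH'.
- by rewrite fs IH.
Qed.

End Free.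

Lemma giota_free (K : fieldType) : is_free_operad (F := tdg K) (giota K).
Proof.
split; first exact: giota_morphism.
move=> P g gM; exists (fun n => tree_map g (n := n)); split.
- exact: tree_map_morphism.
- exact: tree_map_gens.
- by move=> f fm fg n x; exact: tree_map_unique.
Qed.

(** * Minimality and comparison with the operad of compatible Lie brackets *)

Section Minimality.
Variable K : fieldType.
Local Notation spanned := (spanned_by_trees_ge2 (F := tdg K) (giota K)).

Lemma spanned0 n : spanned (0 : tdg K n).
Proof.
exists 0%N, (fun _ => 0), (fun _ => 0); split; first by case.
by rewrite big_ord0.
Qed.

Lemma spanned_linear n k (x y : tdg K n) : spanned x -> spanned y -> spanned (k *: x + y).
Proof.
move=> [r [a [t [ht ->]]]] [r' [a' [t' [ht' ->]]]].
exists (r + r')%N, (fun j => match fintype.split j with inl i => k * a i | inr i => a' i end),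
  (fun j => match fintype.split j with inl i => t i | inr i => t' i end); split.
  by move=> j; case: (fintype.split j).
rewrite big_split_ord /= scaler_sumr; congr (_ + _); apply: eq_bigr => j _.
  by rewrite (unsplitK (inl _)) scalerA.
by rewrite (unsplitK (inr _)).
Qed.

Lemma spanned_tree n w (x : tdg K n) : (2 <= w)%N -> tree_monomial (F := tdg K) (giota K) w x -> spanned x.
Proof.
move=> w2 tx; exists 1%N, (fun _ => 1), (fun _ => x); split; first by move=> _; exists w.
by rewrite big_ord1 scale1r.
Qed.

Lemma spanned_sum n I (r : seq I) (p : pred I) (x : I -> tdg K n) :
  (forall i, p i -> spanned (x i)) -> spanned (\sum_(i <- r | p i) x i).
Proof.
move=> h; apply: (big_ind (fun y : tdg K n => spanned y)) => //; first exact: spanned0.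
by move=> y z hy hz; rewrite -[y]scale1r; exact: spanned_linear.
Qed.

Lemma giota_minimal n (v : gens K n) : spanned (diff (tdg K) (giota K n v)).
Proof.
elim/gens_ind: v => [|k a b IHa IHb|i n2]; first by rewrite !linear0; exact: spanned0.
  by rewrite !linearP; exact: spanned_linear.
rewrite cdiff_gen //; do 4!(apply: spanned_sum => ? ?).
rewrite /two_vertex_tree scalerA -[_ *: _]addr0; apply: spanned_linear; last exact: spanned0.
apply: (@spanned_tree _ 2) => //; apply: Tree_relabel.
by apply: (Tree_graft (v := 1) (w := 1)); exact: Tree_corolla.
Qed.

End Minimality.

Lemma perm2E (s : 'S_2) : s = if odd_perm s then tperm ord0 ord_max else 1%g.
Proof.
have E : s = 1%g \/ s = tperm ord0 ord_max.
  have [e|ne] := eqVneq (s ord0) ord0; [left | right]; apply/permP => j.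
    rewrite perm1; case: (unliftP ord0 j) => [k|] -> //.
    case: (unliftP ord0 (s (lift ord0 k))) => [k' ->|e']; first by rewrite (ord1 k) (ord1 k').
    by have := @perm_inj _ s ord0 (lift ord0 k); rewrite e e' => /(_ erefl).
  have e : s ord0 = ord_max.
    by case: (unliftP ord0 (s ord0)) ne => [k' -> _|-> /eqP //]; rewrite (ord1 k'); apply: ord_inj.
  rewrite permE /=; case: (unliftP ord0 j) => [k|] -> //.
  have -> : lift ord0 k = ord_max by rewrite (ord1 k); apply: ord_inj.
  case: (unliftP ord0 (s ord_max)) => [k' e'|-> //].
  have : s ord0 = s ord_max by rewrite e e' (ord1 k'); apply: ord_inj.
  by move/perm_inj.
by case: E => ->; rewrite ?odd_perm1 ?odd_tperm.
Qed.

(** * The Jacobi identity and the ternary generators *)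

Section Jacobi.
Variables (K : fieldType) (P : operad K).

Definition jacobi (b b' : P 2) : P 3 :=
  \sum_(k < 3) relabel (Defs.pcomp (erefl : (2 + 2 = 4)%N) ord0 b b') (perm (@ordS_inj 3) ^+ k)%g.

Lemma relabelD n (a b : P n) s : relabel (a + b) s = relabel a s + relabel b s.
Proof. by have := act_linear s 1 a b; rewrite !scale1r. Qed.

Lemma jacobiDl b c b' : jacobi (b + c) b' = jacobi b b' + jacobi c b'.
Proof.
rewrite /jacobi -big_split; apply: eq_bigr => k _; rewrite -[RHS]relabelD; congr relabel.
by have := comp_linearl (erefl : (2 + 2 = 4)%N) ord0 b' 1 b c; rewrite !scale1r.
Qed.

Lemma jacobiDr b b' c' : jacobi b (b' + c') = jacobi b b' + jacobi b c'.
Proof.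
rewrite /jacobi -big_split; apply: eq_bigr => k _; rewrite -[RHS]relabelD; congr relabel.
by have := comp_linearr (erefl : (2 + 2 = 4)%N) ord0 b 1 b' c'; rewrite !scale1r.
Qed.

(* The square of the 3-cycle is the transposition of the two inputs of [b'] followed by a shuffle. *)
Lemma sum_shuffles3 b b' (h : (2 + 2 = 4)%N) : relabel b' (tperm ord0 ord_max) = - b' ->
  \sum_(t : 'S_3 | is_shuffle 2 t) (-1) ^+ odd_perm t *: relabel (Defs.pcomp h ord0 b b') t = jacobi b b'.
Proof.
move=> ab; rewrite (eq_irrelevance h erefl); set X := Defs.pcomp _ _ _ _.
pose o0 : 'I_3 := ord0; pose o1 : 'I_3 := lift ord0 ord0; pose o2 : 'I_3 := ord_max.
pose r := perm (@ordS_inj 3).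
have rE : r = (tperm o1 o2 * tperm o0 o1)%g.
  apply/permP => -[[|[|[|]]] // i]; rewrite /r permE permM !permE /=; apply: ord_inj => //=.
have r2E : (r * r = tperm o0 o1 * tperm o1 o2)%g.
  apply/permP => -[[|[|[|]]] // i]; rewrite !permM /r !permE /=; apply: ord_inj => //=.
have XN : relabel X (tperm o0 o1) = - X.
  have := @Defs.comp_act _ P _ _ _ (erefl : (2 + 2 = 4)%N) ord0 1%g (tperm ord0 ord_max) (tperm o0 o1) b b'.
  rewrite Defs.act1 ab perm1 -/X => <-.
  - by rewrite -scaleN1r compZr scaleN1r.
  - by move=> [[|[|]] // i] [u ui] // _ /= uE; subst u; rewrite perm1 permE.
  - by move=> [[|[|]] // i] [u ui] /= uE; subst u; rewrite !permE.
have det (t t' : 'S_3) : t o0 = t' o0 -> t o1 = t' o1 -> t = t'.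
  move=> e0 e1; apply/permP => j; have [<- //|n0] := eqVneq o0 j; have [<- //|n1] := eqVneq o1 j.
  have V (s : 'S_3) : s j != s o0 /\ s j != s o1.
    by rewrite !(inj_eq (@perm_inj _ s)) ![j == _]eq_sym.
  have n01 : t o0 != t o1 by rewrite (inj_eq (@perm_inj _ t)).
  apply: ord_inj; have [v0 v1] := V t; have [v0' v1'] := V t'; rewrite -e0 -e1 in v0' v1'.
  move: (ltn_ord (t j)) (ltn_ord (t' j)) (ltn_ord (t o0)) (ltn_ord (t o1)) v0 v1 v0' v1' n01.
  rewrite -!(inj_eq (@ord_inj 3)); clear; lia.
have shP (t : 'S_3) : is_shuffle 2 t = (t o0 < t o1)%N.
  apply/shuffleP/idP => [|lt i j ij jk]; first exact.
  have j3 := ltn_ord j.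
  have [ei ej] : i = 0%N :> nat /\ j = 1%N :> nat by clear - ij jk j3; lia.
  have e0 : i = o0 by apply: ord_inj; exact: ei.
  have e1 : j = o1 by apply: ord_inj; exact: ej.
  by rewrite e0 e1.
have v1 : is_shuffle 2 (1 : 'S_3)%g by rewrite shP !permE.
have vr : is_shuffle 2 r by rewrite shP !permE.
have vt : is_shuffle 2 (tperm o1 o2) by rewrite shP !permE.
have r1 : r != 1%g by apply/eqP => /permP/(_ o0); rewrite !permE => /(congr1 (@nat_of_ord 3)).
have t1 : tperm o1 o2 != 1%g by apply/eqP => /permP/(_ o1); rewrite !permE => /(congr1 (@nat_of_ord 3)).
have tr : tperm o1 o2 != r by apply/eqP => /permP/(_ o0); rewrite !permE => /(congr1 (@nat_of_ord 3)).
rewrite (bigD1 1%g) //= (bigD1 r) ?vr //= (bigD1 (tperm o1 o2)) ?vt ?t1 //= big1 => [|t]; last first.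
  rewrite shP => /andP[/andP[/andP[lt n1] nr] nt]; exfalso.
  have l0 := ltn_ord (t o0); have l1 := ltn_ord (t o1).
  have [[e0 e1]|[[e0 e1]|[e0 e1]]] : (t o0 = 0%N :> nat /\ t o1 = 1%N :> nat) \/
     (t o0 = 0%N :> nat /\ t o1 = 2%N :> nat) \/ (t o0 = 1%N :> nat /\ t o1 = 2%N :> nat).
  - move: lt l0 l1; move: (nat_of_ord (t o0)) (nat_of_ord (t o1)) => x y; clear; lia.
  - by case/eqP: n1; apply: det; apply: ord_inj; rewrite ?e0 ?e1 !permE.
  - by case/eqP: nt; apply: det; apply: ord_inj; rewrite ?e0 ?e1 !permE.
  - by case/eqP: nr; apply: det; apply: ord_inj; rewrite ?e0 ?e1 !permE.
rewrite addr0 /jacobi !big_ord_recl big_ord0 addr0 -/X -/r expg0 expg1 /=.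
have -> : (r ^+ (bump 0 (bump 0 0)) = tperm o0 o1 * tperm o1 o2)%g by rewrite -r2E.
rewrite -Defs.actM XN -scaleN1r relabelZ odd_perm1 expr0 scale1r.
have -> : odd_perm r = false by rewrite rE odd_permM !odd_tperm.
by rewrite odd_tperm /= expr0 expr1 scale1r !addrA.
Qed.

End Jacobi.

Section TernaryDifferential.
Variable K : fieldType.
Local Notation T := (toperad K).

Definition bracket (j : nat) : T 2 := giota K 2 (gen_basis K 2 j).

Lemma bracket_anti j : relabel (bracket j) (tperm ord0 ord_max) = - bracket j.
Proof.
rewrite /bracket -(giota_morphism K).2.
have -> : relabel (gen_basis K 2 j) (tperm ord0 ord_max) =
  (-1) ^+ odd_perm (tperm (ord0 : 'I_2) ord_max) *: gen_basis K 2 j by [].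
by rewrite odd_tperm expr1 scaleN1r linearN.
Qed.

(** For n = 3 only k = 2 occurs, the exponent (k - 1)(n - k + 1) is even and the generators involved
    have degree 0; the three shuffles assemble into a Jacobi expression. *)
Lemma diff_ternary (i : 'I_3) : diff (tdg K) (giota K 3 (gen_basis K 3 i)) =
  \sum_(i1 < 2) \sum_(i2 < 2 | (i1 + i2 == i)%N) jacobi (bracket i2) (bracket i1).
Proof.
rewrite cdiff_gen // (big_pred1 ord_max) => [|k]; last first.
  by case: k => [[|[|[|]]] ?].
apply: eq_bigr => i1 _; apply: eq_bigr => i2 _.
rewrite -(sum_shuffles3 (bracket i2) (arity_split (@ord_max 2)) (bracket_anti i1)).
apply: eq_bigr => t _; rewrite /two_vertex_tree exprD scalerA.
have -> : (-1) ^+ (((ord_max : 'I_3) - 1) * (3 - (ord_max : 'I_3) + 1))%N = 1 :> K by rewrite -signr_odd.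
have -> : (-1) ^ (gen_degree (ord_max : 'I_3) * gen_degree (3 - (ord_max : 'I_3)).+1) = 1 :> K by [].
by rewrite !mulr1.
Qed.

End TernaryDifferential.

Lemma sum_pairs2 (V : zmodType) (f : nat -> nat -> V) (i : nat) :
  \sum_(i1 < 2) \sum_(i2 < 2 | (i1 + i2 == i)%N) f i1 i2 =
  match i with 0 => f 0%N 0%N | 1 => f 1%N 0%N + f 0%N 1%N | 2 => f 1%N 1%N | _ => 0 end.
Proof.
rewrite !big_ord_recr big_ord0 big_mkcond /= !big_ord_recr !big_ord0 /= !add0r.
rewrite [X in _ + X]big_mkcond /= !big_ord_recr big_ord0 /= add0r.
by case: i => [|[|[|i]]] /=; rewrite ?addr0 ?add0r // addrC.
Qed.

(** * The morphism defined by a compatible pair *)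

Section LieMap.
Variables (K : fieldType) (P : operad K) (b1 b2 : P 2).
Hypothesis pair : is_compatible_pair b1 b2.
Local Notation T := (toperad K).
Local Notation F n := (cochain K 'I_n).

Definition lie_gen n : gens K n -> P n :=
  match n with 2 => fun v => gcoef v 0 *: b1 + gcoef v 1 *: b2 | _ => fun _ => 0 end.

Fact lie_gen_linear n : linear (@lie_gen n).
Proof.
case: n => [|[|[|n]]] k u v /=; rewrite ?scaler0 ?addr0 //.
have E j : gcoef (k *: u + v) j = k * gcoef u j + gcoef v j by exact: (gcoef_linear j k u v).
by rewrite !E !scalerDl !scalerDr !scalerA addrACA.
Qed.

HB.instance Definition _ n :=
  GRing.isLinear.Build K (gens K n) (P n) *:%R (@lie_gen n) (@lie_gen_linear n).

Lemma lie_gen_ge3 n (v : gens K n) : (3 <= n)%N -> lie_gen v = 0.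
Proof. by case: n v => [|[|[|n]]]. Qed.

Lemma lie_gen_relabel n (v : gens K n) (s : 'S_n) : lie_gen (relabel v s) = relabel (lie_gen v) s.
Proof.
have -> : relabel v s = (-1) ^+ s *: v by [].
rewrite [LHS]linearZ; case: n v s => [|[|[|n]]] v s /=; rewrite ?Defs.act0 ?scaler0 //.
have [[_ a1 _] [_ a2 _] _] := pair.
have R (b : P 2) : relabel b (tperm ord0 ord_max) = - b -> relabel b s = (-1) ^+ s *: b.
  by move=> ab; rewrite {1}(perm2E s); case: (odd_perm s); rewrite ?ab ?Defs.act1 ?scaleN1r ?scale1r.
by rewrite relabelD !relabelZ !R // scalerDr !scalerA ![(-1) ^+ s * _]mulrC.
Qed.

Lemma lie_gen_morphism : is_smodule_morphism (P := gens K) (Q := P) lie_gen.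
Proof.
split; last by move=> n v s; exact: lie_gen_relabel.
move=> n d v hv; change (homog d (lie_gen v)).
case: n v hv => [|[|[|n]]] v hv /=; try exact: homog0.
have [[h1 _ _] [h2 _ _] _] := pair.
case: hv => [dE|v0].
  have -> : d = 0 by move: dE; clear; lia.
  by apply: homog_linear => //; rewrite -[_ *: _]addr0; apply: homog_linear => //; exact: homog0.
have z j : gcoef v j = 0 by rewrite v0 /gcoef big1 // => k _; rewrite mxE.
by rewrite !z !scale0r addr0; exact: homog0.
Qed.

Definition lie_map n : {linear T n -> P n} := @tree_map K P lie_gen n.

Lemma lie_map_morphism : is_operad_morphism (P := T) lie_map.
Proof. exact: tree_map_morphism lie_gen_morphism. Qed.

Lemma lie_map_gens n v : lie_map n (giota K n v) = lie_gen v.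
Proof. exact: (tree_map_gens lie_gen_morphism). Qed.

Lemma lie_map_bracket j : lie_map 2 (bracket K j) = (j == 0)%N%:R *: b1 + (j == 1)%N%:R *: b2.
Proof. 
rewrite lie_map_gens /=.
have [j2|j2] := ltnP j 2; first by rewrite !gcoef_basis // gen_multE.
have z i : (i < 2)%N -> gcoef (gen_basis K 2 j) i = 0.
  by move=> i2; rewrite /gcoef big1 // => k _; rewrite mxE (_ : (k == j :> nat) = false) // ltn_eqF // (leq_trans (ltn_ord k)).
by rewrite !z // !gtn_eqF // (leq_trans _ j2).
Qed.

(** A tree with fewer than n - 1 vertices has a vertex of arity at least 3, which is sent to 0. *)
Lemma mon_low n (c : T n) x (w : word 'I_n) : mon lie_gen c x -> (c : F n) w != 0 ->
  ((size w).+1 < n)%N -> x = 0.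
Proof.
move=> m; elim: m w => {n c x} [|n i n2|n c x _ IH|m n p h i a y b z ma IHa mb IHb|n c x t _ IH] w nz wn.
- by [].
- apply: lie_gen_ge3; move: nz wn; rewrite giotaE /gfun1; case: ifP => _; last by rewrite eqxx.
  by case: w => [|l [|]] //=; rewrite eqxx.
- by rewrite (IH w) ?oppr0 //; rewrite evN oppr_eq0 in nz.
- have n0 := mon_gt0 mb; have m0 := mon_gt0 ma.
  case: p h i w nz wn => [|p] // h i w nz wn.
  have [gw sw na nb] := @pcomp_neq0 K _ _ _ h i a b w n0 nz.
  have sz := size_low_upp (omap (m := m) p n i) (qmap (n := n) p i) w.
  set lo := low _ _ _ in na sz; set up := upp _ _ in nb sz.
  have [lt|ge] := ltnP (size lo).+1 m; first by rewrite (IHa lo) // comp0l.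
  have [lt'|ge'] := ltnP (size up).+1 n; first by rewrite (IHb up) // comp0r.
  exfalso; rewrite -sz in wn; clear - wn ge ge' h n0 m0; lia.
- move: nz; rewrite [X in X != 0]crelabelE mulf_eq0 signr_eq0 /= => nz.
  by rewrite (IH _ nz) ?Defs.act0 // size_map.
Qed.

Lemma lie_map_low n (a : F n) : (forall w, (size w).+1 = n -> a w = 0) -> lie_map n (a : T n) = 0.
Proof.
move=> ha; change (@tree_map K P lie_gen n (a : T n) = 0).
rewrite /tree_map big1 // => A _; have [->|nz] := eqVneq (a (wordof A)) 0; first by rewrite scale0r.
have [mt t1] := treevalP lie_gen (ev_good nz).
rewrite (mon_low (w := wordof A) mt) ?scaler0 ?t1 ?oner_eq0 //.
have := good_size (ev_good nz); rewrite card_ord leq_eqVlt => /orP[/eqP e|//].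
by rewrite ha ?eqxx // in nz.
Qed.

(** The mixed identity comes from expanding the Jacobi identity of [b1 + b2] bilinearly. *)
Lemma jacobi0 : [/\ jacobi b1 b1 = 0, jacobi b2 b2 = 0 & jacobi b1 b2 + jacobi b2 b1 = 0].
Proof.
have [[_ _ j1] [_ _ j2] [_ _ j3]] := pair.
have e1 : jacobi b1 b1 = 0 := j1; have e2 : jacobi b2 b2 = 0 := j2; split=> //.
have : jacobi (b1 + b2) (b1 + b2) = 0 := j3.
by rewrite jacobiDl !jacobiDr e1 e2 add0r addr0.
Qed.

Lemma morph_jacobi (f : forall n, {linear T n -> P n}) (c c' : T 2) : is_operad_morphism f ->
  f 3 (jacobi c c') = jacobi (f 2 c) (f 2 c').
Proof.
by move=> [[_ fs] _ fc]; rewrite linear_sum; apply: eq_bigr => k _; rewrite fs fc.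
Qed.

(** For n at least 4 every two-vertex tree has a vertex of arity at least 3. For n = 3 the three
    values of [i] give the three identities of [jacobi0], and for n = 2 the sum is empty. *)
Lemma lie_map_diff_gen n (i : 'I_n) : (2 <= n)%N ->
  lie_map n (diff (tdg K) (giota K n (gen_basis K n i))) = 0.
Proof.
have [[_ fs] fu fc] := lie_map_morphism; move=> n2.
have fZ p k (x : T p) : lie_map p (k *: x) = k *: lie_map p x by rewrite linearZ.
have [n3|n3] := leqP n 3; last first.
  rewrite cdiff_gen // linear_sum big1 // => k k2; do 2!rewrite linear_sum big1 // => ? _.
  rewrite linear_sum big1 // => t _; rewrite /two_vertex_tree fZ fZ fs fc !lie_map_gens.
  have [k3|k3] := leqP 3 k; first by rewrite (lie_gen_ge3 _ k3) comp0r Defs.act0 !scaler0.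
  by rewrite lie_gen_ge3 ?comp0l ?Defs.act0 ?scaler0 //; clear - n3 k3; lia.
have [e|e] : n = 2%N \/ n = 3%N by clear - n2 n3; lia.
  subst n; rewrite cdiff_gen // big_pred0 ?linear0 // => k; rewrite leqNgt; have := ltn_ord k; by case: ltnP.
subst n; rewrite diff_ternary linear_sum.
have [e1 e2 e3] := jacobi0; have B0 : lie_map 2 (bracket K 0) = b1 by rewrite lie_map_bracket /= scale0r scale1r addr0.
have B1 : lie_map 2 (bracket K 1) = b2 by rewrite lie_map_bracket /= scale0r scale1r add0r.
pose J i1 i2 := lie_map 3 (jacobi (bracket K i2) (bracket K i1)).
transitivity (\sum_(i1 < 2) \sum_(i2 < 2 | (i1 + i2 == i)%N) J i1 i2).
  by apply: eq_bigr => i1 _; rewrite linear_sum.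
rewrite sum_pairs2 /J !(morph_jacobi _ _ lie_map_morphism) B0 B1 e1 e2.
by case: (nat_of_ord i) => [|[|[|]]].
Qed.

Lemma lie_map_diff n (x : T n) : lie_map n (diff (tdg K) (x : tdg K n)) = 0.
Proof.
have [[_ fs] fu fc] := lie_map_morphism.
elim/(@trees_ind K P lie_gen n): x => [|k a b IHa IHb|c x m]; first by rewrite !linear0.
  by rewrite !linearP IHa IHb scaler0 addr0.
elim: m => {n c x} [|n i n2|n c x _ IH|m n p h i a y b z ma IHa mb IHb|n c x s _ IH].
- have -> : diff (tdg K) (unit_op T : tdg K 1) = 0; last by rewrite linear0.
  apply: cochain_eq => w gw; have := good_size gw; rewrite card_ord; case: w gw => // gw _.
  by rewrite [LHS]cdiffE.
- exact: lie_map_diff_gen.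
- by rewrite !linearN IH oppr0.
- have [d [ha _]] := mon_homog lie_gen_morphism ma.
  rewrite (@diff_comp _ (tdg K) _ _ _ h i d a b ha) linearD linearZ /= [X in X + _]fc [X in _ + _ *: X]fc.
  by rewrite [X in Defs.pcomp h i X _ + _]IHa [X in _ *: Defs.pcomp h i _ X]IHb comp0l comp0r scaler0 addr0.
- by rewrite (@diff_act _ (tdg K) _ c s) [LHS]fs [X in relabel X _]IH Defs.act0.
Qed.

End LieMap.

(** * Quotient operads concentrated in degree 0 *)

Record subspace (K : fieldType) (V : lmodType K) := Subspace {
  sub_mem :> V -> Prop;
  sub_mem0 : sub_mem 0;
  sub_mem_linear : forall k x y, sub_mem x -> sub_mem y -> sub_mem (k *: x + y) }.

Section QuotientSpace.
Variables (K : fieldType) (V : lmodType K) (S : subspace V).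

Definition sub_pred : {pred V} := fun x => `[< S x >].

Fact sub_pred_closed : zmod_closed sub_pred.
Proof.
split=> [|x y /asboolP hx /asboolP hy]; apply/asboolP; first exact: sub_mem0.
by rewrite addrC -scaleN1r; exact: sub_mem_linear.
Qed.

HB.instance Definition _ := GRing.isZmodClosed.Build V sub_pred sub_pred_closed.

Definition qspace := Quotient.quot sub_pred.
HB.instance Definition _ := GRing.Zmodule.on qspace.

Definition proj (x : V) : qspace := (\pi x)%qT.

Lemma projP x y : proj x = proj y <-> S (x - y).
Proof.
split=> [/eqP|h]; first by rewrite -(Quotient.idealrBE sub_pred) => /asboolP.
by apply/eqP; rewrite -(Quotient.idealrBE sub_pred); apply/asboolP.
Qed.

Lemma proj_surj q : exists x, q = proj x.
Proof. by exists (generic_quotient.repr q); rewrite /proj reprK. Qed.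

Lemma projD x y : proj (x + y) = proj x + proj y.
Proof. exact: (raddfD (\pi_(qspace)%qT)). Qed.

Lemma proj0E x : proj x = 0 <-> S x.
Proof.
have <- : proj 0 = 0 by exact: (raddf0 (\pi_(qspace)%qT)).
by rewrite projP subr0.
Qed.

Definition qscale k (q : qspace) : qspace := proj (k *: generic_quotient.repr q).

Lemma qscale_proj k x : qscale k (proj x) = proj (k *: x).
Proof.
apply/projP; rewrite -scalerBr -[_ *: _]addr0; apply: sub_mem_linear; last exact: sub_mem0.
by apply/projP; rewrite /proj reprK.
Qed.

Fact qscaleA a b q : qscale a (qscale b q) = qscale (a * b) q.
Proof. by have [x ->] := proj_surj q; rewrite !qscale_proj scalerA. Qed.

Fact qscale1 : left_id 1 qscale.
Proof. by move=> q; have [x ->] := proj_surj q; rewrite qscale_proj scale1r. Qed.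

Fact qscaleDr : right_distributive qscale +%R.
Proof.
move=> k q q'; have [x ->] := proj_surj q; have [y ->] := proj_surj q'.
by rewrite -projD !qscale_proj scalerDr projD.
Qed.

Fact qscaleDl q : {morph qscale^~ q : a b / a + b}.
Proof. by move=> a b; have [x ->] := proj_surj q; rewrite !qscale_proj scalerDl projD. Qed.

HB.instance Definition _ :=
  GRing.Zmodule_isLmodule.Build K qspace qscaleA qscale1 qscaleDr qscaleDl.

Lemma projZ k x : proj (k *: x) = k *: proj x.
Proof. by rewrite -qscale_proj. Qed.

Fact proj_linear : linear proj.
Proof. by move=> k x y; rewrite projD projZ. Qed.

HB.instance Definition _ := GRing.isLinear.Build K V qspace *:%R proj proj_linear.

(* Only used for quotients all of whose classes are represented in degree 0. *)
Definition qhomog (d : int) (q : qspace) := d = 0 \/ q = 0.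

Fact qhomog0 d : qhomog d 0. Proof. by right. Qed.

Fact qhomog_linear d (k : K) x y : qhomog d x -> qhomog d y -> qhomog d (k *: x + y).
Proof.
by case=> [e|->]; [left | case=> [e|->]; [left | right; rewrite scaler0 addr0]].
Qed.

Fact qhomog_span x : exists (s : seq int) (f : int -> qspace),
  (forall d, qhomog d (f d)) /\ x = \sum_(d <- s) f d.
Proof.
exists [:: 0], (fun d => if d == 0 then x else 0); rewrite big_seq1 eqxx; split=> // d.
by case: eqP => [e|_]; [left | right].
Qed.

Fact qhomog_indep (s : seq int) (f : int -> qspace) : uniq s ->
  (forall d, qhomog d (f d)) -> \sum_(d <- s) f d = 0 -> forall d, d \in s -> f d = 0.
Proof.
move=> us hf sum0 d ds; case: (hf d) => // d0.
move: sum0; rewrite (bigD1_seq d) //= big1 ?addr0 // => e ne.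
by case: (hf e) => // e0; rewrite d0 e0 in ne.
Qed.

Definition qgraded : graded_space K := GradedSpace qhomog0 qhomog_linear qhomog_span qhomog_indep.

End QuotientSpace.

Section QuotientOperad.
Variables (K : fieldType) (P : operad K) (I : forall n, subspace (P n)).
Hypothesis I_act : forall n (x : P n) s, I n x -> I n (relabel x s).
Hypothesis I_compl : forall m n p (h : (m + n = p.+1)%N) i (a : P m) (b : P n),
  I m a -> I p (Defs.pcomp h i a b).
Hypothesis I_compr : forall m n p (h : (m + n = p.+1)%N) i (a : P m) (b : P n),
  I n b -> I p (Defs.pcomp h i a b).
Hypothesis I_deg0 : forall n (x : P n), exists y, homog 0 y /\ I n (x - y).
Hypothesis I_homog : forall n d (x : P n), homog d x -> d != 0 -> I n x.

Local Notation Q n := (qgraded (I n)).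
Local Notation pr := (proj (I _)).
Implicit Types m n p q l : nat.

(** With representatives of degree 0 the Koszul sign in [comp_par] is trivial, and the quotient may
    be placed in degree 0. *)
Lemma proj_deg0 n (q : Q n) : exists x : P n, homog 0 x /\ q = pr x.
Proof.
have [x ->] := proj_surj q; have [y [hy Iy]] := I_deg0 x.
by exists y; split=> //; apply/projP.
Qed.

Definition qrelabel n (q : Q n) (s : 'S_n) : Q n := pr (relabel (generic_quotient.repr q) s).

Definition qpcomp m n p (h : (m + n = p.+1)%N) i (a : Q m) (b : Q n) : Q p :=
  pr (Defs.pcomp h i (generic_quotient.repr a) (generic_quotient.repr b)).

Lemma repr_proj n (x : P n) : I n (generic_quotient.repr (pr x : qspace (I n)) - x).
Proof. by apply/projP; rewrite /proj reprK. Qed.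

Lemma qrelabelE n (x : P n) s : qrelabel (pr x) s = pr (relabel x s).
Proof.
apply/projP; rewrite -scaleN1r -relabelZ -relabelD scaleN1r.
exact: I_act (repr_proj x).
Qed.

Lemma qpcompE m n p (h : (m + n = p.+1)%N) i (a : P m) (b : P n) :
  qpcomp h i (pr a) (pr b) = pr (Defs.pcomp h i a b).
Proof.
rewrite /qpcomp; set a' := generic_quotient.repr _; set b' := generic_quotient.repr _.
transitivity (pr (Defs.pcomp h i a b') : Q p); apply/projP.
  have -> : Defs.pcomp h i a' b' - Defs.pcomp h i a b' = Defs.pcomp h i (a' - a) b'.
    by rewrite -scaleN1r addrC -(comp_linearl h i b') scaleN1r addrC.
  exact: I_compl (repr_proj a).
have -> : Defs.pcomp h i a b' - Defs.pcomp h i a b = Defs.pcomp h i a (b' - b).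
  by rewrite -scaleN1r addrC -(comp_linearr h i a) scaleN1r addrC.
exact: I_compr (repr_proj b).
Qed.

Fact qact_linear n (s : 'S_n) : linear (fun q : Q n => qrelabel q s).
Proof.
move=> k q q'; have [x [_ ->]] := proj_deg0 q; have [y [_ ->]] := proj_deg0 q'.
by rewrite -(proj_linear (I n)) !qrelabelE -(proj_linear (I n)) (act_linear s k).
Qed.

Fact qact_homog n (s : 'S_n) d (q : Q n) : homog d q -> homog d (qrelabel q s).
Proof.
move=> [e|q0]; [by left | right]; rewrite q0.
have -> : (0 : Q n) = pr 0 by apply/esym/proj0E; exact: sub_mem0.
by rewrite qrelabelE Defs.act0.
Qed.

Fact qact1 n (q : Q n) : qrelabel q 1%g = q.
Proof. by have [x [_ ->]] := proj_deg0 q; rewrite qrelabelE Defs.act1. Qed.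

Fact qactM n (q : Q n) (s t : 'S_n) : qrelabel (qrelabel q s) t = qrelabel q (s * t)%g.
Proof. by have [x [_ ->]] := proj_deg0 q; rewrite !qrelabelE Defs.actM. Qed.

Definition qsmodule : smodule K := @SModule K (fun n => Q n) qrelabel qact_linear qact_homog qact1 qactM.

Fact qcomp_linearl m n p (h : (m + n = p.+1)%N) i (b : Q n) : linear (fun a : Q m => qpcomp h i a b).
Proof.
move=> k q q'; have [x [_ ->]] := proj_deg0 q; have [y [_ ->]] := proj_deg0 q'.
have [z [_ ->]] := proj_deg0 b.
by rewrite -(proj_linear (I m)) !qpcompE -(proj_linear (I p)) (comp_linearl h i z k).
Qed.

Fact qcomp_linearr m n p (h : (m + n = p.+1)%N) i (a : Q m) : linear (qpcomp h i a : Q n -> Q p).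
Proof.
move=> k q q'; have [x [_ ->]] := proj_deg0 q; have [y [_ ->]] := proj_deg0 q'.
have [z [_ ->]] := proj_deg0 a.
by rewrite -(proj_linear (I n)) !qpcompE -(proj_linear (I p)) (comp_linearr h i z k).
Qed.

Fact qcomp_homog m n p (h : (m + n = p.+1)%N) i d e (a : Q m) (b : Q n) :
  homog d a -> homog e b -> homog (d + e) (qpcomp h i a b).
Proof.
have L := qcomp_linearl h i b (-1) 0 0; have R := qcomp_linearr h i a (-1) 0 0.
rewrite scaler0 addr0 scaleN1r addNr in L; rewrite scaler0 addr0 scaleN1r addNr in R.
case=> [->|->]; last by right.
by case=> [->|->]; [left; rewrite addr0 | right].
Qed.

Definition qoperad : operad K.
Proof.
refine (@Operad K qsmodule (pr (unit_op P)) qpcomp _ qcomp_linearl qcomp_linearr qcomp_homog _ _ _ _ _).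
- by left.
- by move=> n h i a; have [x [_ ->]] := proj_deg0 a; rewrite qpcompE Defs.comp1l.
- by move=> n h i a; have [x [_ ->]] := proj_deg0 a; rewrite qpcompE Defs.comp1r.
- move=> m n l q r p hab hab_c hbc ha_bc i j x a b c xE.
  have [a' [_ ->]] := proj_deg0 a; have [b' [_ ->]] := proj_deg0 b; have [c' [_ ->]] := proj_deg0 c.
  by rewrite !qpcompE (Defs.comp_seq hab hab_c hbc ha_bc a' b' c' xE).
- move=> m n l q r p hab hab_c hac hac_b i k x y d e a b c ik xE yE hb hc.
  have [a' [_ ->]] := proj_deg0 a; have [b' [hb' bE]] := proj_deg0 b; have [c' [hc' cE]] := proj_deg0 c.
  have E : qpcomp hab_c x (qpcomp hab i (pr a') b) c = qpcomp hac_b y (qpcomp hac k (pr a') c) b.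
    by rewrite bE cE !qpcompE (Defs.comp_par hab hab_c hac hac_b a' ik xE yE hb' hc') scale1r.
  rewrite E; case: hb => [->|b0]; last first.
    have R := qcomp_linearr hac_b y (qpcomp hac k (pr a') c) (-1) 0 0.
    by rewrite scaler0 addr0 scaleN1r addNr in R; rewrite b0 R scaler0.
  by rewrite mul0r expr0z scale1r.
- move=> m n p h i s t r a b r1 r2.
  have [a' [_ ->]] := proj_deg0 a; have [b' [_ ->]] := proj_deg0 b.
  rewrite [qsmodule.(relabel) _ s]qrelabelE [qsmodule.(relabel) _ t]qrelabelE !qpcompE.
  by rewrite [RHS]qrelabelE (Defs.comp_act h a' b' r1 r2).
Defined.

Definition qproj n : {linear P n -> qoperad n} := @proj K (P n) (I n).

Lemma qproj_morphism : is_operad_morphism qproj.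
Proof.
split=> [||m n p h i a b]; last by rewrite [RHS]qpcompE.
- split=> [n d x hx|n x s]; last by rewrite [RHS]qrelabelE.
  have [->|d0] := eqVneq d 0; first by left.
  by right; apply/proj0E; exact: I_homog hx d0.
- by [].
Qed.

End QuotientOperad.

(** * The homology in degree 0 as a quotient operad *)

Section TreeIdeal.
Variable K : fieldType.
Local Notation T := (toperad K).
Local Notation F n := (cochain K 'I_n).
Implicit Types m n p : nat.

Definition vanishes_on_top n (a : F n) := forall w, (size w).+1 = n -> a w = 0.

(* Boundaries and elements of negative degree: the quotient is the homology in
   degree 0, as an operad. *)
Definition exact_top n (x : T n) := exists z : T n, vanishes_on_top (x - cdiff z : F n).

Fact exact_top0 n : exact_top (0 : T n).
Proof. by exists 0 => w _; rewrite linear0 subr0 ev0. Qed.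

Fact exact_top_linear n k (x y : T n) : exact_top x -> exact_top y -> exact_top (k *: x + y).
Proof.
move=> [z hz] [z' hz']; exists (k *: z + z') => w sw.
have -> : (k *: x + y - cdiff (k *: z + z') : F n) = k *: (x - cdiff z) + (y - cdiff z').
  by rewrite linearP scalerBr opprD addrACA.
by rewrite evD evZ hz // hz' // mulr0 addr0.
Qed.

Definition top_ideal n : subspace (T n) := Subspace (@exact_top0 n) (@exact_top_linear n).

Lemma exact_top_diff n (z : F n) : exact_top (cdiff z : T n).
Proof. by exists z => w _; rewrite subrr ev0. Qed.

Lemma exact_top_vanish n (x : F n) : vanishes_on_top x -> exact_top (x : T n).
Proof. by move=> hx; exists 0 => w sw; rewrite linear0 subr0 hx. Qed.

(** A binary tree already has the largest possible number of vertices, so everything in degree 0 is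
    closed. *)
Lemma cdiff_top n (a : F n) : (forall w, a w != 0 -> (size w).+1 = n) -> cdiff a = 0.
Proof.
move=> ha; apply: cochain_eq => w gw; rewrite cdiffE //; apply: Dsum0 => C u v E.
case: ifP => // _; apply/eqP/negPn/negP => /ha; rewrite size_mkw => s1.
have sw : size w = (size (u ++ v)).+1.
  by rewrite -(size_map fst w) -/(cl w) E !size_cat /= addnS.
by have := good_size gw; rewrite card_ord sw s1 ltnn.
Qed.

Definition top n (a : F n) : F n := cut (fun s => s.+1 == n) a.

Lemma top_homog n (a : F n) : homog 0 (top a : T n).
Proof.
move=> w; rewrite cutE; case: ifP => [/eqP e _|_]; last by rewrite eqxx.
by rewrite /wdeg card_ord; clear - e; lia.
Qed.

Lemma top_vanish n (a : F n) : vanishes_on_top (a - top a).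
Proof. by move=> w sw; rewrite [LHS]evD evN cutE sw eqxx subrr. Qed.

Lemma cdiff_top0 n (a : F n) : cdiff (top a) = 0.
Proof. by apply: cdiff_top => w; rewrite cutE; case: ifP => [/eqP //|_]; rewrite eqxx. Qed.

(** Degrees are never positive, so a composite has a component in degree 0 only if both factors
    do. *)
Lemma vanish_compl m n p (h : (m + n = p.+1)%N) i (a : F m) (b : F n) :
  vanishes_on_top a -> vanishes_on_top (Defs.pcomp h i (a : T m) (b : T n) : F p).
Proof.
move=> ha w sw; apply/eqP/negPn/negP => nz.
have n0 : (0 < n)%N by case: n h b nz => // h b; rewrite [b]cochain_ord0 comp0r ev0 eqxx.
case: p h w sw nz => [|p] // h w sw nz.
have [gw sat na nb] := @pcomp_neq0 K _ _ _ h i a b w n0 nz.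
have sz := size_low_upp (omap (m := m) p n i) (qmap (n := n) p i) w.
have := good_size (ev_good nb); have := good_size (ev_good na); rewrite !card_ord.
set lo := low _ _ _ in na sz *; set up := upp _ _ in nb sz * => l1 l2.
have E : (size lo + size up)%N = p by move: sw; rewrite -sz => -[].
case/negP: na; rewrite ha //; move: E l1 l2; move: (size lo) (size up) => x y; clear - h; lia.
Qed.

Lemma vanish_compr m n p (h : (m + n = p.+1)%N) i (a : F m) (b : F n) :
  vanishes_on_top b -> vanishes_on_top (Defs.pcomp h i (a : T m) (b : T n) : F p).
Proof.
move=> ha w sw; apply/eqP/negPn/negP => nz.
have n0 : (0 < n)%N by case: n h b ha nz => // h b ha; rewrite [b]cochain_ord0 comp0r ev0 eqxx.
case: p h w sw nz => [|p] // h w sw nz.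
have [gw sat na nb] := @pcomp_neq0 K _ _ _ h i a b w n0 nz.
have sz := size_low_upp (omap (m := m) p n i) (qmap (n := n) p i) w.
have := good_size (ev_good nb); have := good_size (ev_good na); rewrite !card_ord.
set lo := low _ _ _ in na sz *; set up := upp _ _ in nb sz * => l1 l2.
have E : (size lo + size up)%N = p by move: sw; rewrite -sz => -[].
case/negP: nb; rewrite ha //; move: E l1 l2; move: (size lo) (size up) => x y; clear - h; lia.
Qed.

(** The Leibniz rule holds for homogeneous [a]; the components can be summed because the term with
    the degree-dependent sign vanishes. *)
Lemma diff_comp_cocycle m n p (h : (m + n = p.+1)%N) i (a : T m) (b : T n) : cdiff b = 0 ->
  cdiff (Defs.pcomp h i a b) = Defs.pcomp h i (cdiff a : T m) b.
Proof.
move=> db; have [s [f [hf ->]]] := homog_span a.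
elim: s => [|d s IH]; first by rewrite big_nil !linear0 !comp0l linear0.
have compD (x y : T m) : Defs.pcomp h i (x + y) b = Defs.pcomp h i x b + Defs.pcomp h i y b.
  by have := comp_linearl h i b 1 x y; rewrite !scale1r.
have dD q (x y : F q) : cdiff (x + y) = cdiff x + cdiff y by rewrite linearD.
rewrite big_cons compD [LHS]dD IH (dD m) [RHS]compD; congr (_ + _).
have := @diff_comp _ (tdg K) _ _ _ h i d _ b (hf d).
by rewrite [X in _ *: Defs.pcomp h i _ X](db : diff (tdg K) (b : tdg K n) = 0) comp0r scaler0 addr0.
Qed.

Lemma top_ideal_act n (x : T n) s : top_ideal n x -> top_ideal n (relabel x s).
Proof.
move=> [z hz]; exists (relabel z s) => w sw.
have -> : (relabel x s - cdiff (relabel z s) : F n) = relabel (x - cdiff z : T n) s.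
  rewrite [RHS](relabelD (x : T n)) [X in _ = _ + X](relabelN (cdiff z : T n)); congr (_ - _).
  exact: cdiff_relabel.
by rewrite [LHS]crelabelE hz ?mulr0 // size_map.
Qed.

Lemma top_split n (x : T n) : exists y : T n, [/\ homog 0 y, cdiff (y : F n) = 0 & vanishes_on_top (x - y : F n)].
Proof. by exists (top x); split; [exact: top_homog | exact: cdiff_top0 | exact: top_vanish]. Qed.

Lemma comp_splitl (Q : operad K) m n p (h : (m + n = p.+1)%N) i (x y : Q m) (b : Q n) :
  Defs.pcomp h i x b = 1 *: Defs.pcomp h i (x - y) b + Defs.pcomp h i y b.
Proof. by have := comp_linearl h i b 1 (x - y) y; rewrite scale1r subrK. Qed.

Lemma comp_splitr (Q : operad K) m n p (h : (m + n = p.+1)%N) i (a : Q m) (x y : Q n) :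
  Defs.pcomp h i a x = 1 *: Defs.pcomp h i a (x - y) + Defs.pcomp h i a y.
Proof. by have := comp_linearr h i a 1 (x - y) y; rewrite scale1r subrK. Qed.

(** Up to negative degree, [a] is a boundary dz and [b] is its degree-0 part b0, which is closed;
    then dz o b0 is the boundary of z o b0. *)
Lemma top_ideal_compl m n p (h : (m + n = p.+1)%N) i (a : T m) (b : T n) :
  top_ideal m a -> top_ideal p (Defs.pcomp h i a b).
Proof.
move=> [z hz]; have [b0 [_ db0 hb]] := top_split b.
rewrite (comp_splitl h i a (cdiff z : T m)) (comp_splitr h i (cdiff z : T m) b b0).
apply: sub_mem_linear; first by apply: exact_top_vanish; exact: vanish_compl.
apply: sub_mem_linear; first by apply: exact_top_vanish; exact: vanish_compr.
by rewrite -diff_comp_cocycle //; exact: exact_top_diff.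
Qed.

Lemma top_ideal_compr m n p (h : (m + n = p.+1)%N) i (a : T m) (b : T n) :
  top_ideal n b -> top_ideal p (Defs.pcomp h i a b).
Proof.
move=> [z hz]; have [a0 [ha0 da0 ha]] := top_split a.
rewrite (comp_splitr h i a b (cdiff z : T n)) (comp_splitl h i a a0 (cdiff z : T n)).
apply: sub_mem_linear; first by apply: exact_top_vanish; exact: vanish_compr.
apply: sub_mem_linear; first by apply: exact_top_vanish; exact: vanish_compl.
have := @diff_comp _ (tdg K) _ _ _ h i 0 a0 z ha0.
have da0' : diff (tdg K) (a0 : tdg K m) = 0 := da0.
rewrite da0' comp0l add0r expr0z scale1r => <-.
exact: exact_top_diff.
Qed.

Lemma top_ideal_deg0 n (x : T n) : exists y : T n, homog 0 y /\ top_ideal n (x - y).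
Proof.
by have [y [hy _ hxy]] := top_split x; exists y; split=> //; exact: exact_top_vanish.
Qed.

Lemma top_ideal_homog n d (x : T n) : homog d x -> d != 0 -> top_ideal n x.
Proof.
move=> hx d0; apply: exact_top_vanish => w sw; apply: contraNeq d0 => /hx <-.
by apply/eqP; rewrite /wdeg card_ord; clear - sw; lia.
Qed.

Definition top_operad : operad K :=
  qoperad top_ideal_act top_ideal_compl top_ideal_compr top_ideal_deg0.

Definition top_proj n : {linear T n -> top_operad n} := qproj top_ideal_act top_ideal_compl top_ideal_compr top_ideal_deg0 n.

Lemma top_proj_morphism : is_operad_morphism (P := T) top_proj.
Proof. exact: qproj_morphism top_ideal_homog. Qed.

Lemma top_proj0 n (x : T n) : top_proj n x = 0 <-> exact_top x.
Proof. exact: (proj0E (top_ideal n)). Qed.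

Lemma top_proj_surj n (q : top_operad n) : exists x : T n, [/\ homog 0 x, cdiff (x : F n) = 0 & q = top_proj n x].
Proof.
have [x qE] := proj_surj q; have [y [hy dy hxy]] := top_split x.
exists y; split=> //; rewrite qE; apply/projP; exact: exact_top_vanish.
Qed.

End TreeIdeal.

(** * Comparison of the degree-0 homology with the presented operad *)

Section Resolution.
Variables (K : fieldType) (L : operad K) (b1 b2 : L 2).
Hypothesis L_Lie2 : is_Lie2 b1 b2.
Local Notation T := (toperad K).
Local Notation F n := (cochain K 'I_n).
Local Notation phi := (lie_map b1 b2).
Local Notation Q := (top_operad K).
Local Notation q := (top_proj K).
Implicit Types m n p : nat.

Let pair : is_compatible_pair b1 b2. Proof. by case: L_Lie2. Qed.

Lemma phi_top_ideal n (x : T n) : exact_top x -> phi n x = 0.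
Proof.
move=> [z hz]; rewrite -[x](subrK (cdiff z : T n)) linearD (lie_map_low b1 b2 hz) add0r.
exact: (lie_map_diff pair z).
Qed.

Lemma q_diff n (x : T n) : q n (cdiff x : T n) = 0.
Proof. by apply/top_proj0; exact: exact_top_diff. Qed.

Lemma q_gens n (v : gens K n) : (3 <= n)%N -> q n (giota K n v) = 0.
Proof.
move=> n3; apply/top_proj0/exact_top_vanish => w sw.
change (gfun1 v w = 0); rewrite /gfun1; case: ifP => // _.
by case: w sw => [|l [|]] //= e; rewrite -e in n3.
Qed.

Lemma q_bracket_pair : is_compatible_pair (q 2 (bracket K 0)) (q 2 (bracket K 1)).
Proof.
have J (i : 'I_3) : \sum_(i1 < 2) \sum_(i2 < 2 | (i1 + i2 == i)%N)
    jacobi (q 2 (bracket K i2)) (q 2 (bracket K i1)) = 0.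
  transitivity (q 3 (cdiff (giota K 3 (gen_basis K 3 i)) : T 3)); last exact: q_diff.
  rewrite [cdiff _]diff_ternary linear_sum.
  apply: eq_bigr => i1 _; rewrite linear_sum; apply: eq_bigr => i2 _.
  by rewrite (morph_jacobi _ _ (top_proj_morphism K)).
have S i := sum_pairs2 (fun i1 i2 => jacobi (q 2 (bracket K i2)) (q 2 (bracket K i1))) i.
have A j : relabel (q 2 (bracket K j)) (tperm ord0 ord_max) = - q 2 (bracket K j).
  by have [[_ qs] _ _] := top_proj_morphism K; rewrite -qs bracket_anti linearN.
have J0 := J ord0; have J1 := J (lift ord0 ord0); have J2 := J ord_max.
rewrite S /= in J0; rewrite S /= in J1; rewrite S /= in J2.
split; split=> //; try by left.
  by rewrite relabelD !A opprD.
change (jacobi (q 2 (bracket K 0) + q 2 (bracket K 1)) (q 2 (bracket K 0) + q 2 (bracket K 1)) = 0).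
by rewrite jacobiDl !jacobiDr J0 J2 add0r addr0.
Qed.

Section Comparison.
Variable f : forall n, {linear L n -> Q n}.
Hypotheses (fM : is_operad_morphism f) (f1 : f 2 b1 = q 2 (bracket K 0)) (f2 : f 2 b2 = q 2 (bracket K 1)).

Lemma comp_morphism (P P' P'' : operad K) (u : forall n, {linear P n -> P' n})
    (v : forall n, {linear P' n -> P'' n}) : is_operad_morphism u -> is_operad_morphism v ->
  is_operad_morphism (fun n => v n \o u n : {linear P n -> P'' n}).
Proof.
move=> [[uh us] uu uc] [[vh vs] vu vc]; split=> [||m n p h i a b /=]; last by rewrite uc vc.
- by split=> [n d x hx|n x s] /=; [exact/vh/uh | rewrite us vs].
- by rewrite /= uu vu.
Qed.

Lemma gens2 (v : gens K 2) : v = gcoef v 0 *: gen_basis K 2 0 + gcoef v 1 *: gen_basis K 2 1.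
Proof.
have E (i : 'I_2) : gcoef v i = (v : 'rV[K]_2) 0 i.
  rewrite /gcoef (big_pred1 (i : 'I_(gen_mult 2))) //.
apply/rowP => j; rewrite !mxE (E ord0) (E ord_max).
case: j => [[|[|]] // h]; rewrite /= ?mulr1 ?mulr0 ?addr0 ?add0r; congr ((v : 'rV[K]_2) _ _); exact: ord_inj.
Qed.

(** Both sides extend the same map on the generators, and [giota_free] gives uniqueness. In arity at
    least 3 both kill the generators, which have negative degree. *)
Lemma f_phi n (x : T n) : f n (phi n x) = q n x.
Proof.
have gM : is_smodule_morphism (P := gens K) (Q := Q) (fun n => q n \o giota K n : {linear gens K n -> Q n}).
  have [[qh qs] _ _] := top_proj_morphism K; have [gh gs] := giota_morphism K.
  by split=> [m d v hv|m v s] /=; [exact/qh/gh | rewrite gs qs].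
have [u [_ _ uU]] := (giota_free K).2 Q _ gM.
rewrite (uU q (top_proj_morphism K)) //.
apply: (uU (fun n => f n \o phi n : {linear T n -> Q n})).
  exact: comp_morphism (lie_map_morphism pair) fM.
move=> m v /=; rewrite lie_map_gens //.
case: m v => [|[|[|m]]] v.
- by rewrite [v](_ : _ = 0) ?linear0 //; apply/rowP => -[].
- by rewrite [v](_ : _ = 0) ?linear0 //; apply/rowP => -[].
- rewrite /= linearP linearZ /= f1 f2 {3}(gens2 v) !linearD !linearZ //.
- by rewrite lie_gen_ge3 // linear0 q_gens.
Qed.

Definition psi_fun n (x : Q n) : L n := phi n (generic_quotient.repr x).

Lemma psi_proj n (x : T n) : psi_fun (q n x) = phi n x.
Proof.
apply/eqP; rewrite -subr_eq0 -linearB; apply/eqP/phi_top_ideal.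
exact: (@repr_proj K _ (@top_ideal K) n x).
Qed.

Fact psi_linear n : linear (@psi_fun n).
Proof.
move=> k x y; have [x' [_ _ ->]] := top_proj_surj x; have [y' [_ _ ->]] := top_proj_surj y.
by rewrite -linearP !psi_proj linearP.
Qed.

HB.instance Definition _ n := GRing.isLinear.Build K (Q n) (L n) *:%R (@psi_fun n) (@psi_linear n).

Definition psi n : {linear Q n -> L n} := @psi_fun n.

Lemma psi_morphism : is_operad_morphism psi.
Proof.
have [[ph ps] pu pc] := lie_map_morphism pair; have [[qh qs] qu qc] := top_proj_morphism K.
split; first split.
- move=> n d x hx; have [x' [hx' _ xE]] := top_proj_surj x.
  case: hx => [->|->]; last by rewrite linear0; exact: homog0.
  by rewrite xE [psi _ _]psi_proj; exact: ph.
- move=> n x s; have [x' [_ _ ->]] := top_proj_surj x.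
  by rewrite -qs [LHS]psi_proj ps [X in _ = relabel X _]psi_proj.
- by rewrite -qu [LHS]psi_proj pu.
- move=> m n p h i a b; have [a' [_ _ ->]] := top_proj_surj a; have [b' [_ _ ->]] := top_proj_surj b.
  by rewrite -qc [LHS]psi_proj pc [X in _ = Defs.pcomp _ _ X _]psi_proj [X in _ = Defs.pcomp _ _ _ X]psi_proj.
Qed.

(** The composite is an endomorphism of [L] fixing [b1] and [b2], hence the identity by the
    uniqueness clause of [is_Lie2]. *)
Lemma psi_f n (y : L n) : psi n (f n y) = y.
Proof.
have [_ U] := L_Lie2; have [u [_ _ _ uU]] := U L b1 b2 pair.
have idM : is_operad_morphism (fun n => idfun : {linear L n -> L n}) by [].
rewrite -[RHS]/((idfun : {linear L n -> L n}) y) (uU (fun n => idfun : {linear L n -> L n})) //.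
apply: (uU (fun n => psi n \o f n : {linear L n -> L n})).
- exact: comp_morphism fM psi_morphism.
- rewrite /= f1 [LHS]psi_proj; rewrite lie_map_bracket //= scale1r scale0r addr0 //.
- rewrite /= f2 [LHS]psi_proj; rewrite lie_map_bracket //= scale1r scale0r add0r //.
Qed.

End Comparison.

Lemma phi_quasi_isomorphism :
  is_quasi_isomorphism (P := tdg K) (Q := zero_dg L) (phi : forall n, {linear tdg K n -> zero_dg L n}).
Proof.
have [_ U] := L_Lie2; have [f [fM f1 f2 _]] := U Q _ _ q_bracket_pair.
split=> [|n x|n x dx [y phix]|n y _].
- exact: (lie_map_morphism pair).
- exact: (lie_map_diff pair x).
(* A boundary in [zero_dg L] is 0, so [phi] kills [x] and hence so does [q]. *)
- have [z hz] : exact_top (x : T n).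
    by apply/top_proj0; rewrite -(f_phi fM f1 f2) [lie_map _ _ _ _]phix linear0.
  (* Once dz has been subtracted nothing is left in degree 0, and acyclicity applies. *)
  have [u uE] : exists u, (x - cdiff z : F n) = cdiff u.
    apply: cdiff_acyclic; first by rewrite linearB /= cdiff_sq subr0.
    by move=> w; rewrite card_ord; exact: hz.
  exists (u + z : F n); change ((x : F n) = cdiff (u + z)).
  by rewrite linearD /= -uE subrK.
- have [x [_ dx xE]] := top_proj_surj (f n y).
  exists x; split=> //; exists 0; rewrite linear0; apply/eqP; rewrite subr_eq0; apply/eqP.
  by rewrite -(psi_f fM f1 f2 y) xE [RHS]psi_proj.
Qed.

End Resolution.

Theorem corollary5p5p1 (K : fieldType) (charK0 : [pchar K] =i pred0)
    (L : operad K) (b1 b2 : L 2%N) (L_Lie2 : is_Lie2 b1 b2) :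
  exists (F : dg_operad K) (iota : forall n, {linear gens K n -> F n})
         (phi : forall n, {linear F n -> zero_dg L n}),
    is_minimal_resolution iota phi /\
    forall n : nat, (2 <= n)%N -> forall i : 'I_n,
      diff F (iota n (gen_basis K n i)) =
        \sum_(k < n | (2 <= k)%N)
        \sum_(i1 < k) \sum_(i2 < (n - k).+1 | (i1 + i2 == i)%N)
        \sum_(t : 'S_n | is_shuffle k t)
          (-1) ^+ (odd_perm t + (k - 1) * (n - k + 1))%N *:
          two_vertex_tree t (gen_degree k) (gen_degree (n - k).+1)
            (iota k (gen_basis K k i1))
            (iota (n - k).+1 (gen_basis K (n - k).+1 i2)).
Proof.
exists (tdg K), (giota K), (lie_map b1 b2); split; last by move=> n n2 i; exact: cdiff_gen.
split; [exact: giota_free | exact: phi_quasi_isomorphism | exact: giota_minimal].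
Qed.
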